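(* There exist closed non-manifold Alexandrov $3$-spaces $P$, $Q$ and points $p_1,p_2\in P$, $q_1,q_2\in Q$ (with $\Sigma_{p_i}\approx\Sigma_{q_i}$ for $i=1,2$, so that the connected sums below are defined) such that $P\#^{p_1,q_1}Q$ and $P\#^{p_2,q_2}Q$ are not homeomorphic.
   Context: Alexandrov spaces are complete, locally compact length spaces of finite Hausdorff dimension with curvature bounded below in the triangle comparison sense. A closed Alexandrov $3$-space is a compact $3$-dimensional Alexandrov space without boundary. Write $\approx$ for homeomorphism and $P^2$ for the real projective plane. In a closed Alexandrov $3$-space $P$, the space of directions $\Sigma_p$ at any point $p$ is homeomorphic to $S^2$ ($p$ is topologically regular) or to $P^2$ ($p$ is topologically singular), and $p$ has a small open neighborhood homeomorphic to the open cone $K_p$ over $\Sigma_p$. The space $P$ is a $3$-manifold if and only if it has no topologically singular points. Topologically, the closed non-manifold Alexandrov $3$-spaces are exactly the spaces obtained from a compact connected non-orientable $3$-manifold whose boundary is a non-empty union of an even number of projective planes by capping off each boundary component with a cone over $P^2$. Connected sum: let $P,Q$ be closed Alexandrov $3$-spaces, $p\in P$, $q\in Q$ with $K_p\approx K_q$ (equivalently $\Sigma_p\approx\Sigma_q$). Let $U_p\subset P$ and $V_q\subset Q$ be open (regular) cone neighborhoods of $p$, $q$ homeomorphic to $K_p$, $K_q$, so that $\partial(P\setminus U_p)\approx\Sigma_p$ and $\partial(Q\setminus V_q)\approx\Sigma_q$, and let $\varphi\colon\partial(P\setminus U_p)\to\partial(Q\setminus V_q)$ be a homeomorphism. Then $P\#^{p,q}Q=\big((P\setminus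 U_p)\sqcup(Q\setminus V_q)\big)/_{w\sim\varphi(w)}$; the choices of $U_p,V_q,\varphi$ are suppressed in the notation. *)

(* Defs.v *)
From HB Require Import structures.
From mathcomp Require Import all_boot all_order all_algebra.
From mathcomp Require Import all_classical all_reals all_analysis.
From Stdlib Require Relation_Operators.

Set Implicit Arguments.
Unset Strict Implicit.
Unset Printing Implicit Defensive.

Import Order.TTheory GRing.Theory Num.Theory.
Import numFieldNormedType.Exports.

Local Open Scope classical_set_scope.
Local Open Scope ring_scope.
Local Open Scope quotient_scope.

Definition is_homeomorphism (X Y : topologicalType) (f : X -> Y) : Prop :=
  continuous f /\
  exists g : Y -> X, [/\ cancel f g, cancel g f & continuous g].

Definition homeomorphic (X Y : topologicalType) : Prop :=
  exists f : X -> Y, is_homeomorphism f.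

Definition frontier (X : topologicalType) (A : set X) : set X :=
  closure A `\` A°.

Definition topological_manifold (R : realType) (n : nat) (X : topologicalType) :
    Prop :=
  [/\ hausdorff_space X, @second_countable X &
    forall x : X, exists U : set X, [/\ open U, U x & homeomorphic U 'rV[R]_n]].

(* The quotient of a topological space by the equivalence relation generated
   by an arbitrary relation r. *)
Section quotient_by_relation.
Variables (T : topologicalType) (r : T -> T -> Prop).

Let gen_rel (x y : T) : bool :=
  `[< Relation_Operators.clos_refl_sym_trans T r x y >].

Let gen_rel_refl : reflexive gen_rel.
Proof. by move=> x; apply/asboolP; exact: Relation_Operators.rst_refl. Qed.

Let gen_rel_sym : symmetric gen_rel.
Proof.
by move=> x y; apply/asboolP/asboolP => h; exact: Relation_Operators.rst_sym.
Qed.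

Let gen_rel_trans : transitive gen_rel.
Proof.
move=> y x z /asboolP xy /asboolP yz; apply/asboolP.
exact: (Relation_Operators.rst_trans _ _ _ _ _ xy yz).
Qed.

Definition generated_equiv := EquivRel _ gen_rel_refl gen_rel_sym gen_rel_trans.

Definition quotient_by := {eq_quot generated_equiv}.

HB.instance Definition _ :=
  Topological.copy quotient_by (quotient_topology quotient_by).
HB.instance Definition _ := Quotient.on quotient_by.

Definition quotient_by_pi (x : T) : quotient_by := \pi_quotient_by x.
End quotient_by_relation.

(* The open cone S x [0, +oo[ / S x {0}. *)
Section cone.
Variables (R : realType) (S : topologicalType).

Definition cone_rel (a b : S * [set t : R | 0 <= t]) : Prop :=
  val a.2 = 0 /\ val b.2 = 0.

Definition cone : topologicalType := quotient_by cone_rel.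

Definition cone_pt (a : S * [set t : R | 0 <= t]) : cone :=
  quotient_by_pi cone_rel a.
End cone.

Section metric_geometry.
Variable R : realType.
Implicit Types X : metricType R.

(* Stated with filters because the library's completeType is pointed. *)
Definition complete_space X : Prop :=
  forall F : set_system X, ProperFilter F -> cauchy F -> exists x : X, F --> x.

Definition curve_length X (a b : R) (c : R -> X) : \bar R :=
  ereal_sup [set (\sum_(0 <= i < size s)
                    mdist (c (nth b (a :: s) i)) (c (nth b (a :: s) i.+1)))%:E |
             s in itv_partition a b].

Definition length_space X : Prop :=
  forall x y : X, (mdist x y)%:E =
    ereal_inf [set curve_length 0 1 c |
      c in [set c : R -> X | [/\ {within `[0, 1], continuous c},
                                 c 0 = x & c 1 = y]]].

(* The element 0 is added so that the empty set has diameter 0. *)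
Definition diameter X (A : set X) : \bar R :=
  ereal_sup (0%E |` [set (mdist z.1 z.2)%:E | z in A `*` A]).

(* No normalising constant: only the vanishing of the measure matters below. *)
Definition hausdorff_premeasure X (s delta : R) (A : set X) : \bar R :=
  ereal_inf [set (\sum_(0 <= i <oo) (diameter (F i) `^ s)%E)%E |
    F in [set F : nat -> set X |
           A `<=` \bigcup_i F i /\ forall i, (diameter (F i) <= delta%:E)%E]].

Definition hausdorff_measure X (s : R) (A : set X) : \bar R :=
  ereal_sup [set hausdorff_premeasure s delta A | delta in [set d : R | 0 < d]].

(* The exponent 0 is left out, which does not change the infimum and avoids
   the convention 0 `^ 0 = 1 for the empty members of a cover. *)
Definition hausdorff_dim X : \bar R :=
  ereal_inf [set s%:E |
    s in [set s : R | 0 < s /\ hausdorff_measure s [set: X] = 0%E]].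

Definition shortest_path X (l : R) (c : R -> X) : Prop :=
  forall s t : R, 0 <= s <= l -> 0 <= t <= l -> mdist (c s) (c t) = `|s - t|.

(* The model plane of constant curvature k is the plane x.2 = 0 if k = 0, the
   sphere of radius 1 / sqrt k in Euclidean space if 0 < k, and the upper sheet
   of a hyperboloid in Minkowski space if k < 0. *)
Definition model_form (k : R) (x y : R * R * R) : R :=
  x.1.1 * y.1.1 + x.1.2 * y.1.2 + Num.sg k * (x.2 * y.2).

Definition model_plane (k : R) : set (R * R * R) :=
  [set x | if k == 0 then x.2 = 0
           else model_form k x x = k^-1 /\ (k < 0 -> 0 < x.2)].

Definition acosh (t : R) : R := ln (t + Num.sqrt (t ^+ 2 - 1)).

Definition model_dist (k : R) (x y : R * R * R) : R :=
  if 0 < k then acos (k * model_form k x y) / Num.sqrt k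
  else if k < 0 then acosh (k * model_form k x y) / Num.sqrt (- k)
  else Num.sqrt ((x.1.1 - y.1.1) ^+ 2 + (x.1.2 - y.1.2) ^+ 2).

(* Every point has a neighbourhood U such that, for a triangle with vertices
   a, b, c in U and a point d on the side bc, the distance from a to d is at
   least the corresponding distance in a comparison triangle a', b', c' of the
   model plane. *)
Definition curvature_ge X (k : R) : Prop :=
  forall x : X, exists2 U : set X, nbhs x U &
    forall (a b c : X) (g : R -> X) (t : R) (a' b' c' d' : R * R * R),
      U a -> U b -> U c ->
      shortest_path (mdist b c) g -> g 0 = b -> g (mdist b c) = c ->
      0 <= t <= mdist b c ->
      model_plane k a' -> model_plane k b' ->
      model_plane k c' -> model_plane k d' ->
      model_dist k a' b' = mdist a b -> model_dist k a' c' = mdist a c ->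
      model_dist k b' c' = mdist b c ->
      model_dist k b' d' = t -> model_dist k d' c' = mdist b c - t ->
      model_dist k a' d' <= mdist a (g t).

Definition alexandrov_space X : Prop :=
  [/\ complete_space X, locally_compact [set: X], length_space X,
      (hausdorff_dim X < +oo)%E & exists k : R, curvature_ge X k].

Definition geodesic_from X (p : X) (c : R -> X) : Prop :=
  c 0 = p /\ exists2 l : R, 0 < l & shortest_path l c.

(* Euclidean comparison angle at a vertex with adjacent sides s, t and opposite
   side d. *)
Definition comparison_angle (s t d : R) : R :=
  acos ((s ^+ 2 + t ^+ 2 - d ^+ 2) / (2 * s * t)).

Definition angle_is X (c1 c2 : R -> X) (alpha : R) : Prop :=
  (fun st : R * R =>
     comparison_angle st.1 st.2 (mdist (c1 st.1) (c2 st.2)))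
    @ filter_prod 0^'+ 0^'+ --> alpha.

(* S is the metric completion of the set of geodesics issuing from p, with the
   angle as distance (geodesics at angle 0 being identified).  This determines
   S up to isometry. *)
Definition space_of_directions X (p : X) (S : metricType R) : Prop :=
  complete_space S /\
  exists dir : {c : R -> X | geodesic_from p c} -> S,
    (forall c1 c2, angle_is (sval c1) (sval c2) (mdist (dir c1) (dir c2))) /\
    dense (range dir).

(* The boundary of an n-dimensional Alexandrov space, by induction on n: a
   1-dimensional one is a 1-manifold with boundary, and a point is in the
   boundary of a space of dimension n > 1 when its space of directions, of
   dimension n - 1, has non-empty boundary. *)
Fixpoint alexandrov_boundary (n : nat) X : set X :=
  match n with
  | 0 => set0
  | 1 => [set p | exists U : set X, exists f : U -> [set t : R | 0 <= t],
           [/\ open U, is_homeomorphism f &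
               exists2 u : U, val u = p & val (f u) = 0]]
  | m.+1 => [set p | exists S : metricType R,
               space_of_directions p S /\ @alexandrov_boundary m S !=set0]
  end.

Definition closed_alexandrov3 X : Prop :=
  [/\ alexandrov_space X, compact [set: X], hausdorff_dim X = 3%:E &
      @alexandrov_boundary 3 X = set0].

Definition homeomorphic_directions (P Q : metricType R) (p : P) (q : Q) :
    Prop :=
  exists S T : metricType R,
    [/\ space_of_directions p S, space_of_directions q T & homeomorphic S T].

(* U is the open cone of radius 1 inside a strictly larger open cone
   neighbourhood of p, that is, inside the image of an open embedding h of the
   whole open cone K_p sending the apex to p.  Regularity refers to this
   larger cone: it makes the frontier of U a collared copy of the space of
   directions. *)
Definition regular_cone_nbhd X (p : X) (U : set X) : Prop :=
  exists S : metricType R, space_of_directions p S /\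
  exists h : cone R S -> X,
    [/\ continuous h, injective h, (forall O, open O -> open (h @` O)),
        (forall a, val a.2 = 0 -> h (cone_pt a) = p) &
        U = [set h (cone_pt a) | a in [set a | val a.2 < 1]]].

Record connected_sum_data (P Q : metricType R) (p : P) (q : Q) := {
  csU : set P;
  csV : set Q;
  csU_cone : regular_cone_nbhd p csU;
  csV_cone : regular_cone_nbhd q csV;
  cs_phi : frontier (~` csU) -> frontier (~` csV);
  cs_phi_homeo : is_homeomorphism cs_phi
}.

Section connected_sum.
Variables (P Q : metricType R) (p : P) (q : Q) (D : connected_sum_data p q).

Definition connected_sum_piece (b : bool) : topologicalType :=
  if b then (~` csU D : set P) : topologicalType
  else (~` csV D : set Q) : topologicalType.

Definition connected_sum_disjoint : topologicalType :=
  {b : bool & connected_sum_piece b}.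

Inductive connected_sum_rel :
    connected_sum_disjoint -> connected_sum_disjoint -> Prop :=
  ConnectedSumRel (x : ~` csU D) (y : ~` csV D) (w : frontier (~` csU D)) :
    val x = val w -> val y = val (cs_phi w) ->
    connected_sum_rel (existT connected_sum_piece true x)
                      (existT connected_sum_piece false y).

Definition connected_sum : topologicalType := quotient_by connected_sum_rel.
End connected_sum.

End metric_geometry.

(* Main.v *)
(* Take P = Q = R^3 / G, where G is generated by the integral translations and
   x |-> - x. Triangles lift to R^3, so the quotient has curvature >= 0, and it is
   locally R^3 or R^3 / <+-1>, so that every space of directions is the round
   sphere or its quotient by the antipodal map. The points of the second kind form
   a finite non-empty set N. None of them has a Euclidean neighbourhood: otherwise
   the double cover of a punctured neighbourhood would have a section over a
   punctured ball of R^3, because such a ball is simply connected.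
   A gluing point of a connected sum is a manifold point, since its two collars
   are cylinders over a surface. Hence a connected sum at the regular image of
   (1/4, 1/4, 1/4) keeps both copies of N, whereas a connected sum at the singular
   image of 0 has at most 2 (#|N| - 1) non-manifold points. *)

(* Spaces of directions and gluing data are given by properties, not by constructions, so nothing
   may rest on a preferred choice. Every space of directions has to be recognised as the round
   sphere or projective plane, and the two sums have to differ for all gluing data. One-sided
   estimates suffice for this: a closed cone neighbourhood of a regular point contains no singular
   point, so both copies of N survive; and each non-manifold point of any sum lies on one side and
   is not the apex. Composing with a homeomorphism would then give an injective self-map of a finite
   set that misses a point. The two local models R^3 and R^3 / <+-1> are treated together by a
   boolean, which decides whether angles are measured between vectors or between lines. The
   obstruction at a singular point uses only path lifting through u |-> +-u. The two lifts of a
   point are kept apart by the positive distance to the apex, so a lift known up to a small error is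
   known exactly. The regular point (1/4, 1/4, 1/4) is chosen because its double is not integral, so
   that only the identity fixes it. *)
Require Import Defs.
From HB Require Import structures.
From mathcomp Require Import all_boot all_order all_algebra finmap.
From mathcomp Require Import all_classical all_reals all_analysis.
From mathcomp Require Import ring lra zify.

Set Implicit Arguments.
Unset Strict Implicit.
Unset Printing Implicit Defensive.

Import Order.TTheory GRing.Theory Num.Theory.
Import numFieldNormedType.Exports.

Local Open Scope classical_set_scope.
Local Open Scope ring_scope.
Local Open Scope quotient_scope.

(** * Euclidean norm on triples *)

Section euclidean_space.
Variable R : realType.
Local Notation V := (R * R * R)%type.
Implicit Types (x y z u v w : V) (a b c : R).

Definition dot x y : R := x.1.1 * y.1.1 + x.1.2 * y.1.2 + x.2 * y.2.
Definition nrm x : R := Num.sqrt (dot x x).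

Lemma vector_eq x y : x.1.1 = y.1.1 -> x.1.2 = y.1.2 -> x.2 = y.2 -> x = y.
Proof. by case: x y => [[? ?] ?] [[? ?] ?] /= -> -> ->. Qed.

Lemma dotC x y : dot x y = dot y x.
Proof. rewrite /dot; ring. Qed.

Lemma dotDl x y z : dot (x + y) z = dot x z + dot y z.
Proof. rewrite /dot /=; ring. Qed.

Lemma dotDr x y z : dot z (x + y) = dot z x + dot z y.
Proof. by rewrite ![dot z _]dotC dotDl. Qed.

Lemma dotZl a x y : dot (a *: x) y = a * dot x y.
Proof. rewrite /dot /= /GRing.scale /=; ring. Qed.

Lemma dotZr a x y : dot x (a *: y) = a * dot x y.
Proof. by rewrite ![dot x _]dotC dotZl. Qed.

Lemma dotNl x y : dot (- x) y = - dot x y.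
Proof. rewrite /dot /=; ring. Qed.

Lemma dotNr x y : dot x (- y) = - dot x y.
Proof. by rewrite ![dot x _]dotC dotNl. Qed.

Lemma dotBl x y z : dot (x - y) z = dot x z - dot y z.
Proof. by rewrite dotDl dotNl. Qed.

Lemma dotBr x y z : dot z (x - y) = dot z x - dot z y.
Proof. by rewrite dotDr dotNr. Qed.

Lemma dot0l x : dot 0 x = 0.
Proof. rewrite /dot /=; ring. Qed.

Lemma dot0r x : dot x 0 = 0.
Proof. by rewrite dotC dot0l. Qed.

Definition dotE := (dotDl, dotDr, dotNl, dotNr, dotZl, dotZr, dot0l, dot0r).

Lemma dot_ge0 x : 0 <= dot x x.
Proof. by rewrite /dot; nra. Qed.

Lemma dot_eq0 x : dot x x = 0 -> x = 0.
Proof.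
case: x => [[x1 x2] x3]; rewrite /dot /= => h.
have -> : x1 = 0 by nra.
have -> : x2 = 0 by nra.
by have -> : x3 = 0 by nra.
Qed.

Lemma CauchySchwarz_sqr x y : dot x y ^+ 2 <= dot x x * dot y y.
Proof.
case: x => [[x1 x2] x3]; case: y => [[y1 y2] y3]; rewrite /dot /=.
rewrite -subr_ge0 [X in 0 <= X](_ : _ = (x1 * y2 - x2 * y1) ^+ 2 +
  (x1 * y3 - x3 * y1) ^+ 2 + (x2 * y3 - x3 * y2) ^+ 2); last by ring.
by rewrite !addr_ge0 // sqr_ge0.
Qed.

Lemma nrm_ge0 x : 0 <= nrm x. Proof. exact: sqrtr_ge0. Qed.

Lemma sqr_nrm x : nrm x ^+ 2 = dot x x.
Proof. by rewrite sqr_sqrtr // dot_ge0. Qed.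

Lemma nrm0 : nrm 0 = 0. Proof. by rewrite /nrm dot0l sqrtr0. Qed.

Lemma nrm_eq0 x : (nrm x == 0) = (x == 0).
Proof.
apply/eqP/eqP => [h|->]; last exact: nrm0.
by apply: dot_eq0; rewrite -sqr_nrm h expr0n.
Qed.

Lemma nrm_gt0 x : (0 < nrm x) = (x != 0).
Proof. by rewrite lt0r nrm_ge0 andbT nrm_eq0. Qed.

Lemma nrmN x : nrm (- x) = nrm x.
Proof. by rewrite /nrm dotNl dotNr opprK. Qed.

Lemma nrmB x y : nrm (x - y) = nrm (y - x).
Proof. by rewrite -nrmN opprB. Qed.

Lemma nrmZ a x : nrm (a *: x) = `|a| * nrm x.
Proof.
by rewrite /nrm dotZl dotZr mulrA -expr2 sqrtrM ?sqr_ge0 // sqrtr_sqr.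
Qed.

Lemma CauchySchwarz x y : `|dot x y| <= nrm x * nrm y.
Proof.
rewrite -ler_sqr ?nnegrE ?mulr_ge0 ?nrm_ge0 // exprMn !sqr_nrm.
by rewrite real_normK ?num_real // CauchySchwarz_sqr.
Qed.

Lemma nrmD x y : nrm (x + y) <= nrm x + nrm y.
Proof.
rewrite -ler_sqr ?nnegrE ?addr_ge0 ?nrm_ge0 // sqrrD !sqr_nrm !dotE.
have := CauchySchwarz x y; rewrite (dotC y x) ler_norml => /andP[_]; lra.
Qed.

Lemma nrm_triangle y x z : nrm (x - z) <= nrm (x - y) + nrm (y - z).
Proof. by rewrite -(subrKA y x (-z)) nrmD. Qed.

Lemma nrm_dist x y : `|nrm x - nrm y| <= nrm (x - y).
Proof.
rewrite ler_norml; apply/andP; split.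
  by have := nrmD (y - x) x; rewrite subrK (nrmB y); lra.
by have := nrmD (x - y) y; rewrite subrK; lra.
Qed.

Lemma nrm_coord x : [/\ `|x.1.1| <= nrm x, `|x.1.2| <= nrm x & `|x.2| <= nrm x].
Proof.
by split; rewrite -ler_sqr ?nnegrE ?nrm_ge0 // sqr_nrm real_normK ?num_real //
  /dot; nra.
Qed.

(** The sharp factor is sqrt 3; the factor 2 suffices since 3 a^2 <= (2 a)^2. *)
Lemma nrm_le_coord x a : `|x.1.1| <= a -> `|x.1.2| <= a -> `|x.2| <= a ->
  nrm x <= 2 * a.
Proof.
move=> h1 h2 h3; have a0 : 0 <= a by exact: le_trans h1.
rewrite -ler_sqr ?nnegrE ?nrm_ge0 ?mulr_ge0 // sqr_nrm.
have sq (t : R) : `|t| <= a -> t * t <= a ^+ 2.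
  by move=> h; rewrite -expr2 -[t ^+ 2]real_normK ?num_real // ler_sqr ?nnegrE.
by move: (sq _ h1) (sq _ h2) (sq _ h3); rewrite /dot; nra.
Qed.

(** [V] carries the product topology, whose basic balls are cubes. Comparing the Euclidean norm with
    the coordinates in both directions lets later arguments use [nrm] only. *)
Lemma nbhs_nrmP x (A : set V) :
  nbhs x A <-> exists2 e, 0 < e & forall y, nrm (y - x) < e -> A y.
Proof.
split=> [/nbhs_ballP[e /= e0 h]|[e e0 h]].
  exists e => // y; have [h1 h2 h3] := nrm_coord (y - x).
  by move=> hy; apply: h; split; [split|]; rewrite /ball /= distrC;
    apply: le_lt_trans hy.
apply/nbhs_ballP; exists (e / 3) => /=; first by rewrite divr_gt0.
move=> y [[h1 h2] h3]; apply: h.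
move: h1 h2 h3; rewrite /ball /= => h1 h2 h3.
apply: (@le_lt_trans _ _ (2 * (e / 3))); last lra.
by apply: nrm_le_coord; rewrite distrC ltW.
Qed.

Lemma open_nrmP (A : set V) : open A <->
  forall x, A x -> exists2 e, 0 < e & forall y, nrm (y - x) < e -> A y.
Proof.
rewrite openE; split=> h x /h; first by move/nbhs_nrmP.
by move=> h1; apply/nbhs_nrmP.
Qed.

Lemma open_nrm_ball x e : open [set y | nrm (y - x) < e].
Proof.
apply/open_nrmP => y /= h; exists (e - nrm (y - x)); first lra.
by move=> z hz; have := nrm_triangle y z x; lra.
Qed.

End euclidean_space.

Ltac vector_ring := apply: vector_eq; rewrite /= /GRing.scale /=; ring.

(** * Metric space associated with a pseudometric *)

Section metric_quotient.
Variables (R : realType) (A : choiceType) (d : A -> A -> R).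
Hypotheses (dxx : forall a, d a a = 0) (d_sym : forall a b, d a b = d b a)
  (d_tri : forall b a c, d a c <= d a b + d b c).

Let d_ge0 a b : 0 <= d a b.
Proof. by have := d_tri b a a; rewrite dxx (d_sym b a); lra. Qed.

Let rel0 : rel A := [rel a b | d a b == 0].

Let rel0_refl : reflexive rel0. Proof. by move=> a; rewrite /rel0 /= dxx. Qed.

Let rel0_sym : symmetric rel0. Proof. by move=> a b; rewrite /rel0 /= d_sym. Qed.

Let rel0_trans : transitive rel0.
Proof.
rewrite /rel0 => b a c /= /eqP ab /eqP bc; apply/eqP/le_anti.
by rewrite d_ge0 andbT (le_trans (d_tri b a c)) // ab bc addr0.
Qed.

Definition metric_quotient_rel := EquivRel _ rel0_refl rel0_sym rel0_trans.
Definition metric_quotient := {eq_quot metric_quotient_rel}.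

HB.instance Definition _ := EqQuotient.on metric_quotient.
HB.instance Definition _ := [Sub metric_quotient of A by %/].
HB.instance Definition _ := [Choice of metric_quotient by <:].

Let mq_dist (x y : metric_quotient) : R := d (repr x) (repr y).

Let repr_pi a : d a (repr (\pi_metric_quotient a)) = 0.
Proof.
have /eqmodP/eqP : (\pi_metric_quotient a =
  \pi_metric_quotient (repr (\pi_metric_quotient a))) by rewrite reprK.
by [].
Qed.

Let d_congr a a' b b' : d a a' = 0 -> d b b' = 0 -> d a b = d a' b'.
Proof.
move=> aa' bb'; apply/le_anti/andP; split.
  have := d_tri a' a b; have := d_tri b' a' b; rewrite (d_sym b' b); lra.
have := d_tri a a' b'; have := d_tri b a b'; rewrite (d_sym a' a); lra.
Qed.

Let mq_pi a b : mq_dist (\pi_metric_quotient a) (\pi_metric_quotient b) = d a b.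
Proof. by apply/esym/d_congr. Qed.

Let mq_xx x : mq_dist x x = 0. Proof. exact: dxx. Qed.
Let mq_sym x y : mq_dist x y = mq_dist y x. Proof. exact: d_sym. Qed.
Let mq_tri y x z : mq_dist x z <= mq_dist x y + mq_dist y z.
Proof. exact: d_tri. Qed.
Let mq_pos x y : mq_dist x y = 0 -> x = y.
Proof.
move=> xy; rewrite -[x]reprK -[y]reprK; apply/eqmodP.
by apply/eqP.
Qed.

HB.instance Definition _ :=
  @isMetric.Build R metric_quotient mq_dist mq_xx mq_pos mq_sym mq_tri.

(** Applied twice: to the angle on unit vectors, giving model spaces of directions, and to
    [flat_dist] on R^3, giving the orbifold. *)
Lemma metric_quotient_exists : exists (X : metricType R) (f : A -> X),
  (forall x, exists a, f a = x) /\ forall a b, mdist (f a) (f b) = d a b.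
Proof.
exists metric_quotient, (fun a => \pi_metric_quotient a); split.
  by move=> x; exists (repr x); rewrite reprK.
exact: mq_pi.
Qed.
End metric_quotient.

(** * Metric neighbourhoods and completeness *)

Section metric_topology.
Variable R : realType.
Implicit Types X Y : metricType R.

Lemma nbhs_mdist X (x : X) (A : set X) :
  nbhs x A <-> exists2 e, 0 < e & forall y, mdist x y < e -> A y.
Proof.
rewrite -metricType_numDomainType.filter_from_mdist_nbhs.
by split=> -[e e0 h]; exists e.
Qed.

Lemma open_mdist X (A : set X) : open A <->
  forall x, A x -> exists2 e, 0 < e & forall y, mdist x y < e -> A y.
Proof.
rewrite openE; split=> h x /h; first by move/nbhs_mdist.
by move=> h1; apply/nbhs_mdist.
Qed.

(** A Cauchy filter converges to any of its cluster points. *)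
Lemma compact_complete X : compact [set: X] -> complete_space X.
Proof.
move=> cX F FF Fc; have [x [_ Fx]] := cX F FF filterT.
exists x; apply/cvg_entourageP => E entE.
have : nbhs entourage (split_ent E) by rewrite nbhs_filterE.
move=> /(Fc (split_ent E))[] [D1 D2]/= /[!nbhs_simpl] -[FD1 FD2 D1D2E].
have : nbhs x (xsection (split_ent E) x) by exact: nbhs_entourage.
move=> /(Fx _ (xsection (split_ent E) x) FD1)[z [Dz /xsectionP Exz]].
by near=> t; apply/(entourage_split z entE Exz)/D1D2E; split => //; near: t.
Unshelve. all: by end_near. Qed.
End metric_topology.

(** * Angle metric on the sphere and the projective plane *)

Section angular_distance.
Variable R : realType.
Local Notation V := (R * R * R)%type.
Implicit Types (x y z u v w : V) (a c e k : R) (b : bool).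

(* With [b] set, [v] and [- v] are identified: the projective plane. *)
Definition kap b v w : R := if b then `|dot v w| else dot v w.

Lemma acos_itv k : -1 <= k <= 1 -> 0 <= acos k <= pi.
Proof. by move=> h; rewrite acos_ge0 // acos_lepi. Qed.

Lemma acos_cos_lt k e : -1 <= k <= 1 -> 0 <= e <= pi -> (acos k < e) = (cos e < k).
Proof.
move=> hk he; rewrite -[in RHS](@acosK _ k) ?in_itv //=.
by rewrite ltr_cos ?in_itv //= acos_itv.
Qed.

Lemma cos_le_acos k e : -1 <= k <= 1 -> 0 <= e <= pi -> (acos k <= e) = (cos e <= k).
Proof.
move=> hk he; rewrite -[in RHS](@acosK _ k) ?in_itv //= !leNgt.
by rewrite ltr_cos ?in_itv //= acos_itv.
Qed.

Lemma cos_lt1 e : 0 < e -> e <= pi -> cos e < 1 :> R.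
Proof.
move=> e0 epi; rewrite -cos0 ltr_cos // in_itv /= ?lexx ?pi_ge0 ?epi ?ltW //.
Qed.

Lemma dot_unit v w : dot v v = 1 -> dot w w = 1 -> -1 <= dot v w <= 1.
Proof.
move=> v1 w1; have := CauchySchwarz v w.
by rewrite /nrm v1 w1 sqrtr1 mulr1 ler_norml.
Qed.

Lemma kap_itv b v w : dot v v = 1 -> dot w w = 1 -> -1 <= kap b v w <= 1.
Proof.
move=> v1 w1; have := dot_unit v1 w1; rewrite /kap; case: b => //.
by rewrite -ler_norml => ->; rewrite (le_trans _ (normr_ge0 _)) // lerN10.
Qed.

Lemma dot_le_kap b v w : dot v w <= kap b v w.
Proof. by rewrite /kap; case: b => //; exact: ler_norm. Qed.

Lemma kapC b v w : kap b v w = kap b w v.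
Proof. by rewrite /kap dotC. Qed.

(** When lines are considered, one of [w] and [- w] realises the distance to [v]; claims about lines
    thus reduce to claims about unit vectors. *)
Lemma kap_sign b v w : exists w', [/\ w' = w \/ b /\ w' = - w,
  dot w' w' = dot w w & kap b v w = dot v w'].
Proof.
rewrite /kap; case: b; last by exists w; split => //; left.
case: (lerP 0 (dot v w)) => h; first by exists w; split; [left| |rewrite ger0_norm].
by exists (- w); split; [right|rewrite !dotE opprK|rewrite dotNr ltr0_norm].
Qed.

Lemma kapNr b v w : b -> kap b v (- w) = kap b v w.
Proof. by rewrite /kap => ->; rewrite dotNr normrN. Qed.

Lemma sqr_nrm_unitB v w : dot v v = 1 -> dot w w = 1 ->
  nrm (v - w) ^+ 2 = 2 - 2 * dot v w.
Proof. by move=> v1 w1; rewrite sqr_nrm !dotE v1 w1 (dotC w v); ring. Qed.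

(** Spherical triangle inequality. After taking cosines it is Cauchy-Schwarz for the components of
    [u] and [w] orthogonal to [v], whose lengths are the sines of the two angles. *)
Lemma acos_dot_triangle u v w : dot u u = 1 -> dot v v = 1 -> dot w w = 1 ->
  acos (dot u w) <= acos (dot u v) + acos (dot v w).
Proof.
move=> u1 v1 w1.
have /andP[a0 api] := acos_itv (dot_unit u1 v1).
have /andP[c0 cpi] := acos_itv (dot_unit v1 w1).
have /andP[_ dpi] := acos_itv (dot_unit u1 w1).
have [h|h] := leP (acos (dot u v) + acos (dot v w)) pi; last exact: le_trans (ltW h).
rewrite cos_le_acos ?dot_unit ?addr_ge0 // cosD !acosK ?in_itv /= ?dot_unit //.
have s1 : 0 <= sin (acos (dot u v)) by rewrite sin_ge0_pi // a0.
have s2 : 0 <= sin (acos (dot v w)) by rewrite sin_ge0_pi // c0.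
rewrite lerBlDr -lerBlDl.
have [p|p] := leP (dot u v * dot v w) (dot u w).
  by apply: le_trans (mulr_ge0 s1 s2); lra.
have p' : 0 <= dot u v * dot v w - dot u w by rewrite subr_ge0 ltW.
rewrite -ler_sqr ?nnegrE ?mulr_ge0 // exprMn !sin2cos2.
rewrite !acosK ?in_itv /= ?dot_unit //.
have := CauchySchwarz_sqr (u - dot u v *: v) (w - dot v w *: v).
rewrite !dotE u1 v1 w1 (dotC v u) (dotC w v).
by nra.
Qed.

(** Signs are chosen successively so that both angles at [v] become angles between vectors. The
    resulting vector angle from [u] to [w'] is at least the angle between the lines. *)
Lemma acos_kap_triangle b u v w : dot u u = 1 -> dot v v = 1 -> dot w w = 1 ->
  acos (kap b u w) <= acos (kap b u v) + acos (kap b v w).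
Proof.
move=> u1 v1 w1.
have [v' [hv v'1 ->]] := kap_sign b u v; rewrite v1 in v'1.
have [w' [hw w'1 e]] := kap_sign b v' w; rewrite w1 in w'1.
have -> : kap b v w = dot v' w'.
  rewrite -e; case: hv => [->//|[hb ->]].
  by rewrite kapC -(kapNr w v hb) kapC.
apply: le_trans (acos_dot_triangle u1 v'1 w'1).
have -> : kap b u w = kap b u w' by case: hw => [->//|[hb ->]]; rewrite kapNr.
have h := dot_unit u1 w'1.
rewrite cos_le_acos ?kap_itv ?acos_itv //.
by rewrite acosK ?in_itv //= dot_le_kap.
Qed.

Lemma acos_kap_xx b v : dot v v = 1 -> acos (kap b v v) = 0.
Proof. by rewrite /kap => ->; rewrite normr1 if_same acos1. Qed.

Lemma acos_kap_eq0 b v w : dot v v = 1 -> dot w w = 1 -> acos (kap b v w) = 0 ->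
  w = v \/ b /\ w = - v.
Proof.
move=> v1 w1 h; have k1 : kap b v w = 1.
  by rewrite -cos0 -h acosK // in_itv /= kap_itv.
have [w' [hw w'1 e]] := kap_sign b v w; rewrite w1 in w'1.
have : v - w' = 0.
  by apply/eqP; rewrite -nrm_eq0 -sqrf_eq0 sqr_nrm_unitB // -e k1 mulr1 subrr.
move/subr0_eq => ->; case: hw => [->|[? ->]]; [left|right] => //.
by rewrite opprK.
Qed.

Lemma acos_kap_near b e : 0 < e -> exists2 t, 0 < t & forall v w,
  dot v v = 1 -> dot w w = 1 -> nrm (v - w) < t -> acos (kap b v w) < e.
Proof.
move=> e0; pose e' := Num.min e pi.
have e'0 : 0 < e' by rewrite lt_min e0 pi_gt0.
have e'pi : e' <= pi by rewrite ge_min lexx orbT.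
have c1 := cos_lt1 e'0 e'pi.
(* The length of a chord subtending the angle [e']. *)
exists (Num.sqrt (2 * (1 - cos e'))); first by rewrite sqrtr_gt0 mulr_gt0 // subr_gt0.
move=> v w v1 w1 h; apply: (@lt_le_trans _ _ e'); last by rewrite ge_min lexx.
rewrite acos_cos_lt ?kap_itv // ?e'pi ?ltW //.
apply: lt_le_trans (dot_le_kap _ _ _).
have : nrm (v - w) ^+ 2 < Num.sqrt (2 * (1 - cos e')) ^+ 2.
  by rewrite ltr_sqr ?nnegrE ?nrm_ge0 ?sqrtr_ge0.
rewrite sqr_nrm_unitB // sqr_sqrtr; first lra.
by rewrite mulr_ge0 // subr_ge0 ltW.
Qed.

Lemma near_acos_kap e : 0 < e -> exists2 t, 0 < t & forall b v w,
  dot v v = 1 -> dot w w = 1 -> acos (kap b v w) < t ->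
  exists w', [/\ w' = w \/ b /\ w' = - w, dot w' w' = 1 & nrm (v - w') < e].
Proof.
move=> e0.
have : cos x @[x --> 0] --> (1 : R) by rewrite -[X in _ --> X]cos0; exact: continuous_cos.
have e20 : 0 < e ^+ 2 / 2 by rewrite divr_gt0 // exprn_gt0.
move=> /cvgrPdist_lt /(_ _ e20) /nbhs_ballP[t /= t0 ht].
exists t => // b v w v1 w1 hk.
have := ht (acos (kap b v w)).
have k01 := kap_itv b v1 w1.
have /andP[h0 _] := acos_itv k01.
rewrite /ball /= sub0r normrN ger0_norm // => /(_ hk).
rewrite acosK ?in_itv //= => h.
have [w' [hw w'1 ee]] := kap_sign b v w; rewrite w1 in w'1.
exists w'; split => //.
rewrite -ltr_sqr ?nnegrE ?nrm_ge0 ?(ltW e0) // sqr_nrm_unitB //.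
by move: h; rewrite ee ltr_norml => /andP[_]; lra.
Qed.

Lemma cube_compact a : compact [set x : V | [/\ `|x.1.1| <= a, `|x.1.2| <= a & `|x.2| <= a]].
Proof.
have cI : compact [set t : R | `|t| <= a].
  rewrite (_ : mkset _ = `[- a, a]%classic); first exact: segment_compact.
  by apply/seteqP; split=> t /=; rewrite in_itv /= ler_norml.
rewrite (_ : mkset _ = [set t : R | `|t| <= a] `*` [set t : R | `|t| <= a] `*`
   [set t : R | `|t| <= a]); first by do 2! apply: compact_setX => //.
by apply/seteqP; split => -[[x y] z] /= => [[]|[[]]].
Qed.

Lemma closed_bounded_compact (K : set V) a : closed K ->
  (forall x, K x -> nrm x <= a) -> compact K.
Proof.
move=> cK bK; apply: subclosed_compact cK (cube_compact (a := a)) _ => x /bK h.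
by have [h1 h2 h3] := nrm_coord x; split; exact: le_trans h.
Qed.

Lemma nrm_continuous : continuous (@nrm R).
Proof.
move=> x; apply/cvgrPdist_lt => e e0; apply/nbhs_nrmP; exists e => // y h.
by rewrite /= distrC (le_lt_trans (nrm_dist _ _)).
Qed.

Lemma dot_continuous u : continuous (dot u).
Proof.
move=> x; apply/cvgrPdist_lt => e e0; apply/nbhs_nrmP.
have n0 : 0 < nrm u + 1 by rewrite ltr_wpDl ?nrm_ge0.
exists (e / (nrm u + 1)); first by rewrite divr_gt0.
move=> y; rewrite ltr_pdivlMr // => h.
rewrite /= -dotBr.
apply: le_lt_trans (CauchySchwarz _ _) _; rewrite nrmB; apply: le_lt_trans h.
by rewrite mulrC ler_wpM2l ?nrm_ge0 // lerDl.
Qed.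

Lemma unit_nrm v : dot v v = 1 -> nrm v = 1.
Proof. by rewrite /nrm => ->; rewrite sqrtr1. Qed.

Lemma nrm1_dot v : nrm v = 1 -> dot v v = 1.
Proof. by rewrite -sqr_nrm => ->; rewrite expr1n. Qed.

Lemma sphere_compact : compact [set v : V | dot v v = 1].
Proof.
apply: (@closed_bounded_compact _ 1) => [|x /unit_nrm ->//].
rewrite (_ : mkset _ = @nrm R @^-1` [set 1]).
  by apply: closed_comp; [move=> x _; exact: nrm_continuous|exact: closed_eq].
by apply/seteqP; split=> v /=; [exact: unit_nrm|exact: nrm1_dot].
Qed.

Lemma circle_compact u : compact [set v : V | dot v v = 1 /\ dot u v = 0].
Proof.
rewrite (_ : mkset _ = [set v : V | dot v v = 1] `&` dot u @^-1` [set 0]) //.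
apply: compact_closedI; first exact: sphere_compact.
by apply: closed_comp; [move=> x _; exact: dot_continuous|exact: closed_eq].
Qed.

Lemma angular_image_compact b (S : metricType R) (f : V -> S) (K : set V) :
  compact K -> (forall v, K v -> dot v v = 1) ->
  (forall v w, K v -> K w -> mdist (f v) (f w) = acos (kap b v w)) ->
  compact (f @` K).
Proof.
move=> cK K1 fK; apply: continuous_compact => //.
apply/subspace_continuousP => x Kx.
apply/metricType_numDomainType.cvgrPdist_lt => e e0.
have [t t0 ht] := acos_kap_near b e0.
apply/nbhs_nrmP; exists t => // y hy Ky.
rewrite fK //; apply: ht; [exact: K1|exact: K1|by rewrite nrmB].
Qed.

(** In a completion the actual directions are only dense. Here they form a compact set, so the
    completion adds nothing. *)
Lemma angular_image_full b (S : metricType R) (f : V -> S) (K : set V) :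
  compact K -> (forall v, K v -> dot v v = 1) ->
  (forall v w, K v -> K w -> mdist (f v) (f w) = acos (kap b v w)) ->
  dense (f @` K) -> f @` K = [set: S].
Proof.
move=> cK K1 fK df; have cI := angular_image_compact cK K1 fK.
have := compact_closed (@metric_hausdorff _ S) cI.
move/closure_id => ->; apply/seteqP; split=> // s _ B.
rewrite nbhsE => -[U [oU Us] UB].
by have [z [Oz fz]] := df U (ex_intro _ s Us) oU; exists z; split => //; apply: UB.
Qed.

End angular_distance.

(** * Directions of a sphere or projective plane *)

Section circle_of_directions.
Variable R : realType.
Local Notation V := (R * R * R)%type.
Implicit Types (u v w : V) (t s : R) (b : bool).

(** The mean value theorem gives sin t = t cos x with x in [0, t], where the cosine decreases. *)
Lemma sin_bounds t : 0 <= t <= pi -> t * cos t <= sin t <= t.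
Proof.
case/andP=> t0 tpi.
have cs : {within `[0, t], continuous (@sin R)}.
  by apply: continuous_subspaceT => x; exact: continuous_sin.
have [x] := @MVT_segment R (@sin R) (@cos R) 0 t t0 (fun x _ => is_derive_sin x) cs.
rewrite in_itv /= => /andP[x0 xt]; rewrite sin0 !subr0 => ->.
rewrite mulrC ler_wpM2r //=; last first.
  by rewrite leNgt ltr_cos ?in_itv /= ?x0 ?t0 ?tpi ?(le_trans xt) // -leNgt.
by rewrite ler_piMl // cos_le1.
Qed.

(** An angle is a limit at 0, hence depends only on initial pieces of the curves, and limits are
    unique. This is how points of an arbitrary space of directions are compared. *)
Lemma angle_is_germ (X : metricType R) (c1 c1' c2 c2' : R -> X) (t0 a b : R) :
  0 < t0 -> (forall t, 0 <= t <= t0 -> c1 t = c1' t) ->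
  (forall t, 0 <= t <= t0 -> c2 t = c2' t) ->
  angle_is c1 c2 a -> angle_is c1' c2' b -> a = b.
Proof.
move=> t00 e1 e2 h1 h2.
have near0 : \forall t \near (0 : R)^'+, 0 <= t <= t0.
  near=> t; apply/andP; split; near: t; first exact: nbhs_right_ge.
  exact: nbhs_right_le.
apply: (cvg_unique _ h1); first exact: norm_hausdorff.
apply: cvg_trans h2; apply: near_eq_cvg.
exists ([set t | 0 <= t <= t0], [set t | 0 <= t <= t0]); first by split; exact: near0.
by move=> [s t] [/= hs ht]; rewrite e1 // e2.
Unshelve. all: by end_near. Qed.

(** An angle known to exist can be computed along s = t. *)
Lemma angle_is_diag (X : metricType R) (c1 c2 : R -> X) (a : R) : angle_is c1 c2 a ->
  comparison_angle t t (mdist (c1 t) (c2 t)) @[t --> 0^'+] --> a.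
Proof.
move=> h; apply: (@cvg_comp _ _ _ (fun t : R => (t, t)) _ _ _ _ _ h).
move=> A [[B C] /= [hB hC] BC]; rewrite /nbhs /=.
by apply: filterS2 hB hC => t Bt Ct; exact: BC.
Qed.

Definition great_circle v u t : V := cos t *: v + sin t *: u.

Lemma dot_great_circle v u w s t : dot v v = 1 -> dot v u = 0 -> dot v w = 0 ->
  dot (great_circle v u s) (great_circle v w t) =
  cos s * cos t + sin s * sin t * dot u w.
Proof. by move=> v1 vu vw; rewrite !dotE (dotC u v) v1 vu vw; ring. Qed.

Lemma great_circle_unit v u t : dot v v = 1 -> dot u u = 1 -> dot v u = 0 ->
  dot (great_circle v u t) (great_circle v u t) = 1.
Proof.
by move=> v1 u1 vu; rewrite dot_great_circle // u1 mulr1 -!expr2 cos2Dsin2.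
Qed.

Lemma acos_cos t : `|t| <= pi -> acos (cos t) = `|t|.
Proof. by move=> h; rewrite -cos_norm cosK // in_itv /= normr_ge0. Qed.

Lemma cos_small_ge0 t : `|t| <= 1 -> 0 <= cos t.
Proof.
rewrite ler_norml => /andP[h1 h2]; rewrite cos_ge0_pihalf //.
by have := @pihalf_ge1 R; lra.
Qed.

Variables (b : bool) (S : metricType R) (f : V -> S).
Hypothesis f_onto : forall s : S, exists2 v, dot v v = 1 & f v = s.
Hypothesis f_dist : forall v w, dot v v = 1 -> dot w w = 1 ->
  mdist (f v) (f w) = acos (kap b v w).

Lemma f_antipode v w : dot v v = 1 -> w = v \/ b /\ w = - v -> f w = f v.
Proof.
move=> v1 [->//|[hb ->]]; apply: mdist_positivity.
by rewrite f_dist ?dotE ?opprK // kapC kapNr // acos_kap_xx.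
Qed.

Lemma great_circle_geodesic v u : dot v v = 1 -> dot u u = 1 -> dot v u = 0 ->
  geodesic_from (f v) (f \o great_circle v u).
Proof.
move=> v1 u1 vu; split.
  by rewrite /great_circle /= cos0 sin0 scale1r scale0r addr0.
(* Parameters differ by at most 1 <= pi / 2, so the cosine is non-negative and identifying antipodes
   does not shorten the arc. *)
exists 1 => // s t /andP[s0 s1] /andP[t0 t1] /=.
have st : `|s - t| <= 1 by rewrite ler_norml; lra.
rewrite f_dist ?great_circle_unit // /kap dot_great_circle // u1 mulr1 -cosB.
rewrite (ger0_norm (cos_small_ge0 st)) if_same acos_cos //.
by apply: le_trans st _; have := @pi_ge2 R; lra.
Qed.

(** Equality case of the spherical triangle inequality: a point at distance t from [f v] and t0 - t
    from the endpoint lies on the great circle arc joining them. *)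
Lemma geodesic_great_circle v c : dot v v = 1 -> geodesic_from (f v) c ->
  exists u t0, [/\ dot u u = 1, dot v u = 0, 0 < t0 &
    forall t, 0 <= t <= t0 -> c t = f (great_circle v u t)].
Proof.
move=> v1 [c0 [l l0 cl]].
pose t0 := Num.min l (1 / 2); have t00 : 0 < t0 by rewrite lt_min l0 divr_gt0.
have t0l : t0 <= l by rewrite ge_min lexx.
have t01 : t0 <= 1 / 2 by rewrite ge_min lexx orbT.
have pi2 := @pi_ge2 R; have ph := @pihalf_ge1 R.
have lift t : 0 <= t <= t0 -> exists w, [/\ dot w w = 1, c t = f w & dot v w = cos t].
  case/andP=> tt0 tt1; have [w w1 fw] := f_onto (c t).
  have := cl 0 t; rewrite c0 lexx -fw tt0 (ltW l0) (le_trans tt1 t0l) => /(_ isT isT).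
  rewrite f_dist // sub0r normrN ger0_norm // => h.
  have [w' [hw w'1 e]] := kap_sign b v w.
  exists w'; split; [by rewrite w'1|by rewrite -(f_antipode w1 hw) |].
  by rewrite -e -h acosK // in_itv /= kap_itv.
have sin0 : 0 < sin t0 by apply: sin_gt0_pi; rewrite t00 /=; lra.
have [|w0 [w01 cw0 vw0]] := lift t0; first by rewrite lexx ltW.
(* The normalised component of the endpoint orthogonal to [v]. *)
pose u := (sin t0)^-1 *: (w0 - cos t0 *: v).
have vu : dot v u = 0 by rewrite !dotE v1 vw0; ring.
have u1 : dot u u = 1.
  rewrite !dotE w01 v1 (dotC w0 v) vw0.
  rewrite [LHS](_ : _ = (sin t0)^-1 ^+ 2 * (1 - cos t0 ^+ 2)); last ring.
  by rewrite -sin2cos2 exprVn mulVf // sqrf_eq0 gt_eqF.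
exists u, t0; split => // t ht; have [w [w1 cw vw]] := lift t ht.
case/andP: ht => tt0 tt1.
have ww0 : dot w w0 = cos (t0 - t).
  have := cl t t0; rewrite cw cw0 tt0 (ltW t00) t0l (le_trans tt1 t0l) => /(_ isT isT).
  rewrite f_dist // distrC ger0_norm ?subr_ge0 // => h.
  have <- : kap b w w0 = dot w w0.
    rewrite /kap; case: (b) => //; rewrite ger0_norm //.
    have tri := acos_dot_triangle w1 v1 w01.
    rewrite (dotC w v) vw vw0 !acos_cos ?ger0_norm ?(ltW t00) // in tri; try lra.
    have : acos (dot w w0) <= pi / 2 by lra.
    rewrite cos_le_acos ?dot_unit ?cos_pihalf //; lra.
  by rewrite -h acosK // in_itv /= kap_itv.
rewrite cw; congr f; apply/eqP; rewrite -subr_eq0 -nrm_eq0 -sqrf_eq0.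
rewrite sqr_nrm_unitB ?great_circle_unit //.
rewrite /great_circle /u !dotE (dotC w v) vw ww0 cosB.
apply/eqP; have := cos2Dsin2 t => h.
have := gt_eqF sin0 => /negbT sn0.
rewrite [LHS](_ : _ = 2 - 2 * (cos t ^+ 2 + sin t ^+ 2)); last by field.
by rewrite h; ring.
Qed.

(** The distance d at time t satisfies 2 sin^2 (d / 2) = (1 - dot u w) sin^2 t. Estimating both
    sines by [sin_bounds] squeezes 1 - d^2 / (2 t^2), the cosine of the comparison angle, between
    two functions tending to [dot u w]. *)
Lemma angle_great_circle v u w (a : R) : dot v v = 1 -> dot u u = 1 -> dot w w = 1 ->
  dot v u = 0 -> dot v w = 0 ->
  angle_is (f \o great_circle v u) (f \o great_circle v w) a -> a = acos (dot u w).
Proof.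
move=> v1 u1 w1 vu vw /angle_is_diag ha.
pose d t := mdist (f (great_circle v u t)) (f (great_circle v w t)).
pose x t := (t ^+ 2 + t ^+ 2 - d t ^+ 2) / (2 * t * t).
have [c1 c2] := andP (dot_unit u1 w1).
have pi2 := @pi_ge2 R; have ph := @pihalf_ge1 R.
have key t : 0 < t <= 1 / 2 -> [/\ -1 <= x t <= 1,
    1 - (1 - dot u w) / cos t ^+ 2 <= x t & x t <= 1 - (1 - dot u w) * cos t ^+ 2].
  case/andP=> t0 t1.
  have P1 := great_circle_unit t v1 u1 vu; have Q1 := great_circle_unit t v1 w1 vw.
  have dE : d t = acos (dot (great_circle v u t) (great_circle v w t)).
    rewrite /d f_dist // /kap; case: (b) => //; rewrite ger0_norm //.
    rewrite dot_great_circle //.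
    have : 0 <= cos (t + t) by apply: cos_small_ge0; rewrite ger0_norm; lra.
    rewrite cosD; nra.
  have [d0 dpi] := andP (acos_itv (dot_unit P1 Q1)); rewrite -dE in d0 dpi.
  (* The triangle inequality through [f v]. It keeps [x t] at least -1, where [acos] really inverts
     [cos], and gives d t / 2 <= t. *)
  have d2t : d t <= t + t.
    rewrite /d; apply: le_trans (metric_triangle _ (f v) _) _.
    have [g0 _] := great_circle_geodesic v1 u1 vu.
    rewrite metric_sym !f_dist // /kap.
    have e z : dot z z = 1 -> dot v z = 0 -> dot v (great_circle v z t) = cos t.
      by move=> z1 vz; rewrite !dotE v1 vz; ring.
    rewrite !e // ger0_norm ?if_same ?acos_cos ?ger0_norm //; try lra.
    by rewrite cos_small_ge0 // ger0_norm; lra.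
  have ct : 0 < cos t by apply: cos_gt0_pihalf; lra.
  have cd : cos t <= cos (d t / 2).
    by rewrite leNgt ltr_cos ?in_itv /= -?leNgt; lra.
  have /andP[s1 s2] : d t / 2 * cos (d t / 2) <= sin (d t / 2) <= d t / 2.
    by apply: sin_bounds; lra.
  have /andP[s3 s4] : t * cos t <= sin t <= t by apply: sin_bounds; lra.
  have dcos : 2 * sin (d t / 2) ^+ 2 = (1 - dot u w) * sin t ^+ 2.
    have : cos (d t) = cos t * cos t + sin t * sin t * dot u w.
      by rewrite -(dot_great_circle t t v1 vu vw) dE acosK // in_itv /= dot_unit.
    rewrite [in cos (d t)](splitr (d t)) cosD.
    have := cos2Dsin2 (d t / 2); have := cos2Dsin2 t; rewrite !expr2; lra.
  have xE : x t = 1 - 2 * (d t / 2) ^+ 2 / t ^+ 2.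
    by rewrite /x; field; rewrite gt_eqF.
  have t2 : 0 < t ^+ 2 by rewrite exprn_gt0.
  have ct2 : 0 < cos t ^+ 2 by rewrite exprn_gt0.
  have sd0 : 0 <= sin (d t / 2) by apply: sin_ge0_pi; lra.
  have st0 : 0 <= sin t by apply: sin_ge0_pi; lra.
  split.
  - rewrite xE; have : 0 <= 2 * (d t / 2) ^+ 2 / t ^+ 2.
      by apply: divr_ge0; [apply: mulr_ge0 => //; exact: sqr_ge0|exact: ltW].
    have : 2 * (d t / 2) ^+ 2 / t ^+ 2 <= 2.
      by rewrite ler_pdivrMr // ler_pM2l // ler_sqr ?nnegrE; lra.
    lra.
  - rewrite xE lerD2l lerN2 ler_pdivrMr // mulrAC ler_pdivlMr //.
    have : (d t / 2 * cos t) ^+ 2 <= sin (d t / 2) ^+ 2.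
      rewrite ler_sqr ?nnegrE //; last by rewrite mulr_ge0 //; lra.
      by apply: le_trans s1; rewrite ler_wpM2l //; lra.
    have : sin t ^+ 2 <= t ^+ 2 by rewrite ler_sqr ?nnegrE; lra.
    rewrite exprMn; nra.
  - rewrite xE lerD2l lerN2 ler_pdivlMr //.
    have : sin (d t / 2) ^+ 2 <= (d t / 2) ^+ 2 by rewrite ler_sqr ?nnegrE; lra.
    have : (t * cos t) ^+ 2 <= sin t ^+ 2.
      by rewrite ler_sqr ?nnegrE // mulr_ge0; lra.
    rewrite exprMn; nra.
have nearkey : \forall t \near (0 : R)^'+, 0 < t <= 1 / 2.
  near=> t; apply/andP; split; near: t; first exact: nbhs_right_gt.
  by apply: nbhs_right_le; lra.
have cosr : cos t ^+ 2 @[t --> (0 : R)^'+] --> (1 : R).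
  have cl : cos t @[t --> (0 : R)^'+] --> (1 : R).
    by rewrite -[X in _ --> X]cos0; apply: cvg_at_right_filter; exact: continuous_cos.
  by rewrite -[X in _ --> X](mulr1 1); exact: (cvgM cl cl).
have xlim : x t @[t --> 0^'+] --> dot u w.
  apply: (@squeeze_cvgr _ _ _ _ (fun t => 1 - (1 - dot u w) / cos t ^+ 2)
     (fun t => 1 - (1 - dot u w) * cos t ^+ 2)).
  - by near=> t; have [|_ -> ->] := key t; first by near: t.
  - rewrite [X in _ --> X](_ : _ = 1 - (1 - dot u w) / 1); last by field.
    apply: cvgB; first exact: cvg_cst.
    by apply: cvgM; [exact: cvg_cst|apply: cvgV; rewrite ?oner_neq0].
  - rewrite [X in _ --> X](_ : _ = 1 - (1 - dot u w) * 1); last by ring.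
    by apply: cvgB; [exact: cvg_cst|apply: cvgM; [exact: cvg_cst|]].
have cosa : cos a = dot u w.
  suff h : x t @[t --> 0^'+] --> cos a;
    first exact: (@cvg_unique R (@norm_hausdorff R R) _ _ _ _ h xlim).
  have : cos (acos (x t)) @[t --> 0^'+] --> cos a.
    exact: (cvg_comp _ _ ha (@continuous_cos R a)).
  apply: cvg_trans; apply: near_eq_cvg; near=> t.
  by rewrite acosK // in_itv /=; have [] := key t; first by near: t.
have api : a \in `[0, pi].
  have cl : closed `[0 : R, pi]%classic by exact: itv_closed.
  apply: (closed_cvg _ cl _ _ ha); near=> t.
  by rewrite /= in_itv /= acos_itv //; have [] := key t; first by near: t.
by rewrite -cosa cosK.
Unshelve. all: by end_near. Qed.

(** Each geodesic starts along a great circle, so the directions are the unit vectors orthogonal to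
    [v]; this circle is compact and dense in [T], hence all of it. The point [y0] is a default value
    for the choice function. *)
Lemma directions_circle v (T : metricType R) (y0 : T) : dot v v = 1 ->
  space_of_directions (f v) T ->
  exists g : V -> T, (forall y, exists u, [/\ dot u u = 1, dot v u = 0 & g u = y]) /\
    forall u w, dot u u = 1 -> dot v u = 0 -> dot w w = 1 -> dot v w = 0 ->
      mdist (g u) (g w) = acos (dot u w).
Proof.
move=> v1 [_ [dir [dirE dird]]].
pose K := [set u : V | dot u u = 1 /\ dot v u = 0].
have /choice[g gE] : forall u, exists y, K u ->
  exists c : {c : R -> S | geodesic_from (f v) c},
    sval c = f \o great_circle v u /\ dir c = y.
  move=> u; have [[u1 vu]|nK] := pselect (K u); last by exists y0.
  pose c := exist (geodesic_from (f v)) _ (great_circle_geodesic v1 u1 vu).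
  by exists (dir c) => _; exists c.
have gdist u w : K u -> K w -> mdist (g u) (g w) = acos (kap false u w).
  move=> Ku Kw; have [c [cE <-]] := gE _ Ku; have [c' [cE' <-]] := gE _ Kw.
  case: Ku Kw => u1 vu [w1 vw].
  by apply: (angle_great_circle v1 u1 w1 vu vw); rewrite -cE -cE'.
have gfull : g @` K = [set: T].
  apply: (angular_image_full (b := false)) gdist _.
  - exact: circle_compact.
  - by move=> u [].
  - move=> U U0 oU; have [y [Uy [c _ cy]]] := dird U U0 oU.
    exists y; split => //; have [u [t0 [u1 vu t00 ct]]] := geodesic_great_circle v1 (svalP c).
    have [c' [c'E c'y]] := gE u (conj u1 vu).
    exists u => //; rewrite -cy -c'y; apply: mdist_positivity.
    have := dirE c' c; rewrite c'E => h.
    have h' := dirE c' c'; rewrite c'E mdistxx in h'.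
    by apply: (angle_is_germ t00 _ _ h h') => // t ht; rewrite ct.
exists g; split.
  move=> y; have : (g @` K) y by rewrite gfull.
  by case=> u [u1 vu] gy; exists u.
by move=> u w u1 vu w1 vw; rewrite gdist.
Qed.

Definition cross v w : V := (v.1.2 * w.2 - v.2 * w.1.2, v.2 * w.1.1 - v.1.1 * w.2,
  v.1.1 * w.1.2 - v.1.2 * w.1.1).

Lemma dot_crossl v w : dot v (cross v w) = 0.
Proof. by rewrite /dot /=; ring. Qed.

Lemma dot_crossr v w : dot w (cross v w) = 0.
Proof. by rewrite /dot /=; ring. Qed.

Lemma dot_cross v w : dot (cross v w) (cross v w) = dot v v * dot w w - dot v w ^+ 2.
Proof. by rewrite /dot /=; ring. Qed.

(** A boundary point would be sent to the end 0 of a half-line. Moving along the circle through it,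
    the coordinate [F] rises from 0 on both sides, so some value is taken twice, against
    injectivity. *)
Lemma directions_no_boundary v (T : metricType R) : dot v v = 1 ->
  space_of_directions (f v) T -> @alexandrov_boundary R 1 T = set0.
Proof.
move=> v1 sT; apply/seteqP; split=> // y0 [U [h [oU [ch [k [hK _ _]]] [y yE hy]]]].
have [g [gonto gdist]] := directions_circle y0 v1 sT.
have [a [a1 va ga]] := gonto y0.
have pi2 := @pi_ge2 R.
have [e e0 he] := (open_mdist U).1 oU y0 (ltac:(rewrite -yE; exact: set_valP)).
pose e' := Num.min e 1; have e'0 : 0 < e' by rewrite lt_min e0 ltr01.
have e'e : e' <= e by rewrite ge_min lexx.
have e'1 : e' <= 1 by rewrite ge_min lexx orbT.
(* The tangent to the circle at [a]: the vectors [v], [a], [a'] are orthonormal. *)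
pose a' := cross v a.
have aa' : dot a a' = 0 by exact: dot_crossr.
have a'1 : dot a' a' = 1 by rewrite dot_cross v1 a1 va; ring.
have va' : dot v a' = 0 by exact: dot_crossl.
pose p t := g (great_circle a a' t).
have pdist s t : `|s - t| <= pi -> mdist (p s) (p t) = `|s - t|.
  move=> st; rewrite /p gdist ?great_circle_unit //; try by rewrite !dotE va va'; ring.
  by rewrite dot_great_circle // a'1 mulr1 -cosB acos_cos.
have p0 : p 0 = y0.
  by rewrite -ga /p /great_circle cos0 sin0 scale1r scale0r addr0.
have pU t : `|t| < e' -> U (p t).
  move=> te; apply: he; rewrite -p0 pdist sub0r normrN; lra.
pose F t := val (h (insubd y (p t))).
have F0 : F 0 = 0.
  by rewrite /F p0 -yE valKd hy.
have Finj s t : `|s| < e' -> `|t| < e' -> F s = F t -> s = t.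
  move=> se te /val_inj /(can_inj hK) /(congr1 val).
  rewrite !insubdK ?inE; try exact: pU.
  move/(congr1 (fun z => mdist z (p t))); rewrite mdistxx pdist.
    by move/normr0_eq0/subr0_eq.
  by apply: le_trans (ler_normB _ _) _; lra.
have Fge0 t : 0 <= F t by exact: set_valP (h _).
have Fcont t : `|t| < e' -> {for t, continuous F}.
  move=> te; apply/cvgrPdist_lt => r r0.
  have : continuous (fun z : U => val (h z)).
    by move=> z; apply: continuous_comp; [exact: ch|exact: initial_continuous].
  move/(_ (insubd y (p t)))/cvgrPdist_lt/(_ r r0).
  case=> B [/= [W oW WB] Bt] BP; move: Bt; rewrite -WB /= set_valE /= insubdK ?inE;
    last exact: pU.
  move=> /((open_mdist W).1 oW)[r1 r10 hr1].
  apply/nbhs_ballP; exists (Num.min r1 (e' - `|t|)) => /=.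
    by rewrite lt_min r10 subr_gt0.
  move=> s; rewrite /ball /= lt_min => /andP[st1 st2].
  have se : `|s| < e'.
    have := ler_normD (s - t) t; rewrite subrK; rewrite distrC in st2; lra.
  apply: BP; rewrite -WB /= set_valE /= insubdK ?inE; last exact: pU.
  apply: hr1; rewrite pdist //.
  by apply: le_trans (ler_normB _ _) _; lra.
(* The condition 0 < t * s records on which side of 0 the solution lies. *)
have ivt s m : `|s| < e' -> 0 < m < F s -> exists2 t, F t = m & 0 < t * s /\ `|t| <= `|s|.
  move=> se /andP[m0 ms].
  have Fz t : F t = m -> t != 0.
    by move=> Ft; apply: contraTneq m0 => t0; rewrite -Ft t0 F0 ltxx.
  have mm : Num.min (F 0) (F s) <= m <= Num.max (F 0) (F s).
    by rewrite F0 ge_min le_max (ltW m0) (ltW ms) orbT.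
  have [s0|s0] := leP 0 s.
    have [|t] := IVT s0 _ mm.
      apply: continuous_in_subspaceT => t; rewrite inE /= in_itv /= => /andP[t0 ts].
      by apply: Fcont; rewrite ger0_norm // (le_lt_trans ts) // -(ger0_norm s0).
    rewrite in_itv /= => /andP[t0 ts] Ft; exists t => //.
    have tn := Fz _ Ft; have tp : 0 < t by rewrite lt_neqAle eq_sym tn.
    by rewrite !ger0_norm //; split => //; rewrite mulr_gt0 // (lt_le_trans tp).
  rewrite minC maxC in mm.
  have [|t] := IVT (ltW s0) _ mm.
    apply: continuous_in_subspaceT => t; rewrite inE /= in_itv /= => /andP[t0 ts].
    by apply: Fcont; rewrite ler0_norm //; rewrite ltr0_norm // in se; lra.
  rewrite in_itv /= => /andP[ts t0] Ft; exists t => //.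
  have tn := Fz _ Ft; have tp : t < 0 by rewrite lt_neqAle tn.
  by rewrite !ler0_norm ?(ltW s0) //; split; [rewrite nmulr_rgt0|rewrite lerN2].
have e2 : `|e' / 2| < e' by rewrite ger0_norm; lra.
have e3 : `|- (e' / 2)| < e' by rewrite normrN.
have Fpos s : `|s| < e' -> s != 0 -> 0 < F s.
  move=> se s0; rewrite lt_neqAle Fge0 andbT eq_sym; apply: contra_neq s0 => Fs.
  by apply: Finj => //; rewrite ?normr0 // F0.
have P1 : 0 < F (e' / 2) by apply: Fpos => //; rewrite gt_eqF //; lra.
have P2 : 0 < F (- (e' / 2)) by apply: Fpos => //; rewrite lt_eqF //; lra.
pose m := Num.min (F (e' / 2)) (F (- (e' / 2))) / 2.
have mp : 0 < Num.min (F (e' / 2)) (F (- (e' / 2))) by rewrite lt_min P1.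
have m1 : Num.min (F (e' / 2)) (F (- (e' / 2))) <= F (e' / 2) by rewrite ge_min lexx.
have m2 : Num.min (F (e' / 2)) (F (- (e' / 2))) <= F (- (e' / 2)).
  by rewrite ge_min lexx orbT.
have [|t Ft [ts te]] := ivt _ m e2; first by rewrite /m; lra.
have [|t' Ft' [ts' te']] := ivt _ m e3; first by rewrite /m; lra.
have tt' : t = t'.
  by apply: Finj; [exact: le_lt_trans te e2|exact: le_lt_trans te' e3|rewrite Ft Ft'].
by move: ts ts'; rewrite tt'; nra.
Qed.

End circle_of_directions.

(** * Quotient pseudometric on R^3 *)

Section flat_orbifold.
Variable R : realType.
Local Notation V := (R * R * R)%type.
Implicit Types (x y z u v w p : V) (b : bool).

Definition lattice z : bool :=
  [&& z.1.1 \is a Num.int, z.1.2 \is a Num.int & z.2 \is a Num.int].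

Definition sgn b : R := if b then -1 else 1.

Lemma sgnK b : sgn b * sgn b = 1.
Proof. by case: b; rewrite /sgn; ring. Qed.

(* The orbits of the group generated by integral translations and [x |-> - x]. *)
Definition orb x y : Prop := exists b, lattice (y - sgn b *: x).

Lemma lattice0 : lattice 0.
Proof. by rewrite /lattice /= !rpred0. Qed.

Lemma latticeD x y : lattice x -> lattice y -> lattice (x + y).
Proof. by move=> /and3P[h1 h2 h3] /and3P[? ? ?]; rewrite /lattice /= !rpredD. Qed.

Lemma latticeN x : lattice (- x) = lattice x.
Proof. by rewrite /lattice /= !rpredN. Qed.

Lemma latticeB x y : lattice x -> lattice y -> lattice (x - y).
Proof. by move=> hx hy; rewrite latticeD // latticeN. Qed.

Lemma latticeZ b x : lattice x -> lattice (sgn b *: x).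
Proof. by case: b; rewrite /sgn ?scaleN1r ?scale1r ?latticeN. Qed.

Lemma nrm_sgn b x : nrm (sgn b *: x) = nrm x.
Proof. by case: b; rewrite /sgn ?scaleN1r ?scale1r ?nrmN. Qed.

Lemma orb_refl x : orb x x.
Proof. by exists false; rewrite /sgn scale1r subrr lattice0. Qed.

Lemma orb_sym x y : orb x y -> orb y x.
Proof.
move=> [b h]; exists b; rewrite -[x]scale1r -(sgnK b) -scalerA -scalerBr.
by rewrite latticeZ // -latticeN opprB.
Qed.

Lemma orb_trans y x z : orb x y -> orb y z -> orb x z.
Proof.
move=> [b h] [c k]; exists (b (+) c).
have -> : sgn (b (+) c) = sgn c * sgn b by case: b c {h k} => -[]; rewrite /sgn /=; ring.
by rewrite -scalerA -(subrKA (sgn c *: y)) latticeD // -scalerBr latticeZ.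
Qed.

(** The group acts by isometries: [y'] is moved by the element taking [x'] back to [x]. *)
Lemma orb_isometry x x' y' : orb x x' -> exists y, orb y' y /\ nrm (x' - y') = nrm (x - y).
Proof.
move=> [b h]; exists (sgn b *: (y' - (x' - sgn b *: x))); split.
  exists b; have -> : sgn b *: (y' - (x' - sgn b *: x)) - sgn b *: y' =
    - (sgn b *: (x' - sgn b *: x)) by vector_ring.
  by rewrite latticeN latticeZ.
rewrite -(nrm_sgn b (x - _)) scalerBr scalerA sgnK scale1r.
by congr nrm; vector_ring.
Qed.

(** The remainder of [t] modulo a nearest integer, in [-1/2, 1/2), not that integer itself. *)
Definition round (t : R) : R := t - (Num.floor (t + 1 / 2))%:~R.

Lemma round_min (t n : R) : n \is a Num.int -> `|round t| <= `|t - n|.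
Proof.
move=> /intrP[m ->]; rewrite /round; set k := Num.floor _.
have /andP[k1 k2] : k%:~R <= t + 1 / 2 < (k + 1)%:~R by exact: floor_itv.
have [->//|mk] := eqVneq m k.
rewrite intrD in k2.
have : `|t - k%:~R| <= 1 / 2 by rewrite ler_norml; apply/andP; split; lra.
move=> /le_trans; apply; case: (ltgtP m k) mk => // mk _.
  have : (m + 1)%:~R <= k%:~R :> R by rewrite ler_int lezD1.
  rewrite intrD => h; rewrite ger0_norm; lra.
have : (k + 1)%:~R <= m%:~R :> R by rewrite ler_int lezD1.
rewrite intrD => h; rewrite ler0_norm; lra.
Qed.

Definition roundV x : V := (round x.1.1, round x.1.2, round x.2).

Lemma roundV_lattice x : lattice (roundV x - x).
Proof.
have e (t n : R) : t - n - t = - n by ring.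
by rewrite /lattice /= /round !e !rpredN !intr_int.
Qed.

Lemma roundV_min x z : lattice z -> nrm (roundV x) <= nrm (x - z).
Proof.
move=> /and3P[h1 h2 h3]; rewrite ler_sqrt ?dot_ge0 // /dot /= -!expr2.
have sq (s t : R) : `|s| <= `|t| -> s ^+ 2 <= t ^+ 2.
  by move=> st; rewrite -[s ^+ 2]real_normK ?num_real // -[t ^+ 2]real_normK ?num_real //
    ler_sqr ?nnegrE.
by rewrite !lerD //; apply: sq; apply: round_min.
Qed.

(** The distance between two orbits. The group consists of translations and point reflections, and
    rounding minimises over each of the two cosets. *)
Definition flat_dist x y : R := Num.min (nrm (roundV (x - y))) (nrm (roundV (x + y))).

Lemma flat_dist_le x y x' y' : orb x x' -> orb y y' -> flat_dist x y <= nrm (x' - y').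
Proof.
move=> xx' yy'; have [y'' [h ->]] := orb_isometry y' xx'.
have [b {h}] := orb_trans yy' h; rewrite /flat_dist ge_min.
case: b; rewrite /sgn ?scaleN1r ?scale1r ?opprK => h; apply/orP.
  right; have := roundV_min (x + y) h.
  by have -> : x + y - (y'' + y) = x - y'' by vector_ring.
left; have := roundV_min (x - y) h.
by have -> : x - y - (y'' - y) = x - y'' by vector_ring.
Qed.

Lemma flat_dist_attained0 x y : exists y', orb y y' /\ flat_dist x y = nrm (x - y').
Proof.
rewrite /flat_dist; case: (leP (nrm (roundV (x - y))) _) => _.
  exists (x - roundV (x - y)); split; last by rewrite subKr.
  exists false; rewrite /sgn scale1r addrAC -latticeN opprB; exact: roundV_lattice.
exists (x - roundV (x + y)); split; last by rewrite subKr.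
exists true; rewrite /sgn scaleN1r opprK addrAC -latticeN opprB; exact: roundV_lattice.
Qed.

(** A nearest lift of [y] exists whichever lift of [x] is given, so a chain of points can be lifted
    one point at a time. *)
Lemma flat_dist_attained x x' y : orb x x' ->
  exists y', orb y y' /\ flat_dist x y = nrm (x' - y').
Proof.
move=> xx'; have [z [yz e]] := flat_dist_attained0 x y.
have [y' [h e']] := orb_isometry z (orb_sym xx').
by exists y'; split; [exact: orb_trans h|rewrite e e'].
Qed.

Lemma flat_dist_eq0 x y : flat_dist x y = 0 <-> orb x y.
Proof.
split=> [h|h].
  have [y' [yy' e]] := flat_dist_attained0 x y.
  move: e; rewrite h => /esym/eqP; rewrite nrm_eq0 subr_eq0 => /eqP ->.
  exact: orb_sym.
apply/le_anti; have := flat_dist_le h (orb_refl y); rewrite subrr nrm0 => -> /=.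
by rewrite le_min !nrm_ge0.
Qed.

Lemma flat_dist_sym x y : flat_dist x y = flat_dist y x.
Proof.
suff h u v : flat_dist u v <= flat_dist v u by apply/le_anti; rewrite !h.
have [u' [uu' ->]] := flat_dist_attained0 v u.
by rewrite nrmB; apply: flat_dist_le => //; exact: orb_refl.
Qed.

Lemma flat_dist_triangle y x z : flat_dist x z <= flat_dist x y + flat_dist y z.
Proof.
have [y' [yy' ->]] := flat_dist_attained0 x y.
have [z' [zz' ->]] := flat_dist_attained z yy'.
apply: le_trans (nrm_triangle _ _ _); apply: flat_dist_le => //; exact: orb_refl.
Qed.

Lemma flat_dist_le_nrm x y : flat_dist x y <= nrm (x - y).
Proof. by apply: flat_dist_le; exact: orb_refl. Qed.

Lemma lattice_nrm_ge1 z : lattice z -> z != 0 -> 1 <= nrm z.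
Proof.
move=> /and3P[h1 h2 h3] z0; have [n1 n2 n3] := nrm_coord z.
have ge1 (t : R) : t \is a Num.int -> `|t| <= nrm z -> t != 0 -> 1 <= nrm z.
  by move=> ti tz t0; apply: le_trans tz; rewrite norm_intr_ge1.
case: (eqVneq z.1.1 0) => [e1|]; last exact: ge1.
case: (eqVneq z.1.2 0) => [e2|]; last exact: ge1.
case: (eqVneq z.2 0) => [e3|]; last exact: ge1.
by case/eqP: z0; move: e1 e2 e3; case: z {h1 h2 h3 n1 n2 n3 ge1} => [[a b] c] /= -> -> ->.
Qed.

(* [g] is modelled on [R^3 / <+-1>] near [g 0] if [b], on [R^3] otherwise. *)
Definition flat_chart (X : metricType R) b (r : R) (g : V -> X) : Prop :=
  [/\ 0 < r,
      forall u w, nrm u < r -> nrm w < r ->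
        mdist (g u) (g w) = Num.sqrt (dot u u + dot w w - 2 * kap b u w) &
      forall x : X, mdist (g 0) x < r -> exists2 u, g u = x & nrm u = mdist (g 0) x].

(** Near [p] only two group elements can realise the distance: the identity and, when [2 *: p] is a
    lattice vector, the reflection in [p]. The right-hand side is the law of cosines in the quotient
    by these. *)
Lemma flat_dist_local p : exists2 r, 0 < r & forall u w, nrm u < r -> nrm w < r ->
  flat_dist (p + u) (p + w) =
    Num.sqrt (dot u u + dot w w - 2 * kap (lattice (2 *: p)) u w).
Proof.
pose b := lattice (2 *: p).
(* A lower bound for the distance from [2 *: p] to the lattice vectors other than itself. *)
pose rho := if b then 1 else nrm (roundV (2 *: p)).
have rho0 : 0 < rho.
  rewrite /rho; case: ifP => // nb; rewrite nrm_gt0; apply/eqP => h.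
  by have := roundV_lattice (2 *: p); rewrite h sub0r latticeN -/b nb.
have far z : lattice z -> ~ (b /\ z = 2 *: p) -> rho <= nrm (2 *: p - z).
  move=> hz; rewrite /rho; case: ifP => [hb|nb] h; last exact: roundV_min.
  by apply: lattice_nrm_ge1; [exact: latticeB|rewrite subr_eq0; apply/eqP => e; apply: h].
(* 1 / 4 rules out nonzero translations, which move points by at least 1; rho / 4 rules out the
   other reflections. *)
rewrite -/b; exists (Num.min (1 / 4) (rho / 4)); first by rewrite lt_min !divr_gt0.
move=> u w; rewrite !lt_min => /andP[u1 u2] /andP[w1 w2].
have sqB : nrm (u - w) = Num.sqrt (dot u u + dot w w - 2 * dot u w).
  by rewrite /nrm; congr Num.sqrt; rewrite !dotE (dotC w u); ring.
have sqD : nrm (u + w) = Num.sqrt (dot u u + dot w w + 2 * dot u w).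
  by rewrite /nrm; congr Num.sqrt; rewrite !dotE (dotC w u); ring.
have le1 : flat_dist (p + u) (p + w) <= nrm (u - w).
  by apply: le_trans (flat_dist_le_nrm _ _) _; rewrite opprD addrACA subrr add0r.
have uw := nrmD u (- w); rewrite nrmN in uw.
have cases : flat_dist (p + u) (p + w) = nrm (u - w) \/
    b /\ flat_dist (p + u) (p + w) = nrm (u + w).
  have [y [[c hc] e]] := flat_dist_attained0 (p + u) (p + w).
  case: c hc; rewrite /sgn ?scaleN1r ?scale1r ?opprK => hz.
    have [[hb hz']|nz] := pselect (b /\ y + (p + w) = 2 *: p).
      right; split => //; rewrite e.
      have -> : y = 2 *: p - (p + w) by rewrite -hz' addrK.
      by congr nrm; vector_ring.
    have := far _ hz nz.
    have -> : 2 *: p - (y + (p + w)) = (p + u - y) - (u + w).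
      by vector_ring.
    have := nrmD (p + u - y) (- (u + w)); rewrite nrmN.
    by have := nrmD u w; move: le1; rewrite e; lra.
  have [z0|z0] := eqVneq (y - (p + w)) 0.
    left; rewrite e; have -> : y = p + w by apply/subr0_eq.
    by rewrite opprD addrACA subrr add0r.
  have := lattice_nrm_ge1 hz z0.
  have -> : y - (p + w) = (u - w) - (p + u - y) by vector_ring.
  have := nrmD (u - w) (- (p + u - y)); rewrite nrmN.
  by move: le1; rewrite e; lra.
have kE : kap b u w = dot u w \/ b /\ kap b u w = - dot u w.
  rewrite /kap; case: (b); last by left.
  by case: (ger0P (dot u w)) => _; [left|right].
have kle := dot_le_kap b u w.
have le2 : flat_dist (p + u) (p + w) <= Num.sqrt (dot u u + dot w w - 2 * kap b u w).
  case: kE => [->|[hb ->]]; first by rewrite -sqB.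
  rewrite (_ : dot u u + dot w w - 2 * - dot u w = dot u u + dot w w + 2 * dot u w);
    last by ring.
  rewrite -sqD; have := flat_dist_le (orb_refl (p + u)) (y := p + w) (y' := p - w).
  have -> : p + u - (p - w) = u + w by vector_ring.
  apply; exists true; rewrite /sgn scaleN1r opprK.
  by have -> : p - w + (p + w) = 2 *: p by vector_ring.
apply/le_anti; rewrite le2 /=.
case: cases => [->|[hb ->]]; rewrite ?sqB ?sqD; apply: ler_wsqrtr; first lra.
have : - dot u w <= kap b u w by rewrite /kap hb -normrN ler_norm.
lra.
Qed.

End flat_orbifold.

(** * Compactness, length structure and curvature *)

Section flat_orbifold_geometry.
Variable R : realType.
Local Notation V := (R * R * R)%type.
Variables (X : metricType R) (pr : V -> X).
Hypothesis pr_onto : forall x, exists v, pr v = x.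
Hypothesis pr_dist : forall v w, mdist (pr v) (pr w) = flat_dist v w.

Lemma pr_eq v w : pr v = pr w <-> orb v w.
Proof.
rewrite -flat_dist_eq0 -pr_dist.
by split=> [->|h]; [exact: mdistxx|exact: mdist_positivity].
Qed.

Lemma pr_le v w : mdist (pr v) (pr w) <= nrm (v - w).
Proof. by rewrite pr_dist; exact: flat_dist_le_nrm. Qed.

Lemma pr_lift v x : exists w, pr w = x /\ mdist (pr v) x = nrm (v - w).
Proof.
have [w <-] := pr_onto x; rewrite pr_dist.
by have [w' [/pr_eq e ->]] := flat_dist_attained0 v w; exists w'.
Qed.

Lemma pr_continuous : continuous pr.
Proof.
move=> v; apply/metricType_numDomainType.cvgrPdist_lt => e e0.
apply/nbhs_nrmP; exists e => // w h.
by apply: le_lt_trans (pr_le _ _) _; rewrite nrmB.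
Qed.

Lemma orb_cube (v : V) : exists2 w : V, orb v w &
  [/\ `|w.1.1| <= 1, `|w.1.2| <= 1 & `|w.2| <= 1].
Proof.
exists (roundV v).
  by exists false; rewrite /sgn scale1r; exact: roundV_lattice.
have h (t : R) : `|round t| <= 1.
  have /andP[k1 k2] : (Num.floor (t + 1 / 2))%:~R <= t + 1 / 2 <
    (Num.floor (t + 1 / 2) + 1)%:~R by exact: floor_itv.
  by move: k2; rewrite intrD /round ler_norml => k2; apply/andP; split; lra.
by split; exact: h.
Qed.

Lemma flat_orbifold_compact : compact [set: X].
Proof.
have -> : [set: X] = pr @` [set w : V | [/\ `|w.1.1| <= 1, `|w.1.2| <= 1 & `|w.2| <= 1]].
  apply/seteqP; split=> // x _; have [v <-] := pr_onto x.
  by have [w /pr_eq vw hw] := orb_cube v; exists w.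
apply: continuous_compact; last exact: cube_compact.
by apply: continuous_subspaceT; exact: pr_continuous.
Qed.

(** The trivial partition shows that no curve is shorter than the distance. Conversely the segment
    to a nearest lift projects to a curve no longer than the distance, because [pr] does not
    increase lengths. *)
Lemma flat_orbifold_length_space : length_space X.
Proof.
move=> x y; apply/le_anti/andP; split.
  apply: le_ereal_inf_tmp => _ [c [_ c0 c1] <-].
  apply: ereal_sup_ubound; exists [:: 1].
    by split => //=; rewrite ltr01.
  by rewrite big_nat1 /= c0 c1.
have [v vx] := pr_onto x; have [w [wy e]] := pr_lift v y.
rewrite vx in e.
apply: ge_ereal_inf; exists (curve_length 0 1 (fun t => pr (v + t *: (w - v)))).
  exists (fun t => pr (v + t *: (w - v))) => //; split.
  - apply: continuous_subspaceT => t; apply/metricType_numDomainType.cvgrPdist_lt => r r0.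
    have n0 : 0 < nrm (w - v) + 1 by rewrite ltr_wpDl ?nrm_ge0.
    apply/nbhs_ballP; exists (r / (nrm (w - v) + 1)) => /=; first by rewrite divr_gt0.
    move=> s; rewrite /ball /= ltr_pdivlMr // => h.
    apply: le_lt_trans (pr_le _ _) _.
    have -> : v + t *: (w - v) - (v + s *: (w - v)) = (t - s) *: (w - v) by vector_ring.
    by rewrite nrmZ; apply: le_lt_trans h; rewrite ler_wpM2l // lerDl.
  - by rewrite scale0r addr0 vx.
  - by rewrite scale1r subrKC wy.
apply: ge_ereal_sup => _ [s [ps /eqP ls] <-]; rewrite lee_fin e.
pose F i := nth 1 (0 :: s) i.
have -> : nrm (v - w) = \sum_(0 <= i < size s) (F i.+1 - F i) * nrm (w - v).
  have FS : F (size s) = 1 by rewrite -[RHS]ls (last_nth 1).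
  by rewrite -mulr_suml telescope_sumr // FS [F 0%N]/= subr0 mul1r nrmB.
rewrite big_nat [leRHS]big_nat; apply: ler_sum => i /andP[_ hi].
apply: le_trans (pr_le _ _) _.
have -> : v + nth 1 (0 :: s) i *: (w - v) - (v + nth 1 (0 :: s) i.+1 *: (w - v)) =
  (F i - F i.+1) *: (w - v) by rewrite /F; vector_ring.
have : F i < F i.+1 by apply: (pathP 1 ps).
by rewrite nrmZ => h; rewrite ltr0_norm ?subr_lt0 // opprB.
Qed.

(* Lift the point on the side first, then each vertex to a point nearest to this
   lift: the side becomes a segment and the distances to the apex can only grow. *)
Lemma flat_orbifold_curvature : curvature_ge X 0.
Proof.
move=> x0; exists setT; first exact: filterT.
move=> a b c g t a' b' c' d' _ _ _ hg g0 g1 /andP[t0 t1] ma mb mc md.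
move: ma mb mc md; rewrite /model_plane /= eqxx => ma mb mc md.
have mE y z : y.2 = 0 -> z.2 = 0 -> @model_dist R 0 y z = nrm (y - z).
  move=> hy hz; rewrite /model_dist ltxx /nrm /dot /= hy hz; congr Num.sqrt; ring.
rewrite !mE //; set l := mdist b c => eab eac ebc ebd edc.
have l0 : 0 <= l by exact: mdist_ge0.
have gt : mdist b (g t) = t.
  rewrite -[in LHS]g0 hg ?lexx ?t0 ?t1 ?l0 // sub0r normrN ger0_norm //.
have gt' : mdist c (g t) = l - t.
  by rewrite -[in LHS]g1 hg ?lexx ?t0 ?t1 ?l0 // ger0_norm // subr_ge0.
have [d dE] := pr_onto (g t).
have [A [AE hA]] := pr_lift d a; have [B [BE hB]] := pr_lift d b.
have [C [CE hC]] := pr_lift d c.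
rewrite dE metric_sym in hA; rewrite dE metric_sym gt in hB; rewrite dE metric_sym gt' in hC.
have leAB : mdist a b <= nrm (A - B) by rewrite -AE -BE pr_le.
have leAC : mdist a c <= nrm (A - C) by rewrite -AE -CE pr_le.
have leBC : l <= nrm (B - C) by rewrite /l -BE -CE pr_le.
rewrite hA.
(* Stewart's relation says nothing when l = 0, so this degenerate triangle is treated apart. *)
have [l00|ln0] := eqVneq l 0.
  have tt : t = 0 by apply/le_anti; rewrite t0 -l00 t1.
  have -> : d' = b' by apply/esym/subr0_eq/eqP; rewrite -nrm_eq0 ebd tt.
  have <- : B = d by apply/esym/subr0_eq/eqP; rewrite -nrm_eq0 -hB tt.
  by rewrite eab (nrmB B).
have lp : 0 < l by rewrite lt_neqAle eq_sym ln0.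
(* Stewart's theorem, from [d - b = (t / l) (c - b)]. *)
have stewart (p q r s : V) : nrm (q - s) = t -> nrm (s - r) = l - t ->
    l <= nrm (q - r) -> l * nrm (p - s) ^+ 2 =
    (l - t) * nrm (p - q) ^+ 2 + t * nrm (p - r) ^+ 2 - t * (l - t) * l.
  move=> h1 h2 h3.
  have e1 := sqr_nrm (q - s); have e2 := sqr_nrm (s - r).
  rewrite h1 in e1; rewrite h2 in e2.
  have e3 : l ^+ 2 <= dot (q - r) (q - r).
    by rewrite -sqr_nrm ler_sqr ?nnegrE ?nrm_ge0.
  have e4 : dot (q - r) (q - r) = t ^+ 2 + (l - t) ^+ 2 + 2 * dot (q - s) (s - r).
    rewrite e1 e2; have -> : q - r = (q - s) + (s - r) by vector_ring.
    by move: (q - s) (s - r) => y z; rewrite !(dotDl, dotDr) (dotC z y); ring.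
  (* The bound l <= |q - r| forces equality in the triangle inequality, so the two parts of the side
     are proportional. *)
  have z0 : dot ((l - t) *: (q - s) - t *: (s - r)) ((l - t) *: (q - s) - t *: (s - r)) <= 0.
    have tl : t * (l - t) <= dot (q - s) (s - r) by move: e3; rewrite e4; lra.
    have tl0 : 0 <= t * (l - t) by rewrite mulr_ge0 // subr_ge0.
    move: (q - s) (s - r) e1 e2 tl {e3 e4 h1 h2 h3} => y z e1 e2 tl.
    have := mulr_ge0 tl0 (etrans (subr_ge0 _ _) tl).
    rewrite dotBl !dotBr !dotZl !dotZr (dotC z y) -e1 -e2; lra.
  have z1 : (l - t) *: (q - s) - t *: (s - r) = 0.
    by apply: dot_eq0; apply/le_anti; rewrite z0 dot_ge0.
  rewrite !sqr_nrm.
  have -> : p - q = (p - s) - (q - s) by vector_ring.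
  have -> : p - r = (p - s) + (s - r) by vector_ring.
  move: z1 {e3 e4 h1 h2 h3 z0}.
  move: (p - s) (q - s) (s - r) e1 e2 => k y z e1 e2 /(congr1 (dot k)) h.
  rewrite dotBr !dotZr dot0r in h.
  rewrite !dotBl !dotBr !dotDl !dotDr (dotC y k) (dotC z k) -e1 -e2; nra.
have S1 := stewart a' b' c' d' ebd edc (ltac:(by rewrite ebc)).
have S2 := stewart A B C d (ltac:(by rewrite nrmB hB)) (ltac:(by rewrite hC)) leBC.
rewrite (nrmB d) -ler_sqr ?nnegrE ?nrm_ge0 // -(ler_pM2l lp) S1 S2 lerD2r lerD //.
  by rewrite ler_wpM2l ?subr_ge0 // ler_sqr ?nnegrE ?nrm_ge0 // eab.
by rewrite ler_wpM2l // ler_sqr ?nnegrE ?nrm_ge0 // eac.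
Qed.

Lemma flat_orbifold_chart p : exists r,
  flat_chart (lattice (2 *: p)) r (fun u => pr (p + u)).
Proof.
have [r r0 hr] := flat_dist_local p; exists r; split => //.
  by move=> u w ur wr; rewrite pr_dist hr.
move=> x; rewrite addr0 => _; have [w [<- ->]] := pr_lift p x.
by exists (w - p); rewrite ?subrKC // nrmB.
Qed.

End flat_orbifold_geometry.

(** * Hausdorff dimension *)

Section hausdorff_dimension.
Variable R : realType.
Local Notation V := (R * R * R)%type.
Implicit Types (u v w : V) (s h c : R).

Local Notation mu := ((@lebesgue_measure R \x @lebesgue_measure R) \x @lebesgue_measure R)%E.

Definition box v h : set V :=
  `[v.1.1 - h, v.1.1 + h]%classic `*` `[v.1.2 - h, v.1.2 + h]%classic `*`
  `[v.2 - h, v.2 + h]%classic.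

Lemma boxP v h w : box v h w <->
  [/\ `|w.1.1 - v.1.1| <= h, `|w.1.2 - v.1.2| <= h & `|w.2 - v.2| <= h].
Proof. by rewrite /box /= !in_itv /= -!ler_distl; split=> [[[]]|[]]. Qed.

Lemma measurable_box v h : measurable (box v h).
Proof. by apply: measurableX; first apply: measurableX; exact: measurable_itv. Qed.

Lemma measure_box v h : 0 <= h -> mu (box v h) = ((2 * h) ^+ 3)%:E.
Proof.
move=> h0; have len a : @lebesgue_measure R `[a - h, a + h]%classic = (2 * h)%:E.
  rewrite lebesgue_measure_itv /= lte_fin; case: ltP => hh.
    by rewrite -EFinB; congr EFin; ring.
  by congr EFin; lra.
have mi a b : measurable (`[a, b]%classic : set R) by exact: measurable_itv.
have e1 := product_measure1E (@lebesgue_measure R \x @lebesgue_measure R)%E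
  (@lebesgue_measure R)
  (measurableX (mi (v.1.1 - h) (v.1.1 + h)) (mi (v.1.2 - h) (v.1.2 + h)))
  (mi (v.2 - h) (v.2 + h)).
have e2 := product_measure1E (@lebesgue_measure R) (@lebesgue_measure R)
  (mi (v.1.1 - h) (v.1.1 + h)) (mi (v.1.2 - h) (v.1.2 + h)).
pose mul := fun y z : \bar R => (y * z)%E.
have e3 := etrans e2 (f_equal2 mul (len v.1.1) (len v.1.2)).
apply: etrans (etrans e1 (f_equal2 mul e3 (len v.2))) _.
by rewrite /mul -!EFinM; congr EFin; ring.
Qed.

Section diameter.
Variable X : metricType R.
Implicit Types A : set X.

Lemma diameter_ge0 A : (0 <= diameter A)%E.
Proof. by apply: ereal_sup_ubound; left. Qed.

Lemma mdist_le_diameter A y z : A y -> A z -> ((mdist y z)%:E <= diameter A)%E.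
Proof. by move=> Ay Az; apply: ereal_sup_ubound; right; exists (y, z). Qed.

Lemma diameter_le A c : 0 <= c -> (forall y z, A y -> A z -> mdist y z <= c) ->
  (diameter A <= c%:E)%E.
Proof.
move=> c0 h; apply: ge_ereal_sup => _ [->|[[y z] [/= Ay Az] <-]]; first by rewrite lee_fin.
by rewrite lee_fin h.
Qed.

Lemma diameter0 : diameter (set0 : set X) = 0%E.
Proof. by apply/le_anti; rewrite diameter_ge0 andbT; apply: diameter_le. Qed.

(* Volume bounds the sum of the cubed diameters from below. *)
Lemma hausdorff_measure_gt0 r (g : V -> X) s : flat_chart false r g ->
  0 < s <= 3 -> hausdorff_measure s [set: X] != 0%E.
Proof.
move=> [r0 giso _] /andP[s0 s3]; apply/eqP => Hs.
pose h := r / 4; have h0 : 0 < h by rewrite divr_gt0.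
(* The part of the cube mapped into a set of diameter d <= 1 lies in a cube of side 2 d, of volume 8
   d^3 <= 8 d^s since s <= 3. So no cover sums to less than one eighth of the volume of
   [box 0 h]. *)
pose e : R := (2 * h) ^+ 3 / 8.
have e0 : 0 < e by rewrite divr_gt0 // exprn_gt0 // mulr_gt0.
have : (hausdorff_premeasure s 1 [set: X] <= 0)%E.
  by rewrite -Hs; apply: ereal_sup_ubound; exists 1 => //=.
move=> /le_lt_trans => /(_ e%:E); rewrite lte_fin => /(_ e0) /ereal_inf_lt.
move=> [_ [F [Fcov Fd] <-]]; apply/negP; rewrite -leNgt.
have dfin i : diameter (F i) \is a fin_num.
  by rewrite ge0_fin_numE ?diameter_ge0 // (le_lt_trans (Fd i)) // ltry.
pose d i := fine (diameter (F i)).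
have dE i : diameter (F i) = (d i)%:E by rewrite fineK.
have d0 i : 0 <= d i by rewrite -lee_fin -dE diameter_ge0.
have d1 i : d i <= 1 by rewrite -lee_fin -dE Fd.
have small w : box 0 h w -> nrm w < r.
  move=> /boxP[/= h1 h2 h3]; rewrite !subr0 in h1 h2 h3.
  by apply: le_lt_trans (nrm_le_coord h1 h2 h3) _; rewrite /h; lra.
have /choice[a aE] i : exists a, forall w, box 0 h w -> F i (g w) -> box a (d i) w.
  have [[a [a1 a2]]|na] := pselect (exists a, box 0 h a /\ F i (g a)); last first.
    by exists 0 => w w1 w2; case: na; exists w.
  exists a => w w1 w2; apply/boxP.
  have : nrm (w - a) <= d i.
    rewrite -lee_fin -dE; have <- : mdist (g w) (g a) = nrm (w - a).
      rewrite giso ?small // /kap /nrm; congr Num.sqrt.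
      by rewrite !dotE (dotC a w); ring.
    exact: mdist_le_diameter.
  have [n1 n2 n3] := nrm_coord (w - a).
  by move=> n; split; [exact: le_trans n1 n|exact: le_trans n2 n|exact: le_trans n3 n].
have sub : box 0 h `<=` \bigcup_i box (a i) (d i).
  by move=> w hw; have [i _ Fi] := Fcov (g w) I; exists i => //; exact: aE.
have mb i : measurable (box (a i) (d i)) by exact: measurable_box.
have hle : (((2 * h) ^+ 3)%:E <= \sum_(0 <= i <oo) ((2 * d i) ^+ 3)%:E)%E.
  rewrite -(measure_box 0 (ltW h0)).
  rewrite (@eq_eseriesr _ _ (fun i => mu (box (a i) (d i)))); last first.
    by move=> i _; rewrite measure_box.
  exact: (measure_sigma_subadditive mu mb (measurable_box 0 h) sub).
have : (((2 * h) ^+ 3)%:E <= 8%:E * \sum_(0 <= i <oo) (diameter (F i) `^ s)%E)%E.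
  apply: le_trans hle _; rewrite -nneseriesZl; last by move=> i _; exact: poweR_ge0.
  apply: lee_nneseries => [i _ _|i _]; first by rewrite lee_fin exprn_ge0 // mulr_ge0.
  rewrite dE poweR_EFin -EFinM lee_fin.
  rewrite exprMn (_ : 2 ^+ 3 = 8); last by ring.
  rewrite ler_pM2l //; have [->|dn0] := eqVneq (d i) 0.
    by rewrite expr0n /= powR_ge0.
  rewrite -powR_mulrn //; apply: ger_powR => //.
  by rewrite lt_neqAle eq_sym dn0 d0 d1.
by move=> hh; rewrite /e (EFinM _ 8^-1) lee_pdivrMr // muleC.
Qed.

Lemma nneseries_finite_support (f : nat -> \bar R) N c : 0 <= c ->
  (forall i, (0 <= f i)%E) -> (forall i, (f i <= c%:E)%E) ->
  (forall i, (N <= i)%N -> f i = 0%E) ->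
  (\sum_(0 <= i <oo) f i <= (N%:R * c)%:E)%E.
Proof.
move=> c0 f0 fc fN; rewrite (@nneseries_split _ f 0 N) // add0n.
rewrite [X in (_ + X)%E]eseries0 ?adde0; last by move=> i Ni _; exact: fN.
apply: (@le_trans _ _ (\sum_(0 <= k < N) c%:E)%E); first exact: lee_sum.
by rewrite big_mkord sumEFin lee_fin sumr_const card_ord mulr_natl.
Qed.

(** Cutting [-1, 1]^3 into cells of side 2 / n gives about n^3 sets of diameter at most 4 / n, whose
    total n^3 (4 / n)^s tends to 0. *)
Lemma hausdorff_measure_eq0 (g : V -> X) s : 3 < s ->
  (forall x, exists v, g v = x /\ box 0 1 v) ->
  (forall v w, mdist (g v) (g w) <= nrm (v - w)) ->
  hausdorff_measure s [set: X] = 0%E.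
Proof.
move=> s3 g_onto g_lip; apply/le_anti/andP; split; last first.
  apply: le_trans (ereal_sup_ubound _); last by exists 1 => //=.
  apply: le_ereal_inf_tmp => _ [F _ <-]; apply: nneseries_ge0 => i _ _; exact: poweR_ge0.
apply: ge_ereal_sup => _ [delta /= delta0 <-].
apply/lee_addgt0Pr => e e0; rewrite add0e.
(* The sum will be at most 8 * 4^s / n^(s - 3), and the last term of [K] forces n^(s - 3) >= C / e,
   with room to spare. The other terms give n >= 1 and diameters at most [delta]. *)
pose C : R := 64 * 4 `^ s; have C0 : 0 < C by rewrite mulr_gt0 // powR_gt0.
pose K := Num.max (Num.max 1 (4 / delta)) ((C / e) `^ (s - 3)^-1).
pose n := (Num.truncn K).+1; have Kn : K < n%:R by exact: truncnS_gt.
have n0 : 0 < n%:R :> R by rewrite ltr0n.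
have [n1 nd nC] : [/\ 1 <= n%:R :> R, 4 / delta <= n%:R & (C / e) `^ (s - 3)^-1 <= n%:R].
  by move: (ltW Kn); rewrite /K !ge_max => /andP[/andP[]].
(* One cell more than n in each coordinate, so that the endpoint 1 is covered. *)
pose m := n.+1; pose T := ('I_m * 'I_m * 'I_m)%type.
pose ctr (k : 'I_m) : R := k%:R * (2 / n%:R) - 1.
pose cube (t : T) := [set v : V | [/\ ctr t.1.1 <= v.1.1 <= ctr t.1.1 + 2 / n%:R,
  ctr t.1.2 <= v.1.2 <= ctr t.1.2 + 2 / n%:R & ctr t.2 <= v.2 <= ctr t.2 + 2 / n%:R]].
pose F i : set X :=
  if insub i : option 'I_#|{: T}| is Some j then g @` cube (enum_val j) else set0.
have cell (t : R) : `|t - 0| <= 1 -> exists k : 'I_m, ctr k <= t <= ctr k + 2 / n%:R.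
  rewrite subr0 ler_norml => /andP[t1 t2].
  pose y := (t + 1) * n%:R / 2.
  have y0 : 0 <= y by rewrite divr_ge0 // mulr_ge0 //; lra.
  have /andP[k1 k2] : (Num.truncn y)%:R <= y < (Num.truncn y).+1%:R by exact: truncn_itv.
  have kn : (Num.truncn y < m)%N.
    rewrite ltnS -(ler_nat R); apply: le_trans k1 _.
    by rewrite /y ler_pdivrMr // mulrC ler_pM2l //; lra.
  exists (Ordinal kn); rewrite /ctr /=.
  have tE : t = y * (2 / n%:R) - 1 by rewrite /y; field; rewrite gt_eqF.
  have n2 : 0 < 2 / n%:R :> R by rewrite divr_gt0.
  rewrite -natr1 in k2; move: (Num.truncn y)%:R k1 k2 => k k1 k2.
  rewrite {}tE; move: (2 / n%:R) n2 => z z0; apply/andP; split; nra.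
have Fcov : [set: X] `<=` \bigcup_i F i.
  move=> x _; have [v [<- /boxP[h1 h2 h3]]] := g_onto x.
  have [a ha] := cell _ h1; have [b hb] := cell _ h2; have [c hc] := cell _ h3.
  exists (enum_rank (a, b, c)) => //; rewrite /F.
  rewrite insubT //= => hj; exists v => //.
  by rewrite (_ : Sub _ _ = enum_rank (a, b, c)) ?enum_rankK //; apply: val_inj.
have Fdiam i : (diameter (F i) <= (4 / n%:R)%:E)%E.
  have c0 : 0 <= 4 / n%:R :> R by rewrite divr_ge0 // ltW.
  apply: diameter_le => // y z; rewrite /F; case: insub => // j.
  move=> [v [a1 a2 a3] <-] [w [b1 b2 b3] <-].
  apply: le_trans (g_lip _ _) _; rewrite (_ : 4 / n%:R = 2 * (2 / n%:R));
    last by field; rewrite gt_eqF.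
  by apply: nrm_le_coord => /=; rewrite ler_norml; apply/andP; split; lra.
apply: ge_ereal_inf; eexists.
  exists F => //; split => // i; apply: le_trans (Fdiam i) _.
  by rewrite lee_fin ler_pdivrMr // mulrC -ler_pdivrMr.
apply: le_trans (@nneseries_finite_support _ #|{: T}| ((4 / n%:R) `^ s) _ _ _ _) _.
- exact: powR_ge0.
- by move=> i; exact: poweR_ge0.
- have s0 : 0 <= s by lra.
  have n40 : 0 <= 4 / n%:R :> R by rewrite divr_ge0 // ltW.
  move=> i; rewrite -poweR_EFin; apply: (gt0_ler_poweR s0) (Fdiam i).
    by rewrite in_itv /= leey diameter_ge0.
  by rewrite in_itv /= leey lee_fin n40.
- move=> i Ni; rewrite /F insubF; last by rewrite ltnNge Ni.
  by rewrite diameter0 poweR0r // gt_eqF //; lra.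
rewrite lee_fin !card_prod card_ord.
have s30 : 0 < s - 3 by lra.
have nE : n%:R `^ s = n%:R ^+ 3 * n%:R `^ (s - 3) :> R.
  rewrite -powR_mulrn ?ltW // -powRD ?subrKC //.
  by apply/implyP => _; rewrite gt_eqF.
have big : C / e <= n%:R `^ (s - 3).
  have := ge0_ler_powR (ltW s30) (powR_ge0 (C / e) (s - 3)^-1) (ltW n0) nC.
  rewrite -powRrM mulVf ?gt_eqF // powRr1 // divr_ge0 ?ltW //.
rewrite powRM ?invr_ge0 ?(ltW n0) // -powR_inv1 ?(ltW n0) // -powRrM mulN1r powRN nE.
rewrite !natrM -/m mulrA. rewrite ler_pdivrMr; last by rewrite mulr_gt0 ?exprn_gt0 // powR_gt0.
have m2 : m%:R <= 2 * n%:R :> R by rewrite /m -(natr1 n); lra.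
have m3 : m%:R * m%:R * m%:R <= (2 * n%:R) ^+ 3 :> R.
  by rewrite !exprS expr0 mulr1 mulrA; do 2! rewrite ler_pM ?mulr_ge0 //.
apply: le_trans (ler_wpM2r (powR_ge0 _ _) m3) _.
move: big; rewrite ler_pdivrMr // => big.
have n3 : 0 <= n%:R ^+ 3 :> R by rewrite exprn_ge0 // ltW.
have := ler_wpM2l n3 big; have := powR_ge0 4 s; rewrite /C exprMn.
have := mulr_ge0 n3 (powR_ge0 4 s); lra.
Qed.

End diameter.
End hausdorff_dimension.

(** * Spaces of directions of a flat chart *)

Section directions_of_flat_chart.
Variable R : realType.
Local Notation V := (R * R * R)%type.
Implicit Types (u v w : V) (s t : R).

(* [S] is the unit sphere of [V] with the angle metric, modulo [v |-> - v] if [b]. *)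
Definition spherical (b : bool) (S : metricType R) (f : V -> S) : Prop :=
  (forall s : S, exists2 v, dot v v = 1 & f v = s) /\
  forall v w, dot v v = 1 -> dot w w = 1 -> mdist (f v) (f w) = acos (kap b v w).

Definition unit_vector : V := (1, 0, 0).

Lemma unit_vector_unit : dot unit_vector unit_vector = 1.
Proof. by rewrite /dot /=; ring. Qed.

Lemma spherical_compact b (S : metricType R) (f : V -> S) :
  spherical b f -> compact [set: S].
Proof.
move=> [f_onto f_dist].
have -> : [set: S] = f @` [set v | dot v v = 1].
  by apply/seteqP; split=> // s _; have [v v1 <-] := f_onto s; exists v.
exact: (angular_image_compact (b := b)) (@sphere_compact R) _ _.
Qed.

(** Supplies an actual space of directions, needed to show that gluing data exist. *)
Lemma spherical_exists b : exists (S : metricType R) (f : V -> S), spherical b f.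
Proof.
pose A := {v : V | dot v v == 1}.
have A1 (a : A) : dot (val a) (val a) = 1 by exact/eqP/(valP a).
pose d (a a' : A) := acos (kap b (val a) (val a')).
have [||a a' a''|S [f [f_onto f_dist]]] := @metric_quotient_exists R A d.
- by move=> a; exact: acos_kap_xx.
- by move=> a a'; rewrite /d kapC.
- exact: acos_kap_triangle.
have unit_vectorP : dot unit_vector unit_vector == 1 by rewrite unit_vector_unit.
exists S, (fun v => f (insubd (Sub unit_vector unit_vectorP) v)); split=> [s|v w v1 w1].
  by have [a <-] := f_onto s; exists (val a); rewrite ?valKd.
by rewrite f_dist /d !insubdK // -topredE /= ?v1 ?w1.
Qed.

Variables (X : metricType R) (b : bool) (r : R) (g : V -> X).
Hypothesis g_chart : flat_chart b r g.

Lemma flat_chart_gt0 : 0 < r. Proof. by case: g_chart. Qed.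
Let r0 := flat_chart_gt0.

Lemma kapZ s t u w : 0 <= s * t -> kap b (s *: u) (t *: w) = s * t * kap b u w.
Proof.
move=> st; rewrite /kap dotZl dotZr mulrA; case: b => //.
by rewrite normrM ger0_norm.
Qed.

Lemma nrmZ_unit v t : dot v v = 1 -> 0 <= t -> nrm (t *: v) = t.
Proof. by move=> v1 t0; rewrite nrmZ ger0_norm // (unit_nrm v1) mulr1. Qed.

Lemma flat_chart_polar v w s t : dot v v = 1 -> dot w w = 1 -> 0 <= s < r -> 0 <= t < r ->
  mdist (g (s *: v)) (g (t *: w)) = Num.sqrt (s ^+ 2 + t ^+ 2 - 2 * s * t * kap b v w).
Proof.
case: g_chart => _ gd _ v1 w1 /andP[s0 sr] /andP[t0 tr].
rewrite gd ?nrmZ_unit // kapZ ?mulr_ge0 // !dotZl !dotZr v1 w1.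
by congr Num.sqrt; ring.
Qed.

Lemma flat_chart_radius u : nrm u < r -> mdist (g 0) (g u) = nrm u.
Proof.
case: g_chart => _ gd _ ur; rewrite gd ?nrm0 // /kap !dot0l normr0 if_same.
by rewrite mulr0 subr0 add0r.
Qed.

Lemma flat_chart_even u : b -> nrm u < r -> g (- u) = g u.
Proof.
case: g_chart => _ gd _ hb ur; apply: mdist_positivity.
rewrite gd ?nrmN // kapC kapNr // /kap hb ger0_norm ?dot_ge0 // !dotE.
by rewrite [X in Num.sqrt X](_ : _ = 0) ?sqrtr0 //; ring.
Qed.

Lemma ray_geodesic v : dot v v = 1 -> geodesic_from (g 0) (fun t => g (t *: v)).
Proof.
move=> v1; split; first by rewrite scale0r.
have := r0 => rp.
exists (r / 2); first by rewrite divr_gt0.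
move=> s t /andP[s0 s1] /andP[t0 t1]; rewrite flat_chart_polar //;
  try by rewrite ?s0 ?t0 /=; lra.
rewrite /kap v1 normr1 if_same mulr1 -sqrtr_sqr; congr Num.sqrt; ring.
Qed.

(** Equality case of Cauchy-Schwarz: the distances to [g 0] and to the endpoint [w] force dot u w =
    |u| |w| after a choice of sign, so each intermediate point lies on the ray through [w]. *)
Lemma geodesic_ray c : geodesic_from (g 0) c -> exists v t0,
  [/\ dot v v = 1, 0 < t0 & forall t, 0 <= t <= t0 -> c t = g (t *: v)].
Proof.
case: g_chart => _ gd g_lift [c0 [l l0 cl]]; have := r0 => rp.
pose t0 := Num.min l (r / 2); have t00 : 0 < t0 by rewrite lt_min l0 divr_gt0.
have t0l : t0 <= l by rewrite ge_min lexx.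
have t0r : t0 < r by rewrite gt_min; apply/orP; right; lra.
have lift t : 0 <= t <= t0 -> exists2 u, g u = c t & nrm u = t.
  case/andP=> tt0 tt1; have e : mdist (g 0) (c t) = t.
    by rewrite -c0 cl ?sub0r ?normrN ?ger0_norm // ?lexx ?(ltW l0) ?tt0 ?(le_trans tt1 t0l).
  by have [|u gu nu] := g_lift (c t); rewrite ?e //; [lra|exists u; rewrite ?nu].
have [|w gw nw] := lift t0; first by rewrite lexx ltW.
pose v := t0^-1 *: w; have wE : w = t0 *: v by rewrite scalerA mulfV ?scale1r // gt_eqF.
have v1 : dot v v = 1.
  by apply: nrm1_dot; rewrite nrmZ nw gtr0_norm ?invr_gt0 // mulVf // gt_eqF.
move: v wE v1 => v wE v1; exists v, t0; split => // t ht; have [u gu nu] := lift t ht;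
  case/andP: ht => tt0 tt1.
have tr : t < r by exact: le_lt_trans tt1 t0r.
have : mdist (g u) (g w) = t0 - t.
  by rewrite gu gw cl ?tt0 ?(le_trans tt1) ?(ltW t00) // distrC ger0_norm ?subr_ge0.
rewrite gd ?nu ?nw // -!sqr_nrm nu nw => /(congr1 (fun z => z ^+ 2)).
rewrite sqr_sqrtr; last first.
  have h : kap b u w <= t * t0.
    rewrite -nu -nw; have := CauchySchwarz u w; rewrite /kap; case: b => //.
    by apply: le_trans; exact: ler_norm.
  by have := sqr_ge0 (t0 - t); nra.
move=> e; have kE : kap b u w = t * t0 by nra.
have [w' [hw w'1 kE']] : exists u', [/\ g u' = g u, nrm u' = t & dot u' w = t * t0].
  move: kE; rewrite /kap; case hb : b => kE; last by exists u.
  have [d0|d0] := ger0P (dot u w).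
    by exists u; rewrite -kE ger0_norm.
  exists (- u); rewrite flat_chart_even ?nu ?nrmN // dotNl; split => //.
  by rewrite -kE ltr0_norm.
rewrite -gu -hw; congr g; apply/subr0_eq/dot_eq0.
rewrite !dotE v1 -(sqr_nrm w') w'1; have := kE'; rewrite wE dotZr (dotC v w') => h.
have -> : dot w' v = t by apply: (mulfI (lt0r_neq0 t00)); rewrite h mulrC.
by ring.
Qed.

(** By the law of cosines in the chart, the comparison angle along two rays is constant for small
    parameters. *)
Lemma angle_rays v w : dot v v = 1 -> dot w w = 1 ->
  angle_is (fun t => g (t *: v)) (fun t => g (t *: w)) (acos (kap b v w)).
Proof.
move=> v1 w1; have := r0 => rp; have [k1 k2] := andP (kap_itv b v1 w1).
have near0 : \forall t \near (0 : R)^'+, 0 < t < r.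
  by near=> t; apply/andP; split; near: t; [exact: nbhs_right_gt|exact: nbhs_right_lt].
apply: cvg_near_cst; exists ([set t | 0 < t < r], [set t | 0 < t < r]); first by split.
move=> [s t] [/= /andP[s0 sr] /andP[t0 tr]]; rewrite /comparison_angle /=.
rewrite flat_chart_polar ?(ltW s0) ?(ltW t0) // sqr_sqrtr; last first.
  have st : 0 <= s * t by rewrite mulr_ge0 ?ltW.
  by have := sqr_ge0 (s - t); nra.
by congr acos; field; rewrite !gt_eqF.
Unshelve. all: by end_near. Qed.

(** Every geodesic starts as a ray, so the directions of rays are dense in [S]; being compact, they
    exhaust it. *)
Lemma directions_spherical (S : metricType R) : space_of_directions (g 0) S ->
  exists f : V -> S, spherical b f.
Proof.
move=> [_ [dir [dirE dird]]].
(* Vectors that are not unit get the ray of [unit_vector], to make the map total. *)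
pose ray v : {c : R -> X | geodesic_from (g 0) c} :=
  if pselect (dot v v = 1) is left v1 then exist _ _ (ray_geodesic v1)
  else exist _ _ (ray_geodesic unit_vector_unit).
have rayE v : dot v v = 1 -> sval (ray v) = fun t => g (t *: v).
  by move=> v1; rewrite /ray; case: pselect.
pose f v := dir (ray v).
have f_dist v w : dot v v = 1 -> dot w w = 1 -> mdist (f v) (f w) = acos (kap b v w).
  move=> v1 w1; have := dirE (ray v) (ray w); rewrite !rayE // => h.
  exact: (angle_is_germ ltr01 _ _ h (angle_rays v1 w1)).
exists f; split => // s.
have : (f @` [set v | dot v v = 1]) s; last by case=> v v1 fv; exists v.
rewrite (angular_image_full (b := b) (@sphere_compact R)) // => U U0 oU.
have [y [Uy [c _ cy]]] := dird U U0 oU.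
exists y; split => //; have [v [t0 [v1 t00 ct]]] := geodesic_ray (svalP c).
exists v => //; rewrite -cy; apply: mdist_positivity.
have h' := dirE (ray v) (ray v); rewrite mdistxx in h'.
apply: (angle_is_germ t00 _ _ (dirE (ray v) c) h') => // t ht.
by rewrite rayE // ct.
Qed.

Lemma spherical_directions (S : metricType R) (f : V -> S) : spherical b f ->
  space_of_directions (g 0) S.
Proof.
move=> fS; split; first exact: compact_complete (spherical_compact fS).
case: fS => f_onto f_dist.
have /choice[dirv dirvE] (c : {c : R -> X | geodesic_from (g 0) c}) : exists v,
    dot v v = 1 /\ exists2 t0, 0 < t0 & forall t, 0 <= t <= t0 -> sval c t = g (t *: v).
  by have [v [t0 [v1 t00 ct]]] := geodesic_ray (svalP c); exists v; split => //; exists t0.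
exists (f \o dirv); split=> [c1 c2|U [s Us] oU].
  have [v1 [t1 t10 h1]] := dirvE c1; have [v2 [t2 t20 h2]] := dirvE c2.
  have near0 (t0 : R) : 0 < t0 -> \forall t \near (0 : R)^'+, 0 <= t <= t0.
    move=> t00; near=> t; apply/andP; split; near: t; first exact: nbhs_right_ge.
    exact: nbhs_right_le.
  rewrite /= f_dist //; apply: cvg_trans (angle_rays v1 v2); apply: near_eq_cvg.
  exists ([set t | 0 <= t <= t1], [set t | 0 <= t <= t2]); first by split; exact: near0.
  by move=> [x y] [/= hx hy]; rewrite h1 // h2.
have [v v1 fv] := f_onto s; exists s; split => //.
pose c := exist (geodesic_from (g 0)) _ (ray_geodesic v1).
exists c => //=; have [w1 [t0 t00 ht]] := dirvE c; rewrite -fv.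
apply: mdist_positivity; rewrite f_dist //.
apply: (angle_is_germ t00 _ _ (angle_rays w1 v1)); last first.
- by rewrite -(acos_kap_xx b v1); exact: angle_rays.
- by [].
- by move=> t /ht /= ->.
Unshelve. all: by end_near. Qed.

End directions_of_flat_chart.

(** * The orbifold is a closed Alexandrov 3-space *)

Section flat_orbifold_alexandrov.
Variable R : realType.
Local Notation V := (R * R * R)%type.

Lemma quarter_not_lattice : lattice (2 *: ((1 / 4, 1 / 4, 1 / 4) : V)) = false.
Proof.
apply/negP => /and3P[/= + _ _]; rewrite /GRing.scale /= => /intrP[m].
have h2 : 2 * (1 / 4) = 1 / 2 :> R by field.
rewrite h2 => h; have m0 : 0 < m%:~R :> R by rewrite -h; lra.
have m1 : m%:~R < 1 :> R by rewrite -h; lra.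
by move: m0 m1; rewrite ltr0z ltrz1; case: m {h} => // -[].
Qed.

Variables (X : metricType R) (pr : V -> X).
Hypothesis pr_onto : forall x, exists v, pr v = x.
Hypothesis pr_dist : forall v w, mdist (pr v) (pr w) = flat_dist v w.

Lemma flat_orbifold_dim : hausdorff_dim X = 3%:E.
Proof.
apply/le_anti/andP; split.
  apply/lee_addgt0Pr => e e0; apply: ge_ereal_inf; exists (3 + e)%:E; last by rewrite EFinD.
  exists (3 + e) => //; split; first by rewrite addr_gt0.
  apply: (hausdorff_measure_eq0 (g := pr)); first by rewrite ltrDl.
    move=> x; have [v vx] := pr_onto x; have [w /(pr_eq pr_dist) vw [h1 h2 h3]] := orb_cube v.
    by exists w; rewrite -vw; split => //; apply/boxP; rewrite !subr0.
  exact: pr_le.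
apply: le_ereal_inf_tmp => _ [s [s0 Hs] <-]; rewrite lee_fin leNgt; apply/negP => s3.
have [r] := flat_orbifold_chart pr_onto pr_dist (1 / 4, 1 / 4, 1 / 4).
rewrite quarter_not_lattice => hr; have := hausdorff_measure_gt0 (s := s) hr.
by rewrite s0 (ltW s3) Hs eqxx => /(_ isT).
Qed.

(** Unfolding the recursion twice reaches a space of directions of a space of directions, which is a
    circle. *)
Lemma flat_orbifold_boundary : @alexandrov_boundary R 3 X = set0.
Proof.
apply/seteqP; split=> // p [S [Sp [q [T [Tq [y yT]]]]]].
have [v vp] := pr_onto p; have [r hr] := flat_orbifold_chart pr_onto pr_dist v.
have Sg : space_of_directions (pr (v + 0)) S by rewrite addr0 vp.
have [f [f_onto f_dist]] := directions_spherical hr Sg.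
have [w w1 fw] := f_onto q; rewrite -fw in Tq.
by have := directions_no_boundary f_onto f_dist w1 Tq; move/seteqP => [/(_ _ yT)].
Qed.

Lemma flat_orbifold_alexandrov3 : closed_alexandrov3 X.
Proof.
have cX := flat_orbifold_compact pr_onto pr_dist.
split => //; [|exact: flat_orbifold_dim|exact: flat_orbifold_boundary].
split; first exact: compact_complete.
- move=> x _; exists setT; first exact: filterT.
  by split; [exact: cX|exact: closedT].
- exact: flat_orbifold_length_space pr_onto pr_dist.
- by rewrite flat_orbifold_dim ltry.
- by exists 0; exact: flat_orbifold_curvature pr_onto pr_dist.
Qed.

End flat_orbifold_alexandrov.

(** * Open embeddings of open sets *)

Section open_embeddings.
Implicit Types X Y Z : topologicalType.

(** The map is total but constrained only on [D], so charts compose and invert without passing to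
    subtypes. *)
Definition open_embedding X Y (f : X -> Y) (D : set X) : Prop :=
  [/\ open D, {in D &, injective f}, (forall W, open W -> open (D `&` f @^-1` W)) &
      forall D', D' `<=` D -> open D' -> open (f @` D')].

Lemma open_embedding_comp X Y Z (f : X -> Y) (g : Y -> Z) (D : set X) (E : set Y) :
  open_embedding f D -> open_embedding g E ->
  open_embedding (g \o f) (D `&` f @^-1` E).
Proof.
move=> [oD fi fc fo] [oE gi gc go]; split.
- exact: fc.
- move=> x y; rewrite !inE => -[xD xE] [yD yE] /= h.
  by apply: fi; rewrite ?inE //; apply: gi; rewrite ?inE.
- move=> W oW; have := fc _ (gc _ oW).
  by rewrite -setIA.
- move=> A AD oA; rewrite -image_comp; apply: go.
    by move=> _ [x /AD[_ xE] <-].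
  by apply: fo => // x /AD[].
Qed.

Lemma open_embedding_inverse X Y (f : X -> Y) (D : set X) : D !=set0 ->
  open_embedding f D ->
  exists g : Y -> X, open_embedding g (f @` D) /\ {in D, cancel f g}.
Proof.
move=> [x0 _] [oD fi fc fo].
have /choice[g gE] : forall y, exists x, (f @` D) y -> D x /\ f x = y.
  by move=> y; have [[x Dx xy]|n] := pselect ((f @` D) y); [exists x|exists x0].
have gf x : D x -> g (f x) = x.
  move=> Dx; have [Dg fg] := gE (f x) (imageP _ Dx).
  by apply: fi; rewrite ?inE.
exists g; split; last by move=> x; rewrite inE; exact: gf.
split.
- exact: fo.
- by move=> _ _ /set_mem[x Dx <-] /set_mem[y Dy <-]; rewrite !gf // => ->.
- move=> W oW; rewrite (_ : _ `&` _ = f @` (D `&` W)); first by apply: fo => //; exact: openI.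
  apply/seteqP; split=> [_ [[x Dx <-] /= Wg]|_ [x [Dx Wx] <-]].
    by rewrite gf // in Wg; exists x.
  by split; [exists x|rewrite /= gf].
- move=> A AD oA; rewrite (_ : _ @` _ = D `&` f @^-1` A); first exact: fc.
  apply/seteqP; split=> [_ [y Ay <-]|x [Dx Ax]].
    by have [x Dx xy] := AD _ Ay; rewrite -xy gf //; split => //=; rewrite xy.
  by exists (f x) => //; rewrite gf.
Qed.

Lemma homeomorphism_open_embedding X Y (f : X -> Y) : is_homeomorphism f ->
  open_embedding f setT.
Proof.
move=> [fc [g [fg gf gc]]]; split; first exact: openT.
- by move=> x y _ _; exact: (can_inj fg).
- by move=> W oW; rewrite setTI; apply: open_comp => // x _; exact: fc.
- move=> A _ oA; rewrite (_ : _ @` _ = g @^-1` A); first by apply: open_comp => // x _;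
  exact: gc.
  apply/seteqP; split=> [_ [x Ax <-]|y Ay]; first by rewrite /= fg.
  by exists (g y).
Qed.

Lemma val_open_embedding X (A : set X) (D : set A) (W : set X) : open W -> W `<=` A ->
  D = val @^-1` W -> open_embedding (val : A -> X) D.
Proof.
move=> oW WA ->.
have vc : continuous (val : A -> X) by exact: initial_continuous.
have oD : open ((val : A -> X) @^-1` W) by apply: open_comp => // x _; exact: vc.
split => //.
- by move=> x y _ _ /val_inj.
- by move=> U oU; apply: openI => //; apply: open_comp => // x _; exact: vc.
- move=> U UW [U' oU' UE]; rewrite (_ : _ @` _ = W `&` U'); first exact: openI.
  apply/seteqP; split=> [_ [x Ux <-]|x [Wx Ux]]; first by split; [exact: UW|rewrite -UE in Ux].
  exists (exist _ x (mem_set (WA _ Wx))) => //.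
  by rewrite -UE.
Qed.

End open_embeddings.

(** * Locally Euclidean points *)

Section locally_euclidean.
Variable R : realType.
Local Notation V := (R * R * R)%type.
Implicit Types X Y : topologicalType.

(** Any open subset of R^3 may be the domain of a chart; restricting a chart then needs no
    rescaling. *)
Definition locally_euclidean X (x : X) : Prop := exists (e : V -> X) (D : set V),
  open_embedding e D /\ (e @` D) x.

Lemma locally_euclidean_image X Y (f : X -> Y) (D : set X) x : open_embedding f D ->
  D x -> locally_euclidean x -> locally_euclidean (f x).
Proof.
move=> fD Dx [e [E [eE [z Ez ez]]]]; exists (f \o e), (E `&` e @^-1` D).
split; first exact: open_embedding_comp.
by exists z; rewrite /= ?ez.
Qed.

Lemma locally_euclidean_preimage X Y (f : X -> Y) (D : set X) x : open_embedding f D ->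
  D x -> locally_euclidean (f x) -> locally_euclidean x.
Proof.
move=> fD Dx; have [g [gD gf]] := open_embedding_inverse (ex_intro _ x Dx) fD.
by move=> /(locally_euclidean_image gD (imageP _ Dx)); rewrite gf // inE.
Qed.

Lemma locally_euclidean_homeo X Y (f : X -> Y) x : is_homeomorphism f ->
  locally_euclidean (f x) <-> locally_euclidean x.
Proof.
move=> /homeomorphism_open_embedding fT; split.
  exact: (locally_euclidean_preimage fT).
exact: (locally_euclidean_image fT).
Qed.

(** Bridge between triples and the row vectors on which [topological_manifold] is modelled. *)
Definition row3 (v : V) : 'rV[R]_3 :=
  \row_j (if j == 0 then v.1.1 else if j == 1 then v.1.2 else v.2).

Lemma row3_homeomorphism : is_homeomorphism row3.
Proof.
split.
  move=> v; apply/cvg_ballP => e e0; apply/nbhs_nrmP; exists e => // w hw; split=> // i j.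
  have [h1 h2 h3] := nrm_coord (w - v).
  rewrite /ball /= !mxE distrC; case: ifP => _; [|case: ifP => _];
    exact: le_lt_trans hw.
exists (fun M : 'rV[R]_3 => (M 0 0, M 0 1, M 0 2)); split.
- by case=> [[a b] c]; rewrite !mxE.
- move=> M; apply/rowP => j; rewrite !mxE /=.
  by case: j => -[|[|[|//]]] h; rewrite /=; congr (M _ _); apply: val_inj.
- move=> M A /nbhs_ballP[e /= e0 hA]; apply/nbhs_ballP; exists e => //= N [_ h].
  by apply: hA; split; [split|]; exact: h.
Qed.

Lemma manifold_locally_euclidean X : topological_manifold R 3 X ->
  forall x : X, locally_euclidean x.
Proof.
move=> [_ _ h] x; have [U [oU Ux [f hf]]] := h x.
pose u : U := exist _ x (mem_set Ux).
have uU : open_embedding (val : U -> X) setT.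
  apply: (val_open_embedding oU) => //.
  by apply/seteqP; split=> // z _; exact: set_valP.
apply: (locally_euclidean_image (x := u) uU) => //.
apply: (locally_euclidean_preimage (homeomorphism_open_embedding hf)) => //.
have hr := homeomorphism_open_embedding row3_homeomorphism.
exists row3, setT; split => //.
by have [_ [k [_ kr _]]] := row3_homeomorphism; exists (k (f u)).
Qed.

End locally_euclidean.

(** * Induction along the unit interval *)

Section interval_induction.
Variable R : realType.
Implicit Types (a b c t d : R).

(** Compactness of [0, 1] without subdivisions: the local hypothesis carries [P 0] past the supremum
    of the points it reaches. *)
Lemma interval_induction (P : R -> R -> Prop) :
  (forall a b c, 0 <= a <= b -> b <= c <= 1 -> P a b -> P b c -> P a c) ->
  (forall t, 0 <= t <= 1 -> exists2 d, 0 < d & forall a b,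
    0 <= a <= b -> b <= 1 -> `|a - t| < d -> `|b - t| < d -> P a b) ->
  P 0 1.
Proof.
move=> Padd Ploc.
pose S := [set t | 0 <= t <= 1 /\ P 0 t].
have S0 : S 0.
  split; first by rewrite lexx ler01.
  have [|d d0 h] := Ploc 0; first by rewrite lexx ler01.
  by apply: h; rewrite ?subrr ?normr0 ?lexx ?ler01.
have supS : has_sup S.
  by split; [exists 0|exists 1 => t [/andP[]]].
have c0 : 0 <= sup S by apply: sup_upper_bound.
have c1 : sup S <= 1 by apply: ge_sup; [exists 0|move=> t [/andP[]]].
have [|d d0 h] := Ploc (sup S); first by rewrite c0 c1.
have [t [/andP[t0 t1] P0t] td] := sup_adherent d0 supS.
have tS : t <= sup S by apply: sup_upper_bound => //; split => //; rewrite t0 t1.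
have P0 x : sup S <= x <= 1 -> x < sup S + d -> P 0 x.
  move=> /andP[x0 x1] xd; apply: (Padd 0 t x) => //.
  - by rewrite lexx t0.
  - by rewrite (le_trans tS x0) x1.
  - apply: h; rewrite ?t0 ?(le_trans tS x0) //.
      by rewrite ler0_norm ?subr_le0 //; lra.
    by rewrite ger0_norm ?subr_ge0 //; lra.
have [h1|h1] := leP (sup S + d / 2) 1; last by apply: P0; rewrite ?c1 ?lexx //; lra.
have : S (sup S + d / 2).
  by split; [apply/andP; split|apply: P0; [apply/andP; split|]]; lra.
by move=> /(sup_upper_bound supS); lra.
Qed.

End interval_induction.

(** * Path lifting through u |-> +-u *)

Section not_locally_euclidean.
Variable R : realType.
Local Notation V := (R * R * R)%type.
Implicit Types (u v w x y : V) (a b c t s d e : R).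

Definition continuous_on_interval (f : R -> V) a b : Prop :=
  forall t, a <= t <= b -> forall e, 0 < e -> exists2 d, 0 < d & forall s,
    a <= s <= b -> `|s - t| < d -> nrm (f s - f t) < e.

(** As long as |f1| >= m > e, being e-near [f2] and being e-near [- f2] exclude each other, so a
    path cannot switch between them. The tolerance e makes the lemma serve both uniqueness of lifts
    and their dependence on parameters. *)
Lemma lift_stable (f1 f2 : R -> V) e m : e < m ->
  continuous_on_interval f1 0 1 -> continuous_on_interval f2 0 1 ->
  (forall t, 0 <= t <= 1 -> m <= nrm (f1 t)) ->
  (forall t, 0 <= t <= 1 -> nrm (f1 t - f2 t) < e \/ nrm (f1 t + f2 t) < e) ->
  nrm (f1 0 - f2 0) < e -> nrm (f1 1 - f2 1) < e.
Proof.
move=> em c1 c2 fm alt.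
apply: (@interval_induction R (fun a b => nrm (f1 a - f2 a) < e -> nrm (f1 b - f2 b) < e)).
  by move=> a b c _ _ h1 h2 /h1.
(* With this [k], a switch would force 2 m < 2 e + 2 k = m + e. *)
move=> t ht; pose k := (m - e) / 2; have k0 : 0 < k by rewrite /k; lra.
have [d1 d10 h1] := c1 t ht (k / 2) (ltac:(lra)).
have [d2 d20 h2] := c2 t ht (k / 2) (ltac:(lra)).
exists (Num.min d1 d2); first by rewrite lt_min d10.
move=> a b /andP[a0 ab] b1; rewrite !lt_min => /andP[at1 at2] /andP[bt1 bt2] ha.
have ia : 0 <= a <= 1 by rewrite a0 (le_trans ab).
have ib : 0 <= b <= 1 by rewrite b1 (le_trans a0).
have [//|h] := alt b ib.
have := nrmD (f1 b + f2 b) (f1 b - f2 b).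
have -> : f1 b + f2 b + (f1 b - f2 b) = 2 *: f1 b by vector_ring.
rewrite nrmZ ger0_norm // => hh.
have -> // : nrm (f1 b - f2 b) < e.
have mb := fm b ib.
have A1 := h1 a ia at1; have B1 := h1 b ib bt1; have A2 := h2 a ia at2; have B2 := h2 b ib bt2.
have := nrm_triangle (f1 a) (f1 b) (f2 b).
have := nrm_triangle (f1 t) (f1 b) (f1 a); rewrite (nrmB (f1 t) (f1 a)).
have := nrm_triangle (f2 a) (f1 a) (f2 b).
have := nrm_triangle (f2 t) (f2 a) (f2 b); rewrite (nrmB (f2 t) (f2 b)).
rewrite /k in k0 A1 B1 A2 B2; lra.
Qed.

Variables (X : metricType R) (r : R) (g : V -> X).
Hypothesis g_chart : flat_chart true r g.

Lemma cone_dist u w : nrm u < r -> nrm w < r ->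
  mdist (g u) (g w) = nrm (u - w) \/ mdist (g u) (g w) = nrm (u + w).
Proof.
case: g_chart => _ gd _ ur wr; rewrite gd // /kap.
case: (ger0P (dot u w)) => _; [left|right]; rewrite /nrm; congr Num.sqrt;
  by rewrite !dotE (dotC w u); ring.
Qed.

Lemma cone_dist_le u w : nrm u < r -> nrm w < r -> mdist (g u) (g w) <= nrm (u - w).
Proof.
case: g_chart => _ gd _ ur wr; rewrite gd // /nrm ler_wsqrtr //.
by have := ler_norm (dot u w); rewrite /kap !dotE (dotC w u); lra.
Qed.

Lemma cone_eq u w : nrm u < r -> nrm w < r -> g u = g w -> w = u \/ w = - u.
Proof.
move=> ur wr e; have := cone_dist ur wr; rewrite e mdistxx => -[|] /esym/eqP.
  by rewrite nrm_eq0 subr_eq0 => /eqP ->; left.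
by rewrite nrm_eq0 addrC addr_eq0 => /eqP ->; right.
Qed.

Lemma cone_radius u (x : X) : nrm u < r -> g u = x -> mdist (g 0) x = nrm u.
Proof. by move=> ur <-; exact: (flat_chart_radius g_chart). Qed.

Lemma lift_unique (f1 f2 : R -> V) m : 0 < m ->
  continuous_on_interval f1 0 1 -> continuous_on_interval f2 0 1 ->
  (forall t, 0 <= t <= 1 -> [/\ m <= nrm (f1 t), nrm (f1 t) < r, nrm (f2 t) < r &
    g (f1 t) = g (f2 t)]) ->
  f1 0 = f2 0 -> f1 1 = f2 1.
Proof.
move=> m0 c1 c2 h f0.
have alt t : 0 <= t <= 1 -> f2 t = f1 t \/ f2 t = - f1 t.
  by move=> ht; have [_ n1 n2 /cone_eq] := h t ht; apply.
have i1 : 0 <= (1 : R) <= 1 by rewrite ler01 lexx.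
have : nrm (f1 1 - f2 1) < m / 2.
  apply: (@lift_stable f1 f2 (m / 2) m) => //; first lra.
  - by move=> t /h[].
  - move=> t ht; case: (alt t ht) => ->; [left|right]; rewrite subrr nrm0; lra.
  - by rewrite f0 subrr nrm0; lra.
case: (alt 1 i1) => -> //; have [mf _ _ _] := h 1 i1.
have -> : f1 1 - - f1 1 = 2 *: f1 1 by vector_ring.
rewrite nrmZ (ger0_norm (ler0n R 2)) => ?; exfalso; lra.
Qed.

Definition lifts (F : R -> X) (L : R -> V) a b : Prop :=
  (forall t, a <= t <= b -> g (L t) = F t /\ nrm (L t) < r) /\
  continuous_on_interval L a b.

(** Within distance |v| of [g v] no lift is orthogonal to [v], so the half-space of [v] selects one
    of two antipodal lifts. Interval induction concatenates these local lifts. *)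
Lemma path_lifting (F : R -> X) u0 :
  (forall t, 0 <= t <= 1 -> 0 < mdist (g 0) (F t) < r) ->
  (forall t, 0 <= t <= 1 -> forall e, 0 < e -> exists2 d, 0 < d & forall s,
    0 <= s <= 1 -> `|s - t| < d -> mdist (F t) (F s) < e) ->
  g u0 = F 0 -> nrm u0 < r -> exists2 L, L 0 = u0 & lifts F L 0 1.
Proof.
move=> Fr Fc gu0 u0r.
case: (g_chart) => _ gd g_lift.
pose P a b := forall u0, g u0 = F a -> nrm u0 < r -> exists2 L, L a = u0 & lifts F L a b.
suff : P 0 1 by apply.
apply: interval_induction => {u0 gu0 u0r}.
  move=> a b c /andP[a0 ab] /andP[bc c1] Pab Pbc u0 gu0 u0r.
  have [L1 L1a [L1F L1c]] := Pab u0 gu0 u0r.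
  have [|g1b n1b] := L1F b; first by rewrite ab lexx.
  have [L2 L2b [L2F L2c]] := Pbc _ g1b n1b.
  pose L t := if t <= b then L1 t else L2 t.
  have LE t : b <= t -> L t = L2 t.
    move=> bt; rewrite /L; case: (leP t b) => // tb.
    by have -> : t = b by [apply/le_anti; rewrite bt tb]; rewrite L2b.
  exists L; first by rewrite /L ab.
  split=> t /andP[at_ tc].
    rewrite /L; case: (leP t b) => tb; first by apply: L1F; rewrite at_ tb.
    by apply: L2F; rewrite ltW.
  move=> e e0; have [tb|bt] := ltP t b.
    have [|d d0 h] := L1c t _ e e0; first by rewrite at_ ltW.
    exists (Num.min d (b - t)); first by rewrite lt_min d0 subr_gt0.
    move=> s /andP[as_ sc]; rewrite lt_min => /andP[h1 h2].
    have sb : s <= b by move: h2; rewrite ltr_norml; lra.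
    by rewrite /L sb (ltW tb); apply: h => //; rewrite as_ sb.
  have [|d d0 h] := L2c t _ e e0; first by rewrite bt.
  have [tb|tnb] := eqVneq t b; last first.
    have {}bt : b < t by rewrite lt_neqAle eq_sym tnb bt.
    exists (Num.min d (t - b)); first by rewrite lt_min d0 subr_gt0.
    move=> s /andP[as_ sc]; rewrite lt_min => /andP[h1 h2].
    have sb : b <= s by move: h2; rewrite ltr_norml; lra.
    by rewrite !LE ?(ltW bt) //; apply: h => //; rewrite sb.
  have [|d' d'0 h'] := L1c t _ e e0; first by rewrite at_ tb lexx.
  exists (Num.min d d'); first by rewrite lt_min d0.
  move=> s /andP[as_ sc]; rewrite lt_min => /andP[h1 h2].
  have [sb|sb] := leP s b.
    by rewrite /L sb tb lexx -tb; apply: h' => //; rewrite as_ sb.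
  by rewrite !LE ?tb ?(ltW sb) // -tb; apply: h => //; rewrite ltW.
move=> t ht; have /andP[n0 nr] := Fr t ht.
have [d d0 hd] := Fc t ht _ n0.
exists d => // a b /andP[a0 ab] b1 hat hbt u0 gu0 u0r.
have [v gv nv] := g_lift _ nr.
have near_dot s u : 0 <= s <= 1 -> `|s - t| < d -> g u = F s -> nrm u < r -> dot u v != 0.
  move=> hs hst gu ur; apply/eqP => uv.
  have : mdist (g v) (g u) < nrm v by rewrite gv gu nv; exact: hd.
  have vr : nrm v < r by rewrite nv.
  by rewrite gd // kapC /kap uv normr0 mulr0 subr0 ltNge ler_wsqrtr // lerDl dot_ge0.
have uv : dot u0 v != 0.
  by apply: (near_dot a) => //; rewrite a0 (le_trans ab).
(* Of the two lifts of [F t], the one whose half-space contains the prescribed start. *)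
have [v' [gv' nv' uv']] : exists v', [/\ g v' = F t, nrm v' = nrm v & 0 < dot u0 v'].
  have [h|h] := ltP 0 (dot u0 v); first by exists v.
  exists (- v); rewrite nrmN (flat_chart_even g_chart) ?nv //; split => //.
  by rewrite dotNr oppr_gt0 lt_neqAle uv h.
have /choice[L LE] : forall s, exists w, a <= s <= b ->
    [/\ g w = F s, nrm w < r & 0 < dot w v'].
  move=> s; have [hs|ns] := pselect (a <= s <= b); last by exists 0.
  have /andP[as_ sb] := hs.
  have hs1 : 0 <= s <= 1 by rewrite (le_trans a0) ?(le_trans sb).
  have hst : `|s - t| < d by move: hat hbt; rewrite !ltr_norml; lra.
  have /andP[_ sr] := Fr s hs1; have [w gw nw] := g_lift _ sr.
  have wr : nrm w < r by rewrite nw.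
  have wv : dot w v' != 0.
    have [->|->] : v' = v \/ v' = - v.
      by apply: (cone_eq (u := v)); rewrite ?nv' ?nv // gv.
      exact: near_dot hst gw wr.
    by rewrite dotNr oppr_eq0; exact: near_dot hst gw wr.
  have [h|h] := ltP 0 (dot w v'); first by exists w.
  exists (- w) => _; rewrite nrmN (flat_chart_even g_chart) ?nw //; split => //.
  by rewrite dotNl oppr_gt0 lt_neqAle wv h.
have ia : a <= a <= b by rewrite lexx.
exists L.
  have [ga na pa] := LE a ia.
  have [e|e] := cone_eq u0r na (etrans gu0 (esym ga)); rewrite e // in pa.
  by exfalso; move: pa; rewrite dotNl; lra.
split; first by move=> s /LE[].
move=> s hs e e0; have [gs ns ps] := LE s hs.
have v'0 : 0 < nrm v' by rewrite nv' nv.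
(* Below the second bound the distance cannot be |L s + L s'|, since the component of this sum along
   [v'] exceeds that of [L s]. *)
pose k := Num.min e (dot (L s) v' / nrm v').
have k0 : 0 < k by rewrite lt_min e0 divr_gt0.
have hs1 : 0 <= s <= 1 by have /andP[s1 s2] := hs; rewrite (le_trans a0) ?(le_trans s2).
have [d1 d10 h1] := Fc s hs1 k k0.
exists d1 => // s' hs' hss.
have hs'1 : 0 <= s' <= 1 by have /andP[s1 s2] := hs'; rewrite (le_trans a0) ?(le_trans s2).
have [gs' ns' ps'] := LE s' hs'.
have := h1 s' hs'1 hss; rewrite /k lt_min => /andP[m1 m2].
rewrite -gs -gs' in m1 m2.
case: (cone_dist ns ns') => E; rewrite E in m1 m2; first by rewrite nrmB.
move: m2; rewrite ltr_pdivlMr // => m2.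
have := CauchySchwarz (L s + L s') v'; rewrite dotDl ger0_norm; last by lra.
lra.
Qed.

End not_locally_euclidean.

(** * Sections over a punctured ball *)

Section sections_over_ball.
Variable R : realType.
Local Notation V := (R * R * R)%type.
Implicit Types (u v w x y z : V) (a b c t d e : R).

Variables (X : metricType R) (r : R) (g : V -> X).
Hypothesis g_chart : flat_chart true r g.

Variables (E : V -> X) (rho : R).
Hypothesis rho0 : 0 < rho.
Hypothesis E_chart : forall x, x != 0 -> nrm x < rho -> 0 < mdist (g 0) (E x) < r.
Hypothesis E_cont : forall x, nrm x < rho -> forall e, 0 < e ->
  exists2 d, 0 < d & forall y, nrm (y - x) < d -> mdist (E x) (E y) < e.

Definition section_on (A : set V) (s : V -> V) : Prop :=
  (forall x, A x -> g (s x) = E x /\ nrm (s x) < r) /\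
  forall x, A x -> forall e, 0 < e -> exists2 d, 0 < d & forall y, A y ->
    nrm (y - x) < d -> nrm (s y - s x) < e.

Definition punctured : set V := [set x | x != 0 /\ nrm x < rho].

Lemma segment_pos (L : R -> V) : continuous_on_interval L 0 1 ->
  (forall t, 0 <= t <= 1 -> 0 < nrm (L t)) ->
  exists2 m, 0 < m & forall t, 0 <= t <= 1 -> m <= nrm (L t).
Proof.
move=> Lc L0; apply: (@interval_induction R (fun a b => exists2 m, 0 < m &
  forall t, a <= t <= b -> m <= nrm (L t))).
  move=> a b c _ _ [m m0 h] [m' m'0 h']; exists (Num.min m m'); first by rewrite lt_min m0.
  move=> t /andP[ta tc]; rewrite ge_min.
  by have [tb|tb] := leP t b; [rewrite h ?ta|rewrite h' ?orbT // ltW].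
move=> t ht; have n0 := L0 t ht.
have [d d0 hd] := Lc t ht (nrm (L t) / 2) (ltac:(lra)).
exists d => // a b /andP[a0 ab] b1 hat hbt; exists (nrm (L t) / 2); first lra.
move=> s /andP[as_ sb]; have := hd s _ _.
have -> : 0 <= s <= 1 by rewrite (le_trans a0 as_) (le_trans sb).
have -> : `|s - t| < d by move: hat hbt; rewrite !ltr_norml; lra.
move=> /(_ isT isT); have := nrm_dist (L s) (L t); rewrite ler_norml; lra.
Qed.

Lemma ball_segment a x t : 0 <= t <= 1 ->
  forall (p : V), nrm p < a -> nrm x < a -> nrm (p + t *: (x - p)) < a.
Proof.
move=> /andP[t0 t1] p pa xa.
have -> : p + t *: (x - p) = (1 - t) *: p + t *: x by vector_ring.
apply: le_lt_trans (nrmD _ _) _; rewrite !nrmZ !ger0_norm ?subr_ge0 //.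
have [->|tn] := eqVneq t 0; first by rewrite subr0 mul1r mul0r addr0.
have tp : 0 < t by rewrite lt_neqAle eq_sym tn.
have : t * nrm x < t * a by rewrite ltr_pM2l.
have : (1 - t) * nrm p <= (1 - t) * a by rewrite ler_wpM2l ?subr_ge0 // ltW.
lra.
Qed.

Lemma segment_continuous p x e t : 0 < e -> exists2 d, 0 < d &
  forall s, `|s - t| < d -> nrm (p + s *: (x - p) - (p + t *: (x - p))) < e.
Proof.
move=> e0; have n0 : 0 < nrm (x - p) + 1 by rewrite ltr_wpDl ?nrm_ge0.
exists (e / (nrm (x - p) + 1)); first by rewrite divr_gt0.
move=> s; rewrite ltr_pdivlMr // => h.
have -> : p + s *: (x - p) - (p + t *: (x - p)) = (s - t) *: (x - p) by vector_ring.
by rewrite nrmZ; apply: le_lt_trans h; rewrite ler_wpM2l // lerDl.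
Qed.

(* Lifting along the segments issuing from [p]. *)
Lemma star_section (A : set V) p : A `<=` punctured -> A p ->
  (forall x t, A x -> 0 <= t <= 1 -> A (p + t *: (x - p))) ->
  exists s, section_on A s.
Proof.
move=> Apu Ap Astar.
have [_ gd g_lift] := g_chart.
have [u0 gu0 nu0] : exists2 u, g u = E p & nrm u < r.
  have [p0 pr] := Apu _ Ap; have /andP[_ h] := E_chart p0 pr.
  by have [u gu nu] := g_lift _ h; exists u; rewrite ?nu.
pose F x t := E (p + t *: (x - p)).
have Fr x : A x -> forall t, 0 <= t <= 1 -> 0 < mdist (g 0) (F x t) < r.
  by move=> Ax t ht; have [? ?] := Apu _ (Astar x t Ax ht); exact: E_chart.
have /choice[L LE] : forall x, exists L, A x -> L 0 = u0 /\ lifts r g (F x) L 0 1.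
  move=> x; have [Ax|nA] := pselect (A x); last by exists (fun=> 0).
  have [|||L L0 hL] := path_lifting g_chart (F := F x) (u0 := u0) (Fr x Ax).
  - move=> t ht e e0; have [_ h] := Apu _ (Astar x t Ax ht).
    have [d d0 hd] := E_cont h e0; have [d' d'0 hd'] := segment_continuous p x t d0.
    by exists d' => // s _ /hd' /hd.
  - by rewrite /F scale0r addr0.
  - exact: nu0.
  - by exists L.
have i1 : 0 <= (1 : R) <= 1 by rewrite ler01 lexx.
exists (fun x => L x 1); split=> [x Ax|x Ax e e0].
  have [_ [LF _]] := LE x Ax; have [-> ?] := LF 1 i1.
  by rewrite /F scale1r subrKC.
have [Lx0 [LxF Lxc]] := LE x Ax.
have [m m0 hm] : exists2 m, 0 < m & forall t, 0 <= t <= 1 -> m <= nrm (L x t).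
  apply: segment_pos => // t ht; have [gl nl] := LxF t ht.
  by rewrite -(cone_radius g_chart nl gl); have /andP[] := Fr x Ax t ht.
(* Staying below the lower bound [m] of the lift is what lets [lift_stable] compare lifts along
   neighbouring segments. *)
pose k := Num.min e (m / 2).
have k0 : 0 < k by rewrite lt_min e0 divr_gt0.
have ke : k <= e by rewrite ge_min lexx.
have km : k <= m / 2 by rewrite ge_min lexx orbT.
(* A tube lemma: closeness is uniform along the whole segment, again by interval induction. *)
have [d d0 hd] : exists2 d, 0 < d & forall y t, A y -> nrm (y - x) < d -> 0 <= t <= 1 ->
    mdist (F x t) (F y t) < k.
  suff [d d0 hd] : exists2 d, 0 < d & forall y, A y -> nrm (y - x) < d ->
      forall t, 0 <= t <= 1 -> mdist (F x t) (F y t) < k.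
    by exists d => // y t Ay yd ht; exact: hd.
  apply: (@interval_induction R (fun a b => exists2 d, 0 < d & forall y, A y ->
    nrm (y - x) < d -> forall t, a <= t <= b -> mdist (F x t) (F y t) < k)).
    move=> a b c _ _ [d1 d10 h1] [d2 d20 h2]; exists (Num.min d1 d2).
      by rewrite lt_min d10.
    move=> y Ay; rewrite lt_min => /andP[y1 y2] t /andP[ta tc].
    by have [tb|tb] := leP t b; [apply: h1; rewrite ?ta|apply: h2; rewrite ?(ltW tb)].
  move=> t ht; have [_ h] := Apu _ (Astar x t Ax ht).
  have [d1 d10 h1] := E_cont h (ltac:(by rewrite divr_gt0) : 0 < k / 2).
  have [d2 d20 h2] := segment_continuous p x t (ltac:(by rewrite divr_gt0) : 0 < d1 / 2).
  exists d2 => // a b /andP[a0 ab] b1 hat hbt; exists (d1 / 2); first by rewrite divr_gt0.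
  move=> y Ay yx s /andP[as_ sb].
  have st : `|s - t| < d2 by move: hat hbt; rewrite !ltr_norml; lra.
  have xs := h2 s st.
  have ys : nrm (p + s *: (y - p) - (p + s *: (x - p))) < d1 / 2.
    have -> : p + s *: (y - p) - (p + s *: (x - p)) = s *: (y - x) by vector_ring.
    rewrite nrmZ ger0_norm ?(le_trans a0) //; apply: le_lt_trans yx.
    by rewrite ler_piMl ?nrm_ge0 // (le_trans sb).
  have D1 := h1 (p + s *: (x - p)) (ltac:(lra)).
  have D2 := h1 (p + s *: (y - p)) (ltac:(
    have := nrm_triangle (p + s *: (x - p)) (p + s *: (y - p)) (p + t *: (x - p)); lra)).
  have := metric_triangle (F x s) (F x t) (F y s).
  by rewrite (metric_sym (F x s) (F x t)) /F; lra.
exists d => // y Ay yd; have [Ly0 [LyF Lyc]] := LE y Ay.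
rewrite nrmB; apply: lt_le_trans ke.
apply: (@lift_stable R (L x) (L y) k m) => //; first lra.
- move=> t ht; have := hd y t Ay yd ht.
  have [gx nx] := LxF t ht; have [gy ny] := LyF t ht.
  by rewrite -gx -gy; case: (cone_dist g_chart nx ny) => ->; [left|right].
- by rewrite Lx0 Ly0 subrr nrm0.
Qed.

Lemma section_segment (A : set V) s s' p x : A `<=` punctured ->
  section_on A s -> section_on A s' ->
  (forall t, 0 <= t <= 1 -> A (p + t *: (x - p))) -> s p = s' p -> s x = s' x.
Proof.
move=> Apu [sE sc] [s'E s'c] hA sp.
pose f (q : V -> V) t := q (p + t *: (x - p)).
have fc q : section_on A q -> continuous_on_interval (f q) 0 1.
  move=> [_ qc] t ht e e0; have [d d0 hd] := qc _ (hA t ht) e e0.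
  have [d' d'0 hd'] := segment_continuous p x t d0.
  by exists d' => // z hz zt; apply: hd; [exact: hA|exact: hd'].
have [m m0 hm] : exists2 m, 0 < m & forall t, 0 <= t <= 1 -> m <= nrm (f s t).
  apply: segment_pos => [|t ht]; first exact: fc.
  have [gl nl] := sE _ (hA t ht); rewrite -(cone_radius g_chart nl gl).
  by have [h1 h2] := Apu _ (hA t ht); have /andP[] := E_chart h1 h2.
have := @lift_unique R X r g g_chart (f s) (f s') m m0 (fc s (conj sE sc))
  (fc s' (conj s'E s'c)).
rewrite /f !scale1r !subrKC !scale0r !addr0; apply => //.
move=> t ht; have [g1 n1] := sE _ (hA t ht); have [g2 n2] := s'E _ (hA t ht).
by split => //; [exact: hm|rewrite g1 g2].
Qed.

Lemma section_opp (A : set V) s : section_on A s -> section_on A (fun x => - s x).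
Proof.
move=> [sE sc]; split=> x Ax.
  by have [gs ns] := sE x Ax; rewrite nrmN (flat_chart_even g_chart).
move=> e e0; have [d d0 hd] := sc x Ax e e0; exists d => // y Ay yx.
by rewrite -opprD nrmN; exact: hd.
Qed.

Lemma sectionS (A B : set V) s : B `<=` A -> section_on A s -> section_on B s.
Proof.
move=> BA [sE sc]; split=> x /BA Ax; first exact: sE.
by move=> e e0; have [d d0 hd] := sc x Ax e e0; exists d => // y /BA; exact: hd.
Qed.

(* The punctured ball is covered by the complements [half 1] and [half (- 1)] of
   two opposite closed half-axes, which are star-shaped with a connected
   intersection. *)
Definition half c : set V := [set x | nrm x < rho /\ (x.1 = 0 -> 0 < c * x.2)].

Lemma half_punctured c : half c `<=` punctured.
Proof.
move=> x [xr hx]; split => //; apply/eqP => x0; move: hx; rewrite x0 /= => /(_ erefl).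
by rewrite mulr0 ltxx.
Qed.

Lemma nrm_axis c : nrm ((0, 0, c) : V) = `|c|.
Proof.
by rewrite /nrm /dot /= -sqrtr_sqr; congr Num.sqrt; ring.
Qed.

(** The centre lies on the half-axis that is kept. A segment from it to a point off the axis meets
    the axis only at the centre, and one to a point of the kept half-axis stays in it. *)
Lemma half_star c x t : c = 1 \/ c = -1 -> half c x -> 0 <= t <= 1 ->
  half c ((0, 0, c * (rho / 2)) + t *: (x - (0, 0, c * (rho / 2)))).
Proof.
move=> hc [xr hx] ht; have cc : c * c = 1 by case: hc => ->; ring.
have c1 : `|c| = 1 by case: hc => ->; rewrite ?normrN normr1.
have pr : nrm ((0, 0, c * (rho / 2)) : V) < rho.
  by rewrite nrm_axis normrM c1 mul1r ger0_norm ?divr_ge0 ?(ltW rho0) //; have := rho0; lra.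
split; first exact: ball_segment.
case: x hx xr => [[x1 x2] x3] /= hx xr [].
rewrite /GRing.scale /= !subr0 !add0r => e1 e2.
case/andP: ht => t0 t1.
have [tz|tn] := eqVneq t 0.
  have -> : c * (c * (rho / 2) + t * (x3 - c * (rho / 2))) = c * c * (rho / 2).
    by rewrite tz; ring.
  by rewrite cc; have := rho0; lra.
have x1z : x1 = 0 by apply: (mulfI tn); rewrite e1 mulr0.
have x2z : x2 = 0 by apply: (mulfI tn); rewrite e2 mulr0.
have := hx; rewrite x1z x2z => /(_ erefl) cx.
have -> : c * (c * (rho / 2) + t * (x3 - c * (rho / 2))) =
  (c * c) * (1 - t) * (rho / 2) + t * (c * x3) by ring.
rewrite cc mul1r ltr_wpDl ?mulr_ge0 ?subr_ge0 ?divr_ge0 ?(ltW rho0) //.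
by rewrite mulr_gt0 // lt_neqAle eq_sym tn.
Qed.

Lemma half_open c x : half c x -> exists2 d, 0 < d & forall y, nrm y < rho ->
  nrm (y - x) < d -> half c y.
Proof.
move=> [xr hx]; have [x0|xn] := pselect (x.1 = 0).
  exists (c * x.2 / (`|c| + 1)); first by rewrite divr_gt0 ?hx // ltr_wpDl.
  move=> y yr; rewrite ltr_pdivlMr ?ltr_wpDl // => yx; split => // y0.
  have [_ _ h] := nrm_coord (y - x); rewrite /= in h.
  have : `|c * y.2 - c * x.2| < c * x.2.
    apply: le_lt_trans yx; rewrite -mulrBr normrM mulrC.
    by rewrite ler_pM // lerDl.
  by rewrite ltr_norml; lra.
have [e e0 he] : exists2 e, 0 < e & forall y, nrm (y - x) < e -> y.1 <> 0.
  have [x1|x1] := eqVneq x.1.1 0.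
    have x2 : x.1.2 != 0.
      by apply/eqP => x2; apply: xn; move: x1 x2; case: (x.1) => /= ? ? -> ->.
    exists `|x.1.2|; first by rewrite normr_gt0.
    move=> y yx y0; have [_ h _] := nrm_coord (y - x).
    by move: h; rewrite /= y0 /= sub0r normrN; lra.
  exists `|x.1.1|; first by rewrite normr_gt0.
  move=> y yx y0; have [h _ _] := nrm_coord (y - x).
  by move: h; rewrite /= y0 /= sub0r normrN; lra.
by exists e => // y yr yx; split => // y0; case: (he y yx).
Qed.

Lemma halves_cover x : punctured x -> half 1 x \/ half (-1) x.
Proof.
move=> [x0 xr]; have [h|h|h] := ltgtP x.2 0.
- by right; split => // _; lra.
- by left; split => // _; lra.
- by left; split => // x1; case/eqP: x0; move: h x1; case: x {xr} => a b /= -> ->.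
Qed.

(** At [b1] the two sections agree up to sign; once the sign is corrected, uniqueness of lifts
    spreads the equality along segments that avoid the axis. The half-plane opposite to [b1] is
    reached through [b2]. *)
Lemma halves_sections s s' : section_on (half 1) s -> section_on (half (-1)) s' ->
  exists s'', section_on (half (-1)) s'' /\ forall x, nrm x < rho -> x.1 <> 0 -> s x = s'' x.
Proof.
move=> hs hs'.
pose A : set V := [set x | nrm x < rho /\ x.1 <> 0].
have A1 c : A `<=` half c by move=> x [xr x1]; split => // /x1.
have Apu : A `<=` punctured := subset_trans (A1 1) (@half_punctured 1).
pose b1 : V := (rho / 2, 0, 0); pose b2 : V := (0, rho / 2, 0).
have nb (b : V) : dot b b = (rho / 2) ^+ 2 -> nrm b < rho.
  by move=> bb; rewrite /nrm bb sqrtr_sqr ger0_norm ?divr_ge0 ?(ltW rho0) //; have := rho0;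
    lra.
have nb1 : nrm b1 < rho by apply: nb; rewrite /dot /=; ring.
have nb2 : nrm b2 < rho by apply: nb; rewrite /dot /=; ring.
have rn : rho / 2 <> 0 by move=> h; have := rho0; lra.
have Ab1 : A b1 by split => // -[].
have [s'' [hs'' s1]] : exists s'', section_on (half (-1)) s'' /\ s b1 = s'' b1.
  have [g1 n1] := hs.1 _ (A1 1 _ Ab1); have [g2 n2] := hs'.1 _ (A1 (-1) _ Ab1).
  have [e|e] := cone_eq g_chart n1 n2 (etrans g1 (esym g2)); first by exists s'.
  exists (fun x => - s' x); split; first exact: section_opp.
  by rewrite e opprK.
exists s''; split => //.
have step p x : (forall t, 0 <= t <= 1 -> A (p + t *: (x - p))) -> s p = s'' p -> s x = s'' x.
  by apply: (section_segment Apu); [exact: sectionS hs|exact: sectionS hs''].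
have s2 : s b2 = s'' b2.
  apply: (step b1) => // t ht; split; first exact: ball_segment.
  by rewrite /b1 /b2 /= /GRing.scale /= => -[h1 h2]; have := rho0; nra.
move=> x xr x1; have [[x2 x10]|hx] := pselect (x.1.2 = 0 /\ x.1.1 < 0).
  apply: (step b2) => // t ht; split; first exact: ball_segment.
  case: x {xr x1} x2 x10 => -[y1 y2] y3 /= -> y10 [h1 h2].
  have tz : t = 0.
    have : t * y1 = 0 by move: h1; rewrite /GRing.scale /=; lra.
    by move/eqP; rewrite mulf_eq0 => /orP[/eqP//|/eqP]; lra.
  by move: h2; rewrite tz /GRing.scale /=; have := rho0; lra.
apply: (step b1) => // t ht; split; first exact: ball_segment.
case: x {xr} x1 hx => -[y1 y2] y3 /= x1 hx [].
rewrite /GRing.scale /= => h1 h2; have := rho0 => rp.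
have [tz|tn] := eqVneq t 0; first by move: h1; rewrite tz; lra.
have y20 : y2 = 0 by apply: (mulfI tn); rewrite mulr0; lra.
have y10 : 0 <= y1 by rewrite leNgt; apply/negP => h; apply: hx.
have y1n : y1 <> 0 by move=> h; apply: x1; rewrite h y20.
case/andP: ht => t0 t1; have : 0 <= t * y1 by rewrite mulr_ge0.
have [t11|t1n] := eqVneq t 1; first by move: h1; rewrite t11; lra.
have : 0 < (1 - t) * (rho / 2).
  by rewrite mulr_gt0 ?divr_gt0 // subr_gt0 lt_neqAle t1n.
lra.
Qed.

Lemma punctured_section : exists s, section_on punctured s.
Proof.
have Ap c : c = 1 \/ c = -1 -> exists s, section_on (half c) s.
  move=> hc; apply: (@star_section _ (0, 0, c * (rho / 2))).
  - exact: half_punctured.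
  - have c1 : `|c| = 1 by case: hc => ->; rewrite ?normrN normr1.
    split=> /=; last by move=> _; case: hc => ->; have := rho0; lra.
    by rewrite nrm_axis normrM c1 mul1r ger0_norm ?divr_ge0 ?(ltW rho0) //; have := rho0; lra.
  - by move=> x t hx ht; exact: half_star.
have [s hs] := Ap 1 (or_introl erefl); have [s' hs'] := Ap (-1) (or_intror erefl).
have [s'' [hs'' ss]] := halves_sections hs hs'.
pose q x := if pselect (half 1 x) then s x else s'' x.
have q1 x : half 1 x -> q x = s x by rewrite /q; case: pselect.
have q2 x : half (-1) x -> q x = s'' x.
  move=> [xr hx]; rewrite /q; case: pselect => //= -[_ hx'].
  by apply: ss => // x1; have := hx x1; have := hx' x1; lra.
exists q; split=> x px.
  by case: (halves_cover px) => hx; [rewrite q1 //; exact: hs.1|rewrite q2 //; exact: hs''.1].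
move=> e e0; case: (halves_cover px) => hx.
  have [d d0 hd] := hs.2 x hx e e0; have [d' d'0 hd'] := half_open hx.
  exists (Num.min d d'); first by rewrite lt_min d0.
  move=> y [_ yr]; rewrite lt_min => /andP[yd yd']; have hy := hd' y yr yd'.
  by rewrite !q1 //; exact: hd.
have [d d0 hd] := hs''.2 x hx e e0; have [d' d'0 hd'] := half_open hx.
exists (Num.min d d'); first by rewrite lt_min d0.
move=> y [_ yr]; rewrite lt_min => /andP[yd yd']; have hy := hd' y yr yd'.
by rewrite !q2 //; exact: hd.
Qed.

End sections_over_ball.

(** * Regular and singular points *)

Section regular_and_singular_points.
Variable R : realType.
Local Notation V := (R * R * R)%type.
Implicit Types (u v w x y z : V) (t e : R).

Lemma regular_point_locally_euclidean (X : metricType R) (r : R) (g : V -> X) :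
  flat_chart false r g -> locally_euclidean R (g 0).
Proof.
move=> gch; have [r0 gd g_lift] := gch.
have giso u w : nrm u < r -> nrm w < r -> mdist (g u) (g w) = nrm (u - w).
  move=> ur wr; rewrite gd // /kap /nrm; congr Num.sqrt.
  by rewrite !dotE (dotC w u); ring.
exists g, [set u | nrm u < r]; split; last by exists 0; rewrite //= nrm0.
have oD : open [set u : V | nrm u < r].
  rewrite (_ : mkset _ = [set u | nrm (u - 0) < r]); first exact: open_nrm_ball.
  by apply/seteqP; split=> u /=; rewrite subr0.
split => //.
- move=> u w; rewrite !inE /= => ur wr e; apply/subr0_eq/eqP.
  by rewrite -nrm_eq0 -giso // e mdistxx.
- move=> W oW; apply/open_nrmP => u [/= ur Wu].
  have [e e0 he] := (open_mdist W).1 oW _ Wu.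
  exists (Num.min e (r - nrm u)); first by rewrite lt_min e0 subr_gt0.
  move=> w; rewrite lt_min => /andP[we wr].
  have wr' : nrm w < r by have := nrmD (w - u) u; rewrite subrK; lra.
  by split => //; apply: he; rewrite giso // nrmB.
- move=> A AD oA; apply/open_mdist => _ [u Au <-].
  have ur := AD _ Au; rewrite /= in ur.
  have [e e0 he] := (open_nrmP A).1 oA u Au.
  exists (Num.min e (r - nrm u)); first by rewrite lt_min e0 subr_gt0.
  move=> y; rewrite lt_min => /andP[ye yr].
  have y0 : mdist (g 0) y < r.
    have := metric_triangle (g 0) (g u) y; rewrite giso ?nrm0 // sub0r nrmN; lra.
  have [w gw nw] := g_lift y y0; exists w => //.
  by apply: he; rewrite nrmB -giso // ?gw ?nw.
Qed.

(* Over a punctured ball of [R^3] the double cover [g] would have a section,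
   which along a half great circle would join a lift to its antipode. *)
Lemma singular_point_not_locally_euclidean (X : metricType R) (r : R) (g : V -> X) :
  flat_chart true r g -> ~ locally_euclidean R (g 0).
Proof.
move=> gch [h [D [hD [z Dz hz]]]]; have [oD hi hc ho] := hD.
have [r0 gd g_lift] := gch.
pose B := [set x : X | mdist (g 0) x < r].
have oB : open B.
  apply/open_mdist => x /= Bx; exists (r - mdist (g 0) x); first by rewrite subr_gt0.
  by move=> y; have := metric_triangle (g 0) x y; rewrite /B /=; lra.
have [rho rho0 hrho] : exists2 rho, 0 < rho & forall y, nrm (y - z) < rho ->
  (D `&` h @^-1` B) y.
  by apply: (open_nrmP _).1; [exact: hc|split => //=; rewrite /B /= hz mdistxx].
pose E x := h (z + x).
have ED x : nrm x < rho -> D (z + x) /\ B (E x).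
  by move=> xr; apply: hrho; rewrite addrAC subrr add0r.
have E_chart x : x != 0 -> nrm x < rho -> 0 < mdist (g 0) (E x) < r.
  move=> x0 xr; have [Dx Bx] := ED x xr; apply/andP; split => //.
  rewrite mdist_gt0; apply: contra_neq x0 => ge.
  have : z = z + x by apply: hi; rewrite ?inE // hz.
  by move/(congr1 (fun y => y - z)); rewrite subrr addrAC subrr add0r.
have E_cont x : nrm x < rho -> forall e, 0 < e ->
    exists2 d, 0 < d & forall y, nrm (y - x) < d -> mdist (E x) (E y) < e.
  move=> xr e e0; have [Dx _] := ED x xr.
  have oW : open [set y : X | mdist (E x) y < e].
    apply/open_mdist => y /= ye; exists (e - mdist (E x) y); first by rewrite subr_gt0.
    by move=> w; have := metric_triangle (E x) y w; lra.
  have [|d d0 hd] := (open_nrmP _).1 (hc _ oW) (z + x).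
    by split => //=; rewrite mdistxx.
  by exists d => // y yx; have [|_] := hd (z + y); first by rewrite opprD addrACA subrr add0r.
have [s [sE sc]] := punctured_section gch rho0 E_chart E_cont.
have oball : open [set y | nrm (y - z) < rho] by exact: open_nrm_ball.
have [e1 e10 he1] : exists2 e, 0 < e & forall y : X, mdist (g 0) y < e ->
    (h @` [set y | nrm (y - z) < rho]) y.
  apply: (open_mdist _).1.
    by apply: ho => // y /hrho[].
  by exists z => //=; rewrite subrr nrm0.
pose k := Num.min e1 r / 2.
have k0 : 0 < k by rewrite divr_gt0 // lt_min e10.
have ke : k < e1 by have : Num.min e1 r <= e1 by [rewrite ge_min lexx]; rewrite /k; lra.
have kr : k < r by have : Num.min e1 r <= r by [rewrite ge_min lexx orbT]; rewrite /k; lra.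
(* Half a circle upstairs, from [y 0] to its antipode, so that its image under [g] is a loop. The
   radius [k] is small enough for the loop to lie in the image of the ball. *)
pose y t : V := (k * cos (pi * t), k * sin (pi * t), 0).
have ny t : nrm (y t) = k.
  rewrite /nrm /dot /= (_ : _ + _ = k ^+ 2 * (cos (pi * t) ^+ 2 + sin (pi * t) ^+ 2));
    last by ring.
  by rewrite cos2Dsin2 mulr1 sqrtr_sqr ger0_norm // ltW.
have gy t : mdist (g 0) (g (y t)) = k by rewrite (cone_radius gch (u := y t)) ?ny.
have /choice[q qE] : forall t, exists q, nrm q < rho /\ E q = g (y t).
  move=> t; have [|w wr hw] := he1 (g (y t)); first by rewrite gy.
  by exists (w - z); rewrite /E subrKC.
have qpu t : punctured rho (q t).
  have [qr Eq] := qE t; split => //; apply/eqP => q0; have := gy t.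
  by rewrite -Eq q0 /E addr0 hz mdistxx; lra.
have ycont : continuous_on_interval y 0 1.
  move=> t _ e e0; have e30 : 0 < e / 3 by rewrite divr_gt0.
  have cont (h' : R -> R) : continuous h' -> continuous (fun t => k * h' (pi * t)).
    move=> ch t'; apply: cvgM; first exact: cvg_cst.
    by apply: continuous_comp; [apply: cvgM; [exact: cvg_cst|exact: cvg_id]|exact: ch].
  have /cvgrPdist_lt /(_ _ e30) /nbhs_ballP[d1 /= d10 h1] := cont _ (@continuous_cos R) t.
  have /cvgrPdist_lt /(_ _ e30) /nbhs_ballP[d2 /= d20 h2] := cont _ (@continuous_sin R) t.
  exists (Num.min d1 d2); first by rewrite lt_min d10.
  move=> t' _; rewrite lt_min => /andP[t1 t2].
  apply: (@le_lt_trans _ _ (2 * (e / 3))); last lra.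
  apply: nrm_le_coord; rewrite /= ?subrr ?normr0 ?(ltW e30) // distrC ltW //.
    by apply: h1; rewrite /ball /= distrC.
  by apply: h2; rewrite /ball /= distrC.
(* The loop read in the Euclidean chart is continuous because [h] is open. *)
have qcont : continuous_on_interval q 0 1.
  move=> t ht e e0; have [qr Eq] := qE t.
  pose A := [set x | nrm (x - (z + q t)) < e] `&` [set x | nrm (x - z) < rho].
  have oA : open A by apply: openI; exact: open_nrm_ball.
  have ohA : open (h @` A) by apply: ho => // x [_ /hrho[]].
  have hA : (h @` A) (g (y t)).
    exists (z + q t); last exact: Eq.
    by split; rewrite /= ?subrr ?nrm0 // addrAC subrr add0r.
  have [e2 e20 he2] := (open_mdist (h @` A)).1 ohA _ hA.
  have [d d0 hd] := ycont t ht e2 e20.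
  exists d => // t' ht' tt'.
  have [|x [xe xr] hx] := he2 (g (y t')).
    apply: le_lt_trans (hd t' ht' tt'); rewrite nrmB.
    by apply: (cone_dist_le gch); rewrite ny.
  have [qr' Eq'] := qE t'.
  have -> : q t' = x - z.
    have : z + q t' = x.
      apply: hi; rewrite ?inE; first by have [] := ED _ qr'.
        by have [] := hrho x xr.
      by rewrite hx -Eq'.
    by move=> <-; rewrite addrAC subrr add0r.
  by move: xe; rewrite /= opprD addrA.
pose f t := s (q t).
have fcont : continuous_on_interval f 0 1.
  move=> t ht e e0; have [d d0 hd] := sc _ (qpu t) e e0.
  have [d' d'0 hd'] := qcont t ht d d0; exists d' => // t' ht' tt'.
  by apply: hd => //; exact: hd'.
have fE t : g (f t) = g (y t) /\ nrm (f t) < r.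
  by have [gs ns] := sE _ (qpu t); rewrite /f gs; have [_ ->] := qE t.
have nf t : nrm (f t) = k.
  by have [gf nf] := fE t; rewrite -(cone_radius gch nf gf) gy.
have y1 : y 1 = - y 0.
  by rewrite /y mulr1 mulr0 cos0 sin0 cospi sinpi; vector_ring.
have q01 : q 0 = q 1.
  have [q0r E0] := qE 0; have [q1r E1] := qE 1.
  have : z + q 0 = z + q 1.
    apply: hi; rewrite ?inE; [by have [] := ED _ q0r|by have [] := ED _ q1r|].
    rewrite -/(E _) -/(E _) E0 E1 y1 (flat_chart_even gch) ?ny //.
  by move/addrI.
have [e0 [e0e0 f0]] : exists c : R, c * c = 1 /\ f 0 = c *: y 0.
  have [g0 n0] := fE 0; have := cone_eq gch (u := y 0) (w := f 0).
  rewrite ny g0 => /(_ kr n0 erefl)[->|->]; first by exists 1; rewrite scale1r mulr1.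
  by exists (-1); rewrite scaleN1r; split => //; ring.
have yc c : c * c = 1 -> continuous_on_interval (fun t => c *: y t) 0 1.
  move=> cc t ht e ee0; have [d d0 hd] := ycont t ht e ee0; exists d => // t' ht' tt'.
  rewrite -scalerBr nrmZ (_ : `|c| = 1) ?mul1r; first exact: hd.
  by apply/eqP; rewrite -(@eqrXn2 _ 2) ?normr_ge0 // real_normK ?num_real // expr1n expr2 cc.
have nc c t : c * c = 1 -> nrm (c *: y t) = k /\ g (c *: y t) = g (y t).
  move=> cc; have : c = 1 \/ c = -1.
    have : (c - 1) * (c + 1) = 0 by nra.
    by move/eqP; rewrite mulf_eq0 subr_eq0 addr_eq0 => /orP[/eqP|/eqP]; [left|right].
  by case=> ->; rewrite ?scale1r ?scaleN1r ?nrmN ?(flat_chart_even gch) ?ny.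
(* Both lift the same path from the same start. But [f] closes up, since q 0 = q 1, whereas [y] ends
   at the antipode of its start. *)
have : f 1 = e0 *: y 1.
  apply: (lift_unique gch k0 fcont (yc e0 e0e0)) => // t _.
  by have [n1 g1] := nc e0 t e0e0; rewrite nf n1 g1 lexx; have [-> _] := fE t.
rewrite /f -q01 -/(f 0) f0 y1 scalerN => /eqP; rewrite -subr_eq0 opprK -mulr2n -scaler_nat.
move=> /eqP /(congr1 (@nrm R)); rewrite nrm0 nrmZ (nc _ _ e0e0).1 ger0_norm //.
by have := k0; lra.
Qed.

End regular_and_singular_points.

(** * Quotients by a relation *)

Section quotient_by_facts.
Variables (T : topologicalType) (q : T -> T -> Prop).

Lemma quotient_by_eq x y : quotient_by_pi q x = quotient_by_pi q y <->
  Relation_Operators.clos_refl_sym_trans T q x y.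
Proof.
split=> [/eqmodP/asboolP//|h].
by apply/eqmodP/asboolP.
Qed.

Lemma quotient_by_onto c : exists x, quotient_by_pi q x = c.
Proof. by exists (repr c); exact: reprK. Qed.

Lemma quotient_by_open (A : set (quotient_by q)) :
  open A <-> open (quotient_by_pi q @^-1` A).
Proof. by []. Qed.

Lemma quotient_by_continuous : continuous (quotient_by_pi q : T -> quotient_by q).
Proof. by apply/continuousP. Qed.

End quotient_by_facts.

(** * Polar coordinates and charts on a cone *)

Section cones.
Variables (R : realType) (S : topologicalType).
Local Notation V := (R * R * R)%type.
Implicit Types (s : S) (t : R) (x y v w : V).

(** The collapsing relation is already symmetric and transitive; its closure adds only equality. *)
Lemma cone_pt_eq (a b : S * [set t : R | 0 <= t]) :
  cone_pt a = cone_pt b <-> a = b \/ val a.2 = 0 /\ val b.2 = 0.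
Proof.
rewrite quotient_by_eq; split.
- elim=> {a b} [a b|a|a b _ []|a b c _ h1 _ h2]; [by right|by left|by left|by case; right|].
  by case: h1 => [->//|[a0 b0]]; case: h2 => [<-|[_ c0]]; right.
- by case=> [->|h]; [exact: Relation_Operators.rst_refl|exact: Relation_Operators.rst_step].
Qed.

Definition half_line (t : R) : [set t : R | 0 <= t] := exist _ `|t| (mem_set (normr_ge0 t)).

Lemma half_line_continuous : continuous half_line.
Proof.
move=> t A [B [[W oW <-] Wt] WA].
have nW : nbhs `|t| W by exact: open_nbhs_nbhs.
have nt : nbhs t [set u | W `|u|] := @norm_continuous R R^o t W nW.
by apply: (@filterS _ (nbhs t) _ _ _ _ nt) => u Wu; exact: WA.
Qed.

(* The parameter [t] is extended to [R] by taking its absolute value. *)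
Definition polar_pt s t : cone R S := cone_pt (s, half_line t).

Lemma polar_pt_continuous : continuous (fun a : S * R => polar_pt a.1 a.2).
Proof.
move=> [s t] A nA.
have [[B C] /= [nB nC] BC] := @quotient_by_continuous _ (@cone_rel R S) (s, half_line t) A nA.
exists (B, half_line @^-1` C); first by split=> //=; exact: half_line_continuous.
by move=> [s' t'] [/= Bs Ct]; exact: (BC (s', half_line t')).
Qed.

Lemma polar_pt_onto (c : cone R S) : exists s t, 0 <= t /\ polar_pt s t = c.
Proof.
have [[s u] <-] := quotient_by_onto c; exists s, (val u).
have u0 : 0 <= val u := set_valP u.
split => //; apply: (congr1 (fun z => cone_pt (s, z))); apply: val_inj => /=.
by rewrite ger0_norm.
Qed.

Lemma polar_pt_inj s t s' t' : 0 < t -> 0 <= t' -> polar_pt s t = polar_pt s' t' ->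
  s = s' /\ t = t'.
Proof.
move=> t0 t'0 /cone_pt_eq[e|[/= + _]]; last first.
  by move/normr0_eq0 => e; move: t0; rewrite e ltxx.
split; first exact: (congr1 fst e).
by have := congr1 (fun a => val a.2) e; rewrite /= !ger0_norm // ltW.
Qed.

Lemma polar_pt_apex s s' t' : 0 <= t' -> polar_pt s 0 = polar_pt s' t' -> t' = 0.
Proof.
move=> t'0; rewrite le_eqVlt in t'0; case/orP: t'0 => [/eqP//|t'0 /esym].
by move=> /(polar_pt_inj t'0 (lexx 0))[].
Qed.

Lemma cone_ball_compact t : compact [set: S] ->
  compact [set c : cone R S | exists s u, 0 <= u <= t /\ c = polar_pt s u].
Proof.
move=> cS; rewrite (_ : mkset _ = (fun a : S * R => polar_pt a.1 a.2) @`
   (setT `*` `[0, t]%classic)).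
  apply: continuous_compact; last by apply: compact_setX => //; exact: segment_compact.
  by apply: continuous_subspaceT; exact: polar_pt_continuous.
apply/seteqP; split=> [c [s [u [hu ->]]]|_ [[s u] [_ /= hu] <-]].
  by exists (s, u) => //; split => //=; rewrite in_itv.
by exists s, u; rewrite in_itv /= in hu.
Qed.

(* [d] presents [S] as the unit sphere, possibly with antipodes identified,
   extended radially. *)
Definition radial (d : V -> S) : Prop :=
  [/\ forall s, exists v, dot v v = 1 /\ d v = s,
      forall c x, 0 < c -> d (c *: x) = d x,
      forall x, x != 0 -> {for x, continuous d},
      forall A, open A -> (forall x, A x -> x != 0) -> open (d @` A) &
      forall v w, dot v v = 1 -> dot w w = 1 -> d v = d w -> w = v \/ w = - v].

(** Reflection of the radius in the gluing level 1, applied on one side of a connected sum. *)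
Definition flip (b : bool) (t : R) : R := if b then 2 - t else t.

Lemma flipK b : involutive (flip b).
Proof. by move=> t; rewrite /flip; case: b; ring. Qed.

Lemma flip_lip b t t' : `|flip b t - flip b t'| = `|t - t'|.
Proof.
rewrite /flip; case: b => //.
have -> : 2 - t - (2 - t') = - (t - t') by ring.
exact: normrN.
Qed.

(** The half-space of [w] contains at most one of two antipodes, which gives injectivity; positive
    radii keep away from the apex. *)
Lemma cone_chart (d : V -> S) b w (D : set V) : radial d -> open D ->
  (forall x, D x -> 0 < dot x w /\ 0 < flip b (nrm x)) ->
  open_embedding (fun x => polar_pt (d x) (flip b (nrm x))) D.
Proof.
move=> [d_onto dZ dc dopen deq] oD hD.
have Dn0 x : D x -> x != 0.
  by move=> /hD[h _]; apply: contraTneq h => ->; rewrite dot0l ltxx.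
have unitE x : x != 0 -> dot ((nrm x)^-1 *: x) ((nrm x)^-1 *: x) = 1.
  move=> x0; apply: nrm1_dot.
  by rewrite nrmZ ger0_norm ?invr_ge0 ?nrm_ge0 // mulVf // nrm_eq0.
have dE x : x != 0 -> d ((nrm x)^-1 *: x) = d x.
  by move=> x0; rewrite dZ // invr_gt0 nrm_gt0.
split => //.
- move=> x y; rewrite !inE => Dx Dy /polar_pt_inj.
  case/(_ (hD x Dx).2 (ltW (hD y Dy).2)) => dxy /(can_inj (flipK b)) nxy.
  have x0 := Dn0 _ Dx; have y0 := Dn0 _ Dy.
  have nx : nrm x != 0 by rewrite nrm_eq0.
  have := deq _ _ (unitE x x0) (unitE y y0); rewrite !dE // => /(_ dxy) [e|e].
    have -> : x = nrm x *: ((nrm y)^-1 *: y) by rewrite e scalerA mulfV ?scale1r.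
    by rewrite nxy scalerA mulfV ?scale1r // nrm_eq0.
  have : dot ((nrm y)^-1 *: y) w = - dot ((nrm x)^-1 *: x) w by rewrite e dotNl.
  rewrite !dotZl -nxy => /eqP; rewrite -mulrN.
  have inx : (nrm x)^-1 != 0 by rewrite invr_eq0.
  rewrite (inj_eq (mulfI inx)) => /eqP h.
  by exfalso; have := (hD x Dx).1; have := (hD y Dy).1; lra.
- move=> W oW; rewrite openE => x [Dx Wx]; apply: filterI.
    by apply: open_nbhs_nbhs.
  have kc : (d y, flip b (nrm y)) @[y --> x] --> (d x, flip b (nrm x)).
    apply: (@cvg_pair _ _ _ (nbhs x) (nbhs (d x)) (nbhs (flip b (nrm x)))).
      exact: dc (Dn0 _ Dx).
    apply/cvgrPdist_lt => e e0; apply/nbhs_nrmP; exists e => // y yx.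
    by rewrite /= flip_lip distrC; apply: le_lt_trans (nrm_dist _ _) yx.
  have := @cvg_comp _ _ _ _ _ _ _ _ kc (@polar_pt_continuous (d x, flip b (nrm x))).
  by apply; apply: open_nbhs_nbhs.
- move=> A AD oA; apply/quotient_by_open; rewrite openE => -[s u] [x Ax].
  have [xw fx] := hD x (AD x Ax); have x0 := Dn0 _ (AD x Ax).
  move=> /cone_pt_eq [dus|[/= + _]]; last first.
    by move/normr0_eq0 => e; move: fx; rewrite e ltxx.
  have ds : d x = s := congr1 fst dus.
  have us : half_line (flip b (nrm x)) = u := congr1 snd dus.
  have [e e0 he] := (open_nrmP A).1 oA x Ax.
  have nx0 : 0 < nrm x by rewrite nrm_gt0.
  (* A move by [e'] followed by the radial correction costs less than 3 e' < e, and nrm x / 2 keeps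
     the radii positive. *)
  pose e' := Num.min (e / 4) (nrm x / 2).
  have e'0 : 0 < e' by rewrite lt_min !divr_gt0.
  have e'1 : e' <= e / 4 by rewrite ge_min lexx.
  have e'2 : e' <= nrm x / 2 by rewrite ge_min lexx orbT.
  pose B := [set y | nrm (y - x) < e'].
  have Bn y : B y -> 0 < nrm y.
    by rewrite /B /= => h; have := nrmD (x - y) y; rewrite subrK nrmB; lra.
  have oB : open (d @` B).
    by apply: dopen; [exact: open_nrm_ball|move=> y /Bn; rewrite nrm_gt0].
  have uE : val u = flip b (nrm x) by rewrite -us /= ger0_norm // ltW.
  exists (d @` B, [set u' : [set t : R | 0 <= t] | `|val u' - val u| < e']).
    split => /=.
      by apply: open_nbhs_nbhs; split => //; exists x; rewrite // /B /= subrr nrm0.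
    have : nbhs (val u) [set z | `|z - val u| < e'].
      apply/nbhs_ballP; exists e' => //= z; rewrite /ball /= distrC //.
    move/(@initial_continuous _ _ (val : [set t : R | 0 <= t] -> R) u).
    by [].
  move=> [s' u'] [/= [y By ys'] hu'].
  have u'0 : 0 <= val u' := set_valP u'.
  have fu : `|flip b (val u') - nrm x| < e'.
    by rewrite -(flipK b (nrm x)) flip_lip -uE.
  have f0 : 0 < flip b (val u') by move: fu; rewrite ltr_norml; lra.
  have ny := Bn y By.
  exists ((flip b (val u') / nrm y) *: y).
    apply: he; apply: le_lt_trans (nrm_triangle y _ _) _.
    have -> : (flip b (val u') / nrm y) *: y - y = ((flip b (val u') - nrm y) / nrm y) *: y.
      by rewrite mulrBl divff ?gt_eqF // scalerBl scale1r.
    rewrite nrmZ normrM normfV (ger0_norm (nrm_ge0 y)) divfK ?gt_eqF //.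
    have := nrm_dist x y; rewrite (nrmB x); move: fu By; rewrite /B /= => fu By nd.
    have := ler_distD (nrm x) (flip b (val u')) (nrm y); lra.
  rewrite dZ ?divr_gt0 // nrmZ ger0_norm ?divr_ge0 ?(ltW f0) ?nrm_ge0 //.
  rewrite divfK ?gt_eqF // flipK ys'.
  by apply: (congr1 (fun z => cone_pt (s', z))); apply: val_inj; rewrite /= ger0_norm.
Qed.

End cones.

(** * Radial extension of directions *)

Section radial_maps.
Variable R : realType.
Local Notation V := (R * R * R)%type.
Implicit Types (x y v w : V).

Lemma normalize_unit x : x != 0 -> dot ((nrm x)^-1 *: x) ((nrm x)^-1 *: x) = 1.
Proof.
move=> x0; apply: nrm1_dot.
by rewrite nrmZ ger0_norm ?invr_ge0 ?nrm_ge0 // mulVf // nrm_eq0.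
Qed.

Lemma normalize_id v : dot v v = 1 -> (nrm v)^-1 *: v = v.
Proof. by move=> v1; rewrite unit_nrm // invr1 scale1r. Qed.

Lemma normalize_lip x y : x != 0 -> y != 0 ->
  nrm ((nrm x)^-1 *: x - (nrm y)^-1 *: y) <= 2 * nrm (x - y) / nrm x.
Proof.
move=> x0 y0; have nx : 0 < nrm x by rewrite nrm_gt0.
have ny : 0 < nrm y by rewrite nrm_gt0.
have -> : (nrm x)^-1 *: x - (nrm y)^-1 *: y =
    (nrm x)^-1 *: (x - y) + ((nrm x)^-1 - (nrm y)^-1) *: y by vector_ring.
apply: le_trans (nrmD _ _) _; rewrite !nrmZ ger0_norm ?invr_ge0 ?nrm_ge0 //.
have -> : (nrm x)^-1 - (nrm y)^-1 = (nrm y - nrm x) / (nrm x * nrm y).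
  by field; rewrite !gt_eqF.
rewrite normrM normfV (ger0_norm (_ : 0 <= nrm x * nrm y)) ?mulr_ge0 ?nrm_ge0 //.
have -> : `|nrm y - nrm x| / (nrm x * nrm y) * nrm y = `|nrm y - nrm x| / nrm x.
  by field; rewrite !gt_eqF.
rewrite [X in X + _]mulrC -mulrDl ler_pM2r ?invr_gt0 //.
by have := nrm_dist y x; rewrite (nrmB y); lra.
Qed.

Lemma spherical_radial b (S : metricType R) (f : V -> S) : spherical b f ->
  radial (fun x => f ((nrm x)^-1 *: x)).
Proof.
move=> [f_onto f_dist]; split.
- by move=> s; have [v v1 <-] := f_onto s; exists v; rewrite normalize_id.
- move=> c x c0; congr f; rewrite nrmZ ger0_norm ?(ltW c0) // invfM scalerA.
  by rewrite mulrAC mulVf ?mul1r // gt_eqF.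
- move=> x x0; apply/metricType_numDomainType.cvgrPdist_lt => e e0.
  have [t t0 ht] := acos_kap_near b e0; have nx : 0 < nrm x by rewrite nrm_gt0.
  apply/nbhs_nrmP; exists (Num.min (nrm x) (t * nrm x / 2)).
    by rewrite lt_min nx divr_gt0 // mulr_gt0.
  move=> y; rewrite lt_min => /andP[y1 y2].
  have y0 : y != 0 by apply: contraTneq y1 => ->; rewrite sub0r nrmN ltxx.
  rewrite f_dist ?normalize_unit //; apply: ht; rewrite ?normalize_unit //.
  apply: le_lt_trans (normalize_lip x0 y0) _.
  by rewrite ltr_pdivrMr // nrmB; lra.
- move=> A oA A0; apply/open_mdist => _ [x Ax <-].
  have x0 := A0 x Ax; have nx : 0 < nrm x by rewrite nrm_gt0.
  have [e e0 he] := (open_nrmP A).1 oA x Ax.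
  have [t t0 ht] := near_acos_kap (ltac:(by rewrite divr_gt0) : 0 < e / nrm x).
  exists t => // s; have [w w1 <-] := f_onto s.
  rewrite f_dist ?normalize_unit // => /ht; rewrite normalize_unit // => /(_ erefl w1).
  move=> [w' [ww' w'1 hw']]; exists (nrm x *: w').
    apply: he; have -> : nrm x *: w' - x = nrm x *: (w' - (nrm x)^-1 *: x).
      by rewrite scalerBr scalerA mulfV ?scale1r // gt_eqF.
    by rewrite nrmZ ger0_norm ?(ltW nx) // nrmB mulrC -ltr_pdivlMr.
  rewrite nrmZ (unit_nrm w'1) mulr1 ger0_norm ?(ltW nx) // scalerA mulVf ?scale1r ?gt_eqF //.
  exact: (f_antipode f_dist w1 ww').
- move=> v w v1 w1; rewrite !normalize_id // => e.
  have := f_dist v w v1 w1; rewrite e mdistxx => /esym/(acos_kap_eq0 v1 w1).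
  by case=> [|[_]]; [left|right].
Qed.

Lemma radial_homeomorphism (S S' : topologicalType) (d : V -> S) (k : S -> S') :
  radial d -> is_homeomorphism k -> radial (k \o d).
Proof.
move=> [d1 d2 d3 d4 d5] hk; have [kc [k' [kk k'k _]]] := hk; split.
- move=> s; have [v [v1 dv]] := d1 (k' s); exists v; split => //=.
  by rewrite dv k'k.
- by move=> c x c0 /=; rewrite d2.
- by move=> x x0; apply: continuous_comp; [exact: d3|exact: kc].
- move=> A oA A0; rewrite -image_comp.
  by have [_ _ _ ko] := homeomorphism_open_embedding hk; apply: ko => //; exact: d4.
- by move=> v w v1 w1 /(can_inj kk); exact: d5.
Qed.

End radial_maps.

(** * Cone neighbourhoods, their closure and frontier *)

Section regular_neighbourhoods.
Variables (R : realType) (X : metricType R) (S : topologicalType) (h : cone R S -> X).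
Local Notation V := (R * R * R)%type.
Hypotheses (S_compact : compact [set: S]) (h_cont : continuous h) (h_inj : injective h)
  (h_open : forall A, open A -> open (h @` A)).

Definition cone_nbhd : set X := [set h (cone_pt a) | a in [set a | val a.2 < 1]].

Lemma h_embedding : open_embedding h setT.
Proof.
split; [exact: openT|by move=> x y _ _; exact: h_inj| |by move=> A _; exact: h_open].
by move=> W oW; rewrite setTI; apply: open_comp => // x _; exact: h_cont.
Qed.

Lemma cone_nbhdP x : cone_nbhd x <-> exists s t, 0 <= t < 1 /\ x = h (polar_pt s t).
Proof.
split=> [[[s u] /= u1 <-]|[s [t [/andP[t0 t1] ->]]]].
  have u0 : 0 <= val u := set_valP u.
  exists s, (val u); rewrite u0 u1; split => //; congr h.
  by apply: (congr1 (fun z => cone_pt (s, z))); apply: val_inj; rewrite /= ger0_norm.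
by exists (s, half_line t) => //=; rewrite ger0_norm.
Qed.

Lemma cone_nbhd_polar s t : 0 <= t -> cone_nbhd (h (polar_pt s t)) <-> t < 1.
Proof.
move=> t0; split=> [/cone_nbhdP[s' [t' [/andP[t'0 t'1] /h_inj]]]|t1]; last first.
  by apply/cone_nbhdP; exists s, t; rewrite t0 t1.
have [->|tn] := eqVneq t 0; first by rewrite ltr01.
have tp : 0 < t by rewrite lt_neqAle eq_sym tn.
by move=> /(polar_pt_inj tp t'0)[_ ->].
Qed.

Lemma cone_nbhd_open : open cone_nbhd.
Proof.
rewrite (_ : cone_nbhd = h @` [set c | exists s t, 0 <= t < 1 /\ c = polar_pt s t]).
  apply: h_open; apply/quotient_by_open.
  rewrite (_ : _ @^-1` _ = [set a | val a.2 < 1]).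
    rewrite openE => -[s u] /= u1; exists (setT, val @^-1` [set z : R | z < 1]) => /=.
      split; first exact: filterT.
      have : nbhs (val u) [set z : R | z < 1].
        by apply: open_nbhs_nbhs; split => //; exact: open_lt.
      by move/(@initial_continuous _ _ (val : [set t : R | 0 <= t] -> R) u).
    by move=> [s' u'] [].
  apply/seteqP; split=> [a [s [t [/andP[t0 t1] e]]]|a a1] /=.
    have : cone_pt a = cone_pt (s, half_line t) by exact: e.
    move/cone_pt_eq => [->|[-> _]]; last exact: ltr01.
    by rewrite /= ger0_norm.
  have a0 : 0 <= val a.2 := set_valP a.2.
  exists a.1, (val a.2); rewrite a0 a1; split => //.
  case: a a0 {a1} => s u /= u0; apply: (congr1 (fun z => cone_pt (s, z))).
  by apply: val_inj; rewrite /= ger0_norm.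
apply/seteqP; split=> x.
  by move=> /cone_nbhdP[s [t [ht ->]]]; exists (polar_pt s t) => //; exists s, t.
by move=> [_ [s [t [ht ->]]] <-]; apply/cone_nbhdP; exists s, t.
Qed.

(** The closed cone of radius 1 has compact image, hence closed; a point of radius 1 is a limit
    along its ray. *)
Lemma closure_cone_nbhd x :
  closure cone_nbhd x <-> exists s t, 0 <= t <= 1 /\ x = h (polar_pt s t).
Proof.
pose K := h @` [set c : cone R S | exists s t, 0 <= t <= 1 /\ c = polar_pt s t].
have cK : closed K.
  apply: compact_closed; first exact: metric_hausdorff.
  apply: continuous_compact; last exact: cone_ball_compact.
  by apply: continuous_subspaceT; exact: h_cont.
split.
  move=> Ux; have [_ [s [t [ht ->]]] <-] : K x; last by exists s, t.
  apply: cK; apply: closure_subset Ux => y /cone_nbhdP[s [t [/andP[t0 t1] ->]]].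
  by exists (polar_pt s t) => //; exists s, t; rewrite t0 ltW.
move=> [s [t [/andP[t0 t1] ->]]] B.
have hc : continuous (fun u : R => h (polar_pt s u)).
  move=> u A nA; have nhA : nbhs (polar_pt s u) (h @^-1` A) by exact: h_cont.
  have [[C D] /= [nC nD] CD] := @polar_pt_continuous R S (s, u) _ nhA.
  apply: (@filterS _ (nbhs u) _ _ _ _ nD) => u' Du'.
  by apply: (CD (s, u')); split => //=; exact: nbhs_singleton.
move=> /(hc t) /nbhs_ballP[e /= e0 he].
pose u := Num.max 0 (t - e / 2).
have u0 : 0 <= u by rewrite /u le_max lexx.
have u1 : u < 1 by rewrite /u gt_max ltr01; lra.
exists (h (polar_pt s u)); split; first by apply/cone_nbhd_polar.
apply: he; rewrite /ball /= /u; case: (leP 0 (t - e / 2)) => ht.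
  rewrite opprB addrC subrK ger0_norm; lra.
rewrite subr0 ger0_norm //; lra.
Qed.

Lemma frontier_cone_nbhd x :
  frontier (~` cone_nbhd) x <-> exists s, x = h (polar_pt s 1).
Proof.
rewrite /frontier interiorC setDE setCK.
have /closure_id <- : closed (~` cone_nbhd) by apply: open_closedC; exact: cone_nbhd_open.
split=> [[nU /closure_cone_nbhd[s [t [/andP[t0 t1] xE]]]]|[s ->]].
  exists s; rewrite xE in nU *; congr (h (polar_pt _ _)); apply/le_anti; rewrite t1 /=.
  by rewrite leNgt; apply/negP => tl; apply: nU; exact/cone_nbhd_polar.
split; first by move/(cone_nbhd_polar _ ler01); rewrite ltxx.
by apply/closure_cone_nbhd; exists s, 1; rewrite ler01 lexx.
Qed.

Lemma cone_nbhd_locally_euclidean (d : V -> S) s t : radial d -> 0 < t ->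
  locally_euclidean R (h (polar_pt s t)).
Proof.
move=> hd t0; have [d_onto dZ _ _ _] := hd.
have [v [v1 <-]] := d_onto s.
pose D := [set x : V | 0 < dot v x].
have oD : open D.
  rewrite (_ : D = dot v @^-1` [set z | 0 < z]) //.
  by apply: open_comp; [move=> x _; exact: dot_continuous|exact: open_gt].
have hD x : D x -> 0 < dot x v /\ 0 < flip false (nrm x).
  rewrite /D /flip /= dotC => xv; split => //; rewrite nrm_gt0.
  by apply: contraTneq xv => ->; rewrite dot0l ltxx.
have e := cone_chart (b := false) hd oD hD.
apply: (locally_euclidean_image h_embedding) => //.
exists (fun x => polar_pt (d x) (flip false (nrm x))), D; split => //.
exists (t *: v); first by rewrite /D /= dotZr v1 mulr1.
by rewrite dZ // /flip nrmZ_unit // ltW.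
Qed.

End regular_neighbourhoods.

(** * Regular cone neighbourhoods from flat charts *)

Section cone_of_flat_chart.
Variables (R : realType) (X S : metricType R) (b : bool) (r : R).
Local Notation V := (R * R * R)%type.
Variables (g : V -> X) (f : V -> S).
Hypotheses (g_chart : flat_chart b r g) (f_sph : spherical b f).
Implicit Types (u v w : V) (s : S) (t : R).

Lemma flat_chart_lip u w : nrm u < r -> nrm w < r -> mdist (g u) (g w) <= nrm (u - w).
Proof.
case: g_chart => _ gd _ ur wr; rewrite gd // /nrm ler_wsqrtr //.
by have := dot_le_kap b u w; rewrite !dotE (dotC w u); lra.
Qed.

Let r0 : 0 < r := flat_chart_gt0 g_chart.

(** Compresses the half-line onto [0, r[, because a regular neighbourhood requires an embedding of
    the whole infinite cone. *)
Definition squeeze t : R := r * t / (1 + t).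

Lemma squeeze_itv t : 0 <= t -> 0 <= squeeze t < r.
Proof.
move=> t0; rewrite /squeeze divr_ge0 ?mulr_ge0 ?addr_ge0 ?(ltW r0) //=.
by rewrite ltr_pdivrMr ?ltr_pwDl // ltr_pM2l // ltrDr.
Qed.

Lemma squeeze_lip t t' : 0 <= t -> 0 <= t' -> `|squeeze t - squeeze t'| <= r * `|t - t'|.
Proof.
move=> t0 t'0; have h1 : 1 + t != 0 by rewrite gt_eqF // ltr_pwDl.
have h2 : 1 + t' != 0 by rewrite gt_eqF // ltr_pwDl.
have -> : squeeze t - squeeze t' = r * (t - t') / ((1 + t) * (1 + t')).
  by rewrite /squeeze; field; rewrite h1 h2.
have tt : 0 <= t * t' by rewrite mulr_ge0.
have tt1 : 1 <= (1 + t) * (1 + t') by lra.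
have tt0 : 0 < (1 + t) * (1 + t') by lra.
rewrite normrM (normrM r) normfV (ger0_norm (ltW r0)) (ger0_norm (ltW tt0)).
by rewrite ler_pdivrMr // ler_peMr // mulr_ge0 // ltW.
Qed.

Lemma squeeze_lt t t' : 0 <= t -> 0 <= t' -> (squeeze t < squeeze t') = (t < t').
Proof.
move=> t0 t'0; rewrite /squeeze ltr_pdivrMr ?ltr_pwDl // mulrAC ltr_pdivlMr ?ltr_pwDl //.
rewrite -!mulrA ltr_pM2l // !mulrDr !mulr1 (mulrC t t') ltrD2r //.
Qed.

Lemma squeeze_inj t t' : 0 <= t -> 0 <= t' -> squeeze t = squeeze t' -> t = t'.
Proof.
by move=> t0 t'0 e; case: (ltgtP t t') => //; rewrite -squeeze_lt // e ltxx.
Qed.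

Lemma squeeze_onto a : 0 <= a < r -> exists2 t, 0 <= t & squeeze t = a.
Proof.
move=> /andP[a0 ar]; exists (a / (r - a)); first by rewrite divr_ge0 // subr_ge0 ltW.
have h : r - a != 0 by rewrite subr_eq0 gt_eqF.
rewrite /squeeze; field; rewrite h /= subrK gt_eqF //.
Qed.

Lemma flat_chart_cone : exists h : cone R S -> X,
  [/\ continuous h, injective h, (forall A, open A -> open (h @` A)) &
      forall a, val a.2 = 0 -> h (cone_pt a) = g 0].
Proof.
have [f_onto f_dist] := f_sph; have [_ gd g_lift] := g_chart.
have /choice[dv dvE] : forall s, exists v, dot v v = 1 /\ f v = s.
  by move=> s; have [v v1 fv] := f_onto s; exists v.
pose h (c : cone R S) : X := let a := repr c in g (squeeze (val a.2) *: dv a.1).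
have z0 : squeeze 0 = 0 by rewrite /squeeze mulr0 mul0r.
have hE (a : S * [set t : R | 0 <= t]) : h (cone_pt a) = g (squeeze (val a.2) *: dv a.1).
  rewrite /h; have : cone_pt a = cone_pt (repr (cone_pt a))
    by rewrite /cone_pt /quotient_by_pi reprK.
  by move/cone_pt_eq => [<-//|[-> ->]]; rewrite z0 !scale0r.
(* The lifts [dv] are chosen without continuity. This frees the formula from that choice, so nearby
   directions can be given nearby lifts. *)
have hP s t v : 0 <= t -> dot v v = 1 -> f v = s -> h (polar_pt s t) = g (squeeze t *: v).
  move=> t0 v1 fv; rewrite /polar_pt hE /= ger0_norm //.
  have [d1 fd] := dvE s; have /andP[q0 qr] := squeeze_itv t0.
  have := f_dist v (dv s) v1 d1; rewrite fv fd mdistxx => /esym/(acos_kap_eq0 v1 d1).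
  case=> [->//|[hb ->]]; rewrite scalerN (flat_chart_even g_chart) //.
  by rewrite nrmZ_unit.
have hrad s t : 0 <= t -> mdist (g 0) (h (polar_pt s t)) = squeeze t.
  move=> t0; have [d1 fd] := dvE s; have /andP[q0 qr] := squeeze_itv t0.
  by rewrite (hP s t _ t0 d1 fd) (flat_chart_radius g_chart) nrmZ_unit.
have hcont : continuous h.
  apply/quotient_continuous => -[s u].
  apply/metricType_numDomainType.cvgrPdist_lt => e e0.
  have u0 : 0 <= val u := set_valP u.
  have [d1 fd] := dvE s; have e2 : 0 < e / 2 by rewrite divr_gt0.
  have [t t0 ht] := near_acos_kap (ltac:(by rewrite divr_gt0) : 0 < e / 2 / r).
  exists ([set s' | mdist s s' < t],
    [set u' : [set t : R | 0 <= t] | `|val u' - val u| < e / 2 / r]).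
    split; first by apply/nbhs_mdist; exists t.
    have : nbhs (val u) [set z | `|z - val u| < e / 2 / r].
      by apply/nbhs_ballP; exists (e / 2 / r) => /=; rewrite ?divr_gt0 // => z;
        rewrite /ball /= distrC.
    by move/(@initial_continuous _ _ (val : [set t : R | 0 <= t] -> R) u).
  move=> [s' u'] [/= ss' uu']; have u'0 : 0 <= val u' := set_valP u'.
  have [d1' fd'] := dvE s'.
  have := ht b (dv s) (dv s') d1 d1'; rewrite -f_dist // fd fd' => /(_ ss')[w [hw w1 dw]].
  have fw : f w = s' by rewrite -fd'; apply: (f_antipode f_dist d1' hw).
  have polE (a : S) (z : [set t : R | 0 <= t]) : cone_pt (a, z) = polar_pt a (val z).
    apply: (congr1 (fun z => cone_pt (a, z))); apply: val_inj.
    by rewrite /= ger0_norm //; exact: (set_valP z).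
  have -> : \pi_(quotient_by (@cone_rel R S)) (s, u) = polar_pt s (val u) := polE s u.
  have -> : \pi_(quotient_by (@cone_rel R S)) (s', u') = polar_pt s' (val u') := polE s' u'.
  rewrite (hP s _ _ u0 d1 fd) (hP s' _ _ u'0 w1 fw).
  have /andP[q0 qr] := squeeze_itv u0; have /andP[q'0 q'r] := squeeze_itv u'0.
  apply: le_lt_trans (flat_chart_lip _ _) _; rewrite ?nrmZ_unit //.
  have -> : squeeze (val u) *: dv s - squeeze (val u') *: w =
     squeeze (val u) *: (dv s - w) + (squeeze (val u) - squeeze (val u')) *: w by vector_ring.
  apply: le_lt_trans (nrmD _ _) _; rewrite !nrmZ (unit_nrm w1) mulr1 (ger0_norm q0).
  have A1 := squeeze_lip u0 u'0; rewrite distrC in uu'.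
  have A2 : r * `|val u - val u'| < e / 2 by rewrite mulrC -ltr_pdivlMr.
  have A3 : squeeze (val u) * nrm (dv s - w) <= e / 2.
    apply: le_trans (_ : r * nrm (dv s - w) <= _); first by rewrite ler_wpM2r ?nrm_ge0 // ltW.
    by rewrite mulrC -ler_pdivlMr // ltW.
  lra.
have hinj : injective h.
  move=> c c'; have [s [t [t0 <-]]] := polar_pt_onto c.
  have [s' [t' [t'0 <-]]] := polar_pt_onto c' => e.
  have tt' : t = t' by apply: squeeze_inj => //; rewrite -(hrad s) // -(hrad s') // e.
  rewrite -{t' t'0}tt' in e *.
  have [tz|tn] := eqVneq t 0.
    by apply/cone_pt_eq; right; rewrite /= tz normr0.
  have [d1 fd] := dvE s; have [d1' fd'] := dvE s'.
  have tp : 0 < t by rewrite lt_neqAle eq_sym tn.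
  have qp : 0 < squeeze t by rewrite -z0 squeeze_lt.
  have := e; rewrite (hP s _ _ t0 d1 fd) (hP s' _ _ t0 d1' fd')
    => /(congr1 (mdist (g (squeeze t *: dv s)))).
  rewrite mdistxx (flat_chart_polar g_chart) ?squeeze_itv // => /esym/eqP.
  have [k1 k2] := andP (kap_itv b d1 d1').
  rewrite sqrtr_eq0 => hh.
  have k1' : kap b (dv s) (dv s') = 1.
    apply/le_anti; rewrite k2 /=.
    have : 0 < squeeze t ^+ 2 by rewrite exprn_gt0.
    by move: hh; rewrite expr2; nra.
  suff -> : s = s' by [].
  by apply: mdist_positivity; rewrite -fd -fd' f_dist // k1' acos1.
exists h; split => //; last by move=> a a0; rewrite hE a0 z0 scale0r.
move=> A oA; rewrite openE => _ [c Ac <-].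
have [s [t [t0 ct]]] := polar_pt_onto c; rewrite -ct in Ac *.
(* Openness by compactness: points nearer to the apex than [squeeze (t + 1)] come from [K], and
   those outside the compact image of [K] minus [A] come from [A]. *)
pose K := [set c : cone R S | exists s (u : R), 0 <= u <= t + 1 /\ c = polar_pt s u].
have t10 : 0 <= t + 1 by rewrite addr_ge0.
have cK : compact (h @` (K `&` ~` A)).
  apply: continuous_compact; first by apply: continuous_subspaceT; exact: hcont.
  apply: compact_closedI; last exact: open_closedC.
  exact: cone_ball_compact (spherical_compact f_sph).
have oC : open (~` (h @` (K `&` ~` A))).
  by apply: closed_openC; apply: compact_closed cK; exact: metric_hausdorff.
have oB : open [set x : X | mdist (g 0) x < squeeze (t + 1)].
  apply/open_mdist => x /= Bx; exists (squeeze (t + 1) - mdist (g 0) x);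
    first by rewrite subr_gt0.
  by move=> y; have := metric_triangle (g 0) x y; lra.
have : nbhs (h (polar_pt s t)) (~` (h @` (K `&` ~` A)) `&`
  [set x : X | mdist (g 0) x < squeeze (t + 1)]).
  apply: open_nbhs_nbhs; split; first exact: openI.
  split; last by rewrite /= hrad // squeeze_lt // ltrDl.
  by move=> [c' [_ nA]] /hinj e; apply: nA; rewrite e.
apply: filterS => x [nx xt].
have q1r : squeeze (t + 1) < r by have /andP[] := squeeze_itv t10.
have [u gu nu] := g_lift x (lt_trans xt q1r).
have [t' t'0 qt'] := squeeze_onto (ltac:(by rewrite mdist_ge0 (lt_trans xt q1r)) :
  0 <= mdist (g 0) x < r).
have [v v1 uv] : exists2 v, dot v v = 1 & u = squeeze t' *: v.
  have [u0|un] := eqVneq u 0.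
    by exists (unit_vector R); rewrite ?unit_vector_unit // qt' -nu u0 nrm0 scale0r.
  exists ((nrm u)^-1 *: u); first exact: normalize_unit.
  by rewrite qt' -nu scalerA mulfV ?scale1r // nrm_eq0.
have hx : h (polar_pt (f v) t') = x by rewrite (hP _ _ v t'0 v1) // -uv.
exists (polar_pt (f v) t') => //; apply: contrapT => nA; apply: nx.
exists (polar_pt (f v) t') => //; split => //; exists (f v), t'; split => //.
by rewrite t'0 /= ltW // -squeeze_lt // qt'.
Qed.

Lemma regular_cone_nbhd_exists : exists U, regular_cone_nbhd (g 0) U.
Proof.
have [h [h1 h2 h3 h4]] := flat_chart_cone.
exists (cone_nbhd h), S; split; first exact: (spherical_directions g_chart f_sph).
by exists h.
Qed.

End cone_of_flat_chart.

(** * Homeomorphisms *)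

Section homeomorphism_facts.
Variable R : realType.

Lemma is_homeomorphism_comp (X Y Z : topologicalType) (f : X -> Y) (g : Y -> Z) :
  is_homeomorphism f -> is_homeomorphism g -> is_homeomorphism (g \o f).
Proof.
move=> [fc [f' [ff' f'f f'c]]] [gc [g' [gg' g'g g'c]]]; split.
  by move=> x; apply: continuous_comp; [exact: fc|exact: gc].
exists (f' \o g'); split; [exact: can_comp|exact: can_comp|].
by move=> x; apply: continuous_comp; [exact: g'c|exact: f'c].
Qed.

Lemma is_homeomorphism_inv (X Y : topologicalType) (f : X -> Y) : is_homeomorphism f ->
  exists g : Y -> X, [/\ is_homeomorphism g, cancel f g & cancel g f].
Proof. by move=> [fc [g [fg gf gc]]]; exists g; split => //; split => //; exists f. Qed.

Lemma compact_homeomorphism (S : topologicalType) (X : metricType R) (A : set X) (f : S -> A) :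
  compact [set: S] -> continuous f -> injective f -> (forall y, exists x, f x = y) ->
  is_homeomorphism f.
Proof.
move=> cS fc fi /choice[g fg]; split => //; exists g; split => //.
  by move=> x; apply: fi; rewrite fg.
apply/continuous_closedP => C cC.
have vf : continuous (fun x => val (f x)).
  by move=> x; apply: continuous_comp; [exact: fc|exact: initial_continuous].
have cK : closed ((fun x => val (f x)) @` C).
  apply: compact_closed; first exact: metric_hausdorff.
  apply: continuous_compact; first exact: continuous_subspaceT.
  exact: subclosed_compact cC cS _.
rewrite (_ : g @^-1` C = val @^-1` ((fun x => val (f x)) @` C)).
  by apply: closed_comp => // x _; exact: initial_continuous.
apply/seteqP; split=> y /=; first by exists (g y); rewrite ?fg.
by move=> [x Cx /val_inj <-]; rewrite (_ : g _ = x) //; apply: fi; rewrite fg.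
Qed.

End homeomorphism_facts.

(** * Topology of the connected sum *)

Section connected_sum_topology.
Variables (R : realType) (P Q : metricType R) (p : P) (q : Q) (D : connected_sum_data p q).
Local Notation V := (R * R * R)%type.
Local Notation U := (csU D).
Local Notation W := (csV D).
Local Notation phi := (cs_phi (c := D)).
Local Notation rel := (@connected_sum_rel R P Q p q D).

Definition cs_left (x : ~` U) : connected_sum D :=
  quotient_by_pi rel (existT (connected_sum_piece D) true x).
Definition cs_right (y : ~` W) : connected_sum D :=
  quotient_by_pi rel (existT (connected_sum_piece D) false y).

(** Partial projections of the tagged union; they take the place of inversions on dependent
    pairs. *)
Let as_left (z : connected_sum_disjoint D) : option (~` U) :=
  match z with existT b u => (if b return (connected_sum_piece D b -> option (~` U))
    then Some else fun=> None) u end.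
Let as_right (z : connected_sum_disjoint D) : option (~` W) :=
  match z with existT b u => (if b return (connected_sum_piece D b -> option (~` W))
    then fun=> None else Some) u end.

Let phi_inj : injective phi.
Proof. by have [_ [k [kK _ _]]] := cs_phi_homeo D; exact: can_inj kK. Qed.

Let glued (x : ~` U) (y : ~` W) : Prop :=
  exists w : frontier (~` U), val x = val w /\ val y = val (phi w).

Let relP z z' : rel z z' <-> exists x y,
  [/\ as_left z = Some x, as_right z' = Some y & glued x y].
Proof.
split=> [[x y w h1 h2]|]; first by exists x, y; split => //; exists w.
case: z z' => -[] u [[] u'] [x [y [//= [e] [e'] [w [h1 h2]]]]].
by rewrite e e'; exact: ConnectedSumRel h1 h2.
Qed.

(** As [phi] is injective, a frontier point is glued to a single partner, so every chain of gluings
    shortens to at most one step. *)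
Let clos_relE z z' : Relation_Operators.clos_refl_sym_trans _ rel z z' <->
  z = z' \/ rel z z' \/ rel z' z.
Proof.
split; last first.
  case=> [->|[h|h]]; [exact: Relation_Operators.rst_refl|exact: Relation_Operators.rst_step|].
  by apply: Relation_Operators.rst_sym; exact: Relation_Operators.rst_step.
have leftE (z1 z2 : connected_sum_disjoint D) x x' : as_left z1 = Some x ->
  as_left z2 = Some x' ->
    val x = val x' -> z1 = z2.
  by case: z1 z2 => -[] u [[] u'] //= [->] [->] /val_inj ->.
have rightE (z1 z2 : connected_sum_disjoint D) y y' : as_right z1 = Some y ->
    as_right z2 = Some y' -> val y = val y' -> z1 = z2.
  by case: z1 z2 => -[] u [[] u'] //= [->] [->] /val_inj ->.
have excl (z1 : connected_sum_disjoint D) x y : as_left z1 = Some x -> as_right z1 = Some y ->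
  False.
  by case: z1 => -[].
elim=> {z z'} [z z'|z|z z' _ [->|[]]|z1 z2 z3 _ h1 _ h2]; [by right; left|by left|by left|
  by right; right|by right; left|].
case: h1 => [->//|h1]; case: h2 => [<-|h2]; first by right.
case: h1 => /relP[x1 [y1 [a1 b1 [w1 [c1 d1]]]]];
  case: h2 => /relP[x2 [y2 [a2 b2 [w2 [c2 d2]]]]].
- by case: (excl _ _ _ a2 b1).
- left; apply: (leftE _ _ _ _ a1 a2); rewrite c1 c2; congr val; apply: phi_inj; apply: val_inj.
  by rewrite -d1 -d2; move: b1; rewrite b2 => -[->].
- left; apply: (rightE _ _ _ _ b1 b2); rewrite d1 d2; congr (val (phi _)); apply: val_inj.
  by rewrite -c1 -c2; move: a1; rewrite a2 => -[->].
- by case: (excl _ _ _ a1 b2).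
Qed.

Lemma cs_left_inj : injective cs_left.
Proof.
move=> x x' /quotient_by_eq/clos_relE[/(congr1 as_left)[]//|].
by case=> /relP[? [? []]].
Qed.

Lemma cs_right_inj : injective cs_right.
Proof.
move=> x x' /quotient_by_eq/clos_relE[/(congr1 as_right)[]//|].
by case=> /relP[? [? []]].
Qed.

Lemma cs_left_right x y : cs_left x = cs_right y <->
  exists w : frontier (~` U), val x = val w /\ val y = val (phi w).
Proof.
split=> [/quotient_by_eq/clos_relE[/(congr1 as_left)//|]|[w [h1 h2]]].
  by case=> /relP[x' [y' []]] //= [<-] [<-].
by apply/quotient_by_eq/clos_relE; right; left; exact: ConnectedSumRel h1 h2.
Qed.

Lemma connected_sum_cases z : (exists x, z = cs_left x) \/ (exists y, z = cs_right y).
Proof. by have [[[] u] <-] := quotient_by_onto z; [left|right]; exists u. Qed.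

Lemma connected_sum_open (A : set (connected_sum D)) :
  open A <-> open (cs_left @^-1` A) /\ open (cs_right @^-1` A).
Proof.
split=> [/quotient_by_open/sigT_openP h|[h1 h2]];
  first by split; [exact: (h true)|exact: (h false)].
by apply/quotient_by_open/sigT_openP => -[].
Qed.

Lemma frontier_closure (X : metricType R) (A : set X) x : frontier (~` A) x -> closure A x.
Proof. by rewrite /frontier interiorC => -[_] /contrapT. Qed.

Lemma cs_left_embedding : open_embedding cs_left [set x | ~ closure U (val x)].
Proof.
have oD : open [set x : ~` U | ~ closure U (val x)].
  apply: (@open_comp _ _ (val : ~` U -> P) (~` closure U)).
    by move=> x _; exact: initial_continuous.
  by apply: closed_openC; exact: closed_closure.
split => //.
- by move=> x y _ _ /cs_left_inj.
- by move=> A /connected_sum_open[h _]; exact: openI.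
- move=> A AD oA; apply/connected_sum_open; split.
    by rewrite (_ : _ @^-1` _ = A) //; apply/seteqP;
      split=> [x [y Ay /cs_left_inj <-]|x Ax] //; exists x.
  rewrite (_ : _ @^-1` _ = set0); first exact: open0.
  apply/seteqP; split=> // y [x /AD/= nx /cs_left_right[w [xw _]]].
  by apply: nx; rewrite xw; apply: frontier_closure; exact: set_valP.
Qed.

Lemma cs_right_embedding : open_embedding cs_right [set y | ~ closure W (val y)].
Proof.
have oD : open [set y : ~` W | ~ closure W (val y)].
  apply: (@open_comp _ _ (val : ~` W -> Q) (~` closure W)).
    by move=> x _; exact: initial_continuous.
  by apply: closed_openC; exact: closed_closure.
split => //.
- by move=> x y _ _ /cs_right_inj.
- by move=> A /connected_sum_open[_ h]; exact: openI.
- move=> A AD oA; apply/connected_sum_open; split; last first.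
    by rewrite (_ : _ @^-1` _ = A) //; apply/seteqP;
      split=> [x [y Ay /cs_right_inj <-]|x Ax] //; exists x.
  rewrite (_ : _ @^-1` _ = set0); first exact: open0.
  apply/seteqP; split=> // x [y /AD/= ny /esym/cs_left_right[w [_ yw]]].
  by apply: ny; rewrite yw; apply: frontier_closure; exact: set_valP.
Qed.

(** Away from the closed cone, the maps to [P] and to the sum are both open embeddings. *)
Lemma cs_left_locally_euclidean x : ~ closure U (val x) ->
  locally_euclidean R (cs_left x) <-> locally_euclidean R (val x).
Proof.
move=> nx; have vD : open_embedding (val : ~` U -> P) [set x | ~ closure U (val x)].
  apply: (@val_open_embedding _ _ _ (~` closure U)) => //.
    by apply: closed_openC; exact: closed_closure.
  by apply: subsetC; exact: subset_closure.
split=> h.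
  by apply: (locally_euclidean_image vD nx);
    apply: locally_euclidean_preimage cs_left_embedding nx h.
by apply: (locally_euclidean_image cs_left_embedding nx);
  apply: locally_euclidean_preimage vD nx h.
Qed.

Lemma cs_right_locally_euclidean y : ~ closure W (val y) ->
  locally_euclidean R (cs_right y) <-> locally_euclidean R (val y).
Proof.
move=> ny; have vD : open_embedding (val : ~` W -> Q) [set y | ~ closure W (val y)].
  apply: (@val_open_embedding _ _ _ (~` closure W)) => //.
    by apply: closed_openC; exact: closed_closure.
  by apply: subsetC; exact: subset_closure.
split=> h.
  by apply: (locally_euclidean_image vD ny);
    apply: locally_euclidean_preimage cs_right_embedding ny h.
by apply: (locally_euclidean_image cs_right_embedding ny);
  apply: locally_euclidean_preimage vD ny h.
Qed.

End connected_sum_topology.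

(** * Charts along the gluing locus *)

Section gluing_locus.
Variables (R : realType) (P Q : metricType R) (p : P) (q : Q) (D : connected_sum_data p q).
Variables (S S' : topologicalType) (hU : cone R S -> P) (hV : cone R S' -> Q).
Local Notation V := (R * R * R)%type.
Local Notation U := (csU D).
Local Notation W := (csV D).
Hypotheses (S_compact : compact [set: S]) (S'_compact : compact [set: S'])
  (hU_cont : continuous hU) (hU_inj : injective hU)
  (hU_open : forall A, open A -> open (hU @` A))
  (hV_cont : continuous hV) (hV_inj : injective hV)
  (hV_open : forall A, open A -> open (hV @` A))
  (UE : U = cone_nbhd hU) (WE : W = cone_nbhd hV).

Lemma frontierU x : frontier (~` U) x <-> exists s, x = hU (polar_pt s 1).
Proof. by rewrite UE; exact: frontier_cone_nbhd. Qed.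

Lemma frontierW y : frontier (~` W) y <-> exists s, y = hV (polar_pt s 1).
Proof. by rewrite WE; exact: frontier_cone_nbhd. Qed.

Lemma polar_pt1_continuous (T : topologicalType) :
  continuous (fun s : T => polar_pt (R := R) s 1).
Proof.
move=> s A nA; have [[B C] /= [nB nC] BC] := @polar_pt_continuous R T (s, 1) A nA.
apply: (@filterS _ (nbhs s) _ _ _ _ nB) => s' Bs'.
by apply: (BC (s', 1)); split => //=; exact: nbhs_singleton.
Qed.

Lemma level_homeomorphism (T : topologicalType) (X : metricType R) (A : set X)
  (h : cone R T -> X) :
  compact [set: T] -> continuous h -> injective h ->
  (forall x, A x <-> exists s, x = h (polar_pt s 1)) ->
  exists J : T -> A, is_homeomorphism J /\ forall s, val (J s) = h (polar_pt s 1).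
Proof.
move=> cT hc hi hA.
have JA s : A (h (polar_pt s 1)) by apply/hA; exists s.
pose J s : A := exist _ (h (polar_pt s 1)) (mem_set (JA s)).
exists J; split => //; apply: compact_homeomorphism => //.
- apply: continuous_comp_initial => s A' nA.
  have nh : nbhs (polar_pt s 1) (h @^-1` A') by exact: hc.
  exact: polar_pt1_continuous nh.
- by move=> s s' /(congr1 val)/hi/(polar_pt_inj ltr01 ler01)[].
- move=> y; have [s ys] := (hA (val y)).1 (set_valP y).
  by exists s; apply: val_inj; rewrite /= -ys.
Qed.

(** Both frontiers are the level 1 of a cone, so the gluing map becomes a homeomorphism of the bases
    and can be continued to all radii. *)
Lemma gluing_homeomorphism : exists k : S -> S', is_homeomorphism k /\
  forall (w : frontier (~` U)) s, val w = hU (polar_pt s 1) ->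
    val (cs_phi w) = hV (polar_pt (k s) 1).
Proof.
have [J [hJ JE]] := level_homeomorphism S_compact hU_cont hU_inj frontierU.
have [J' [hJ' J'E]] := level_homeomorphism S'_compact hV_cont hV_inj frontierW.
have [K [hK KJ JK]] := is_homeomorphism_inv hJ'.
exists (K \o (@cs_phi _ _ _ _ _ D \o J)); split.
  apply: is_homeomorphism_comp hK; apply: is_homeomorphism_comp hJ _; exact: cs_phi_homeo.
move=> w s ws; rewrite -J'E /= JK; congr (val (cs_phi _)); apply: val_inj.
by rewrite JE.
Qed.

Let notU s t : 0 <= t -> (~` U) (hU (polar_pt s t)) <-> 1 <= t.
Proof.
move=> t0; rewrite /setC /= UE; split.
  by move=> h; rewrite leNgt; apply/negP => t1; apply: h; apply/cone_nbhd_polar.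
by move=> t1 /(cone_nbhd_polar hU_inj _ t0); rewrite ltNge t1.
Qed.

Let notW s t : 0 <= t -> (~` W) (hV (polar_pt s t)) <-> 1 <= t.
Proof.
move=> t0; rewrite /setC /= WE; split.
  by move=> h; rewrite leNgt; apply/negP => t1; apply: h; apply/cone_nbhd_polar.
by move=> t1 /(cone_nbhd_polar hV_inj _ t0); rewrite ltNge t1.
Qed.

(* The two collars of the gluing locus form a bicollar: the chart is [|x| >= 1]
   on the side of [P] and, reflected radially, [|x| <= 1] on the side of [Q]. *)
Lemma glued_point_locally_euclidean (d : V -> S) (x0 : ~` U) : radial d ->
  frontier (~` U) (val x0) -> locally_euclidean R (cs_left x0).
Proof.
move=> hd fx0; have [d_onto _ _ _ _] := hd.
have [k [hk kE]] := gluing_homeomorphism.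
have hkd := radial_homeomorphism hd hk.
have [s0 xs0] := (frontierU _).1 fx0; have [v [v1 dv]] := d_onto s0.
pose y0 : ~` W := exist _ (hV (polar_pt (k s0) 1)) (mem_set ((notW (k s0) ler01).2 (lexx 1))).
(* Radius 1 / 2 keeps [B] in the half-space of [v] and its radii in ]1/2, 3/2[, where both |x| and 2
   - |x| are positive. *)
pose B : set V := [set x | nrm (x - v) < 1 / 2].
have oB : open B by exact: open_nrm_ball.
have Bn x : B x -> [/\ 0 < dot x v, 1 / 2 < nrm x & nrm x < 3 / 2].
  rewrite /B /= => h; have := nrm_dist x v; rewrite (unit_nrm v1) ler_norml => /andP[n1 n2].
  have := CauchySchwarz (x - v) v; rewrite dotBl v1 (unit_nrm v1) mulr1 ler_norml
    => /andP[c1 c2].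
  by split; lra.
pose al x := hU (polar_pt (d x) (flip false (nrm x))).
pose be x := hV (polar_pt (k (d x)) (flip true (nrm x))).
have al_emb : open_embedding al B.
  have e : open_embedding (fun x => polar_pt (d x) (flip false (nrm x))) B.
    by apply: (cone_chart (w := v)) => // x /Bn[? ? ?]; split => //; rewrite /flip; lra.
  have := open_embedding_comp e (h_embedding hU_cont hU_inj hU_open).
  by rewrite preimage_setT setIT.
have be_emb : open_embedding be B.
  have e : open_embedding (fun x => polar_pt ((k \o d) x) (flip true (nrm x))) B.
    by apply: (cone_chart (w := v)) => // x /Bn[? ? ?]; split => //; rewrite /flip; lra.
  have := open_embedding_comp e (h_embedding hV_cont hV_inj hV_open).
  by rewrite preimage_setT setIT.
have [_ al_inj al_cont al_open] := al_emb; have [_ be_inj be_cont be_open] := be_emb.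
have alU x : (~` U) (al x) <-> 1 <= nrm x by rewrite /al; apply: notU; exact: nrm_ge0.
have beW x : B x -> (~` W) (be x) <-> nrm x <= 1.
  move=> /Bn[_ _ n]; rewrite /be (notW _ (_ : 0 <= flip true (nrm x))) /flip; last by lra.
  by split; lra.
pose L x := cs_left (insubd x0 (al x)); pose T x := cs_right (insubd y0 (be x)).
have LE x : 1 <= nrm x -> val (insubd x0 (al x)) = al x.
  by move=> /alU h; rewrite insubdK // inE.
have TE x : B x -> nrm x <= 1 -> val (insubd y0 (be x)) = be x.
  by move=> Bx n; rewrite insubdK // inE; apply/beW.
(* On the unit sphere the two half-charts agree by the gluing relation itself. *)
have LT x : B x -> nrm x = 1 -> L x = T x.
  move=> Bx n1; apply/cs_left_right; rewrite LE ?n1 // TE ?n1 //.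
  have fa : frontier (~` U) (al x) by apply/frontierU; exists (d x); rewrite /al /flip n1.
  exists (exist _ (al x) (mem_set fa)); split => //.
  rewrite (kE _ (d x)); last by rewrite /= /al /flip n1.
  by rewrite /be /flip n1 (_ : 2 - 1 = 1 :> R) //; ring.
pose e x := if 1 <= nrm x then L x else T x.
have eT x : B x -> nrm x <= 1 -> e x = T x.
  by move=> Bx n; rewrite /e; case: ifP => // n'; apply: LT => //; apply/le_anti; rewrite n n'.
have frontier1 x : frontier (~` U) (al x) -> nrm x = 1.
  move=> /frontierU[s /hU_inj]; have [->|n0] := eqVneq (nrm x) 0.
    by move=> /(polar_pt_apex ler01)/eqP; rewrite oner_eq0.
  by move/polar_pt_inj; case; rewrite ?lt_neqAle 1?eq_sym ?n0 ?nrm_ge0 ?ler01.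
have frontier1' x : B x -> frontier (~` W) (be x) -> nrm x = 1.
  move=> Bx /frontierW[s /hV_inj/polar_pt_inj].
  have [_ _ n] := Bn x Bx.
  by rewrite /flip; case; [lra|exact: ler01|move=> _; lra].
exists e, B; split; last by exists v; rewrite /= ?/B /= ?subrr ?nrm0 ?divr_gt0 // /e
  unit_nrm // lexx
   /L; congr cs_left; apply: val_inj; rewrite LE ?unit_nrm // /al dv /flip unit_nrm.
split => //.
- move=> x y; rewrite !inE => Bx By; rewrite /e; case: ifP => nx; case: ifP => ny.
  + move=> /cs_left_inj/(congr1 val); rewrite !LE //; by apply: al_inj; rewrite inE.
  + move=> /cs_left_right[w [_ yw]]; have [_ _ n] := Bn y By.
    have fy : frontier (~` W) (be y).
      by rewrite -(TE y) // ?yw; [exact: set_valP|rewrite leNgt; apply/negP => h;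
        rewrite ltW in ny].
    by have := frontier1' y By fy; move: ny => /negbT; rewrite -ltNge => + h; rewrite h ltxx.
  + move=> /esym/cs_left_right[w [_ yw]].
    have fx : frontier (~` W) (be x).
      by rewrite -(TE x) // ?yw; [exact: set_valP|rewrite leNgt; apply/negP => h;
        rewrite ltW in nx].
    by have := frontier1' x Bx fx; move: nx => /negbT; rewrite -ltNge => + h; rewrite h ltxx.
  + move: nx ny => /negbT + /negbT; rewrite -!ltNge => nx ny.
    by move=> /cs_right_inj/(congr1 val); rewrite !TE ?ltW //; apply: be_inj; rewrite inE.
- move=> O oO; have [/= [W1 oW1 W1E] [W2 oW2 W2E]] := (connected_sum_open O).1 oO.
  rewrite openE => x [Bx Ox].
  have nearB : nbhs x B by exact: open_nbhs_nbhs.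
  (* The two half-charts are tested separately; if x lies strictly on the other side of the sphere,
     the condition is vacuous near x. *)
  have near1 : nbhs x [set y | 1 <= nrm y -> O (L y)].
    have [n|n] := leP 1 (nrm x).
      have ax : (B `&` al @^-1` W1) x.
        split => //=; rewrite -(LE x n); suff : (val @^-1` W1) (insubd x0 (al x)) by [].
        by rewrite W1E /=; move: Ox; rewrite /e /= n.
      have : nbhs x (B `&` al @^-1` W1) by apply: open_nbhs_nbhs; split => //; exact: al_cont.
      apply: filterS => y [By Wy] ny; suff : (@cs_left _ _ _ _ _ D @^-1` O) (insubd x0 (al y))
        by [].
      by rewrite -W1E; change (W1 (val (insubd x0 (al y)))); rewrite LE.
    apply/nbhs_nrmP; exists (1 - nrm x) => [|y yx ny]; first by rewrite subr_gt0.
    by have := nrm_dist y x; rewrite ler_norml; lra.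
  have near2 : nbhs x [set y | B y -> nrm y <= 1 -> O (T y)].
    have [n|n] := leP (nrm x) 1.
      have bx : (B `&` be @^-1` W2) x.
        split => //=; rewrite -(TE x Bx n); suff : (val @^-1` W2) (insubd y0 (be x)) by [].
        by rewrite W2E /= -/(T x) -eT.
      have : nbhs x (B `&` be @^-1` W2) by apply: open_nbhs_nbhs; split => //; exact: be_cont.
      apply: filterS => y [By Wy] _ ny; suff : (@cs_right _ _ _ _ _ D @^-1` O) (insubd y0 (be y))
        by [].
      by rewrite -W2E; change (W2 (val (insubd y0 (be y)))); rewrite TE.
    apply/nbhs_nrmP; exists (nrm x - 1) => [|y yx _ ny]; first by rewrite subr_gt0.
    by have := nrm_dist y x; rewrite ler_norml; lra.
  apply: filterS2 (filterI nearB near1) near2 => y [By h1] h2; split => //=.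
  by rewrite /e; case: leP => n; [exact: h1|exact: h2 By (ltW n)].
- move=> A AB oA; apply/connected_sum_open; split.
    rewrite (_ : _ @^-1` _ = (val : ~` U -> P) @^-1` (al @` A)).
      apply: (@open_comp _ _ (val : ~` U -> P)); last exact: al_open.
      by move=> x _; exact: initial_continuous.
    apply/seteqP; split=> z /= [x Ax].
      rewrite /e; case: leP => n.
        by move=> /cs_left_inj <-; exists x; rewrite ?LE.
      move=> /esym/cs_left_right[w [_]]; rewrite TE ?(ltW n) //; last exact: AB.
      move=> bw; have : frontier (~` W) (be x) by rewrite bw; exact: set_valP.
      by move/(frontier1' x (AB x Ax)) => h; rewrite h ltxx in n.
    move=> az; have n : 1 <= nrm x by apply/alU; rewrite az; exact: set_valP.
    by exists x => //; rewrite /e n; congr cs_left; apply: val_inj; rewrite LE.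
  rewrite (_ : _ @^-1` _ = (val : ~` W -> Q) @^-1` (be @` A)).
    apply: (@open_comp _ _ (val : ~` W -> Q)); last exact: be_open.
    by move=> x _; exact: initial_continuous.
  apply/seteqP; split=> z /= [x Ax]; have Bx := AB x Ax.
    rewrite /e; case: leP => n; last first.
      by move=> /cs_right_inj <-; exists x; rewrite ?TE // ltW.
    move=> /cs_left_right[w []]; rewrite LE // => aw.
    have n1 : nrm x = 1 by apply: frontier1; rewrite aw; exact: set_valP.
    move=> zw; exists x => //; rewrite zw (kE _ (d x)); last by rewrite -aw /al /flip n1.
    by rewrite /be /flip n1; congr (hV (polar_pt _ _)); ring.
  move=> bz; have n : nrm x <= 1 by apply/(beW x Bx); rewrite bz; exact: set_valP.
  by exists x => //; rewrite eT // /T; congr cs_right; apply: val_inj; rewrite TE.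
Qed.

End gluing_locus.

(** * Non-manifold points of a connected sum *)

Section singular_points_of_connected_sum.
Variables (R : realType) (X : metricType R) (b : bool) (r : R).
Local Notation V := (R * R * R)%type.
Variable g : V -> X.
Hypothesis g_chart : flat_chart b r g.
Variable D : connected_sum_data (g 0) (g 0).
Local Notation LE := (@locally_euclidean R _).

(** A relation rather than a map, because the points of the removed cone have no image. *)
Definition on_side (c : bool) (x : X) (z : connected_sum D) : Prop :=
  if c then exists u : ~` csU D, val u = x /\ z = cs_left u
  else exists u : ~` csV D, val u = x /\ z = cs_right u.

Lemma on_side_fun c x z z' : on_side c x z -> on_side c x z' -> z = z'.
Proof.
by case: c => -[u [ux ->]] [u' [ux' ->]]; congr (_ _); apply: val_inj; rewrite ux ux'.
Qed.

Lemma cone_nbhd_data U : regular_cone_nbhd (g 0) U ->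
  exists (S : metricType R) (h : cone R S -> X) (d : V -> S),
    [/\ compact [set: S], continuous h, injective h,
        forall A, open A -> open (h @` A) &
        [/\ U = cone_nbhd h, radial d & forall s, h (polar_pt s 0) = g 0]].
Proof.
move=> [S [Sp [h [h1 h2 h3 h4 h5]]]]; have [f fS] := directions_spherical g_chart Sp.
exists S, h, (fun x => f ((nrm x)^-1 *: x)); split => //; first exact: spherical_compact fS.
split => //; first exact: spherical_radial fS.
by move=> s; apply: h4; rewrite /= normr0.
Qed.

Lemma apex_in_cone_nbhd U : regular_cone_nbhd (g 0) U -> U (g 0).
Proof.
move=> /cone_nbhd_data[S [h [d [h1 h2 h3 h4 [-> [d_onto _ _ _ _] h0]]]]].
by rewrite -(h0 (d 0)); apply/cone_nbhd_polar; rewrite ?ltr01.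
Qed.

(** Off its apex a cone is a cylinder over a surface, so only the apex could fail to be a manifold
    point. *)
Lemma cone_nbhd_regular U x : LE (g 0) -> regular_cone_nbhd (g 0) U -> closure U x -> LE x.
Proof.
move=> l0 /cone_nbhd_data[S [h [d [h1 h2 h3 h4 [-> hd h0]]]]].
move=> /(closure_cone_nbhd h1 h2 h3)[s [t [/andP[t0 _] ->]]].
have [->|tn] := eqVneq t 0; first by rewrite h0.
by apply: (cone_nbhd_locally_euclidean h2 h3 h4 _ hd); rewrite lt_neqAle eq_sym tn.
Qed.

Lemma singular_on_side c x : LE (g 0) -> ~ LE x -> exists2 z, on_side c x z & ~ LE z.
Proof.
move=> l0 nx; have nc U : regular_cone_nbhd (g 0) U -> ~ closure U x.
  by move=> hU /(cone_nbhd_regular l0 hU).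
case: c => /=.
  have nU := nc _ (csU_cone D); have xU : (~` csU D) x by move/subset_closure.
  exists (cs_left (exist _ x (mem_set xU))); first by exists (exist _ x (mem_set xU)).
  by rewrite cs_left_locally_euclidean.
have nU := nc _ (csV_cone D); have xU : (~` csV D) x by move/subset_closure.
exists (cs_right (exist _ x (mem_set xU))); first by exists (exist _ x (mem_set xU)).
by rewrite cs_right_locally_euclidean.
Qed.

(** The two sides meet only in the gluing locus, which consists of manifold points of [X] when the
    apex is regular. *)
Lemma on_side_inj c x c' x' z : LE (g 0) -> ~ LE x -> ~ LE x' ->
  on_side c x z -> on_side c' x' z -> c = c' /\ x = x'.
Proof.
move=> l0 nx nx'; have fr U y : regular_cone_nbhd (g 0) U -> frontier (~` U) y -> LE y.
  by move=> hU /frontier_closure; exact: cone_nbhd_regular.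
case: c; case: c' => -[u [ux ->]] [u' [ux' +]].
- by move=> /cs_left_inj e; rewrite -ux -ux' e.
- move=> /cs_left_right[w [uw _]]; case: nx; rewrite -ux uw.
  by apply: (fr _ _ (csU_cone D)); exact: (set_valP w).
- move=> /esym/cs_left_right[w [uw _]]; case: nx'; rewrite -ux' uw.
  by apply: (fr _ _ (csU_cone D)); exact: (set_valP w).
- by move=> /cs_right_inj e; rewrite -ux -ux' e.
Qed.

(** Gluing points are manifold points of the sum whatever the type of the apex, and the apex itself
    has been removed on both sides. *)
Lemma singular_from_side z : ~ LE z ->
  exists c x, [/\ on_side c x z, ~ LE x & x <> g 0].
Proof.
move=> nz.
have [S [h [d [h1 h2 h3 h4 [UE hd h0]]]]] := cone_nbhd_data (csU_cone D).
have [S' [h' [d' [h1' h2' h3' h4' [WE hd' h0']]]]] := cone_nbhd_data (csV_cone D).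
have glued (x : ~` csU D) : frontier (~` csU D) (val x) -> LE (cs_left x).
  move=> fx; exact: (glued_point_locally_euclidean h1 h1' h2 h3 h4 h2' h3' h4' UE WE hd fx).
have closE (U : set X) y : open U -> ~ U y -> closure U y -> frontier (~` U) y.
  move=> oU nU cU; rewrite /frontier interiorC; split; last by move=> h''; exact: h''.
  exact: subset_closure.
have oU : open (csU D) by rewrite UE; exact: cone_nbhd_open.
have oW : open (csV D) by rewrite WE; exact: cone_nbhd_open.
have [[u zu]|[u zu]] := connected_sum_cases z.
  have nu : ~ csU D (val u) := set_valP u.
  have ncu : ~ closure (csU D) (val u).
    by move=> cu; apply: nz; rewrite zu; apply: glued; exact: closE.
  exists true, (val u); split; first by exists u.
    by move=> l; apply: nz; rewrite zu; apply/cs_left_locally_euclidean.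
  by move=> e; apply: nu; rewrite e; exact: apex_in_cone_nbhd (csU_cone D).
have nu : ~ csV D (val u) := set_valP u.
have ncu : ~ closure (csV D) (val u).
  move=> cu; apply: nz; rewrite zu.
  (* A frontier point of the right side is glued to one of the left side, where the chart was
     built. *)
  have fu : frontier (~` csV D) (val u) by exact: closE.
  have [_ [k [_ kK _]]] := cs_phi_homeo D.
  pose w := k (exist _ (val u) (mem_set fu)).
  have nw : (~` csU D) (val w).
    have [+ _] := set_valP w.
    by have /closure_id <- : closed (~` csU D) by exact: open_closedC.
  have <- : cs_left (exist _ (val w) (mem_set nw)) = cs_right u.
    by apply/cs_left_right; exists w; rewrite kK.
  by apply: glued; exact: (set_valP w).
exists false, (val u); split; first by exists u.
  by move=> l; apply: nz; rewrite zu; apply/cs_right_locally_euclidean.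
by move=> e; apply: nu; rewrite e; exact: apex_in_cone_nbhd (csV_cone D).
Qed.

End singular_points_of_connected_sum.

Lemma finite_injection_onto (T : choiceType) (A : set T) (f : T -> T) :
  finite_set A -> {in A &, injective f} -> f @` A `<=` A -> A `<=` f @` A.
Proof.
move=> fA fi fsub; have ffA : finite_set (f @` A) by exact: finite_image.
have /(fcard_eq ffA fA) e : (f @` A #= A)%card by exact: inj_card_eq.
have sub : (fset_set (f @` A) `<=` fset_set A)%fset by rewrite -fset_set_sub.
have /eqP E : fset_set (f @` A) == fset_set A by rewrite eqEfcard sub e leqnn.
move=> x Ax; have : x \in fset_set A by rewrite in_fset_set // inE.
by rewrite -E in_fset_set // inE.
Qed.

(** * Comparing the singular points of the two sums *)

Section flat_orbifold_singular_points.
Variables (R : realType) (X : metricType R) (pr : R * R * R -> X).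
Hypothesis pr_onto : forall x, exists v, pr v = x.
Hypothesis pr_dist : forall v w, mdist (pr v) (pr w) = flat_dist v w.

Lemma flat_orbifold_singular_finite : finite_set [set x : X | ~ locally_euclidean R x].
Proof.
(* A singular orbit has a representative whose coordinates are half-integers in [-1, 1], which
   leaves five values for each. *)
pose c (i : 'I_5) : R := i%:R / 2 - 1.
pose F (t : 'I_5 * 'I_5 * 'I_5) := pr (c t.1.1, c t.1.2, c t.2).
apply: (@sub_finite_set _ _ (F @` setT)); last by apply: finite_image; exact: finite_finset.
move=> x nx; have [v vx] := pr_onto x.
have [w /(pr_eq pr_dist) vw [w1 w2 w3]] := orb_cube v.
have [r hr] := flat_orbifold_chart pr_onto pr_dist w.
have hl : lattice (2 *: w).
  apply: contrapT => /negP/negbTE hl; rewrite hl in hr; apply: nx.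
  by have := regular_point_locally_euclidean hr; rewrite addr0 -vw vx.
have coord (t : R) : 2 * t \is a Num.int -> `|t| <= 1 -> exists i, c i = t.
  move=> /intrP[m mE]; rewrite ler_norml => /andP[t1 t2].
  have m1 : (-2 <= m)%R by rewrite -(ler_int R) -mE; lra.
  have m2 : (m <= 2)%R by rewrite -(ler_int R) -mE; lra.
  have m0 : (0 <= m + 2)%R by lia.
  pose n := absz (m + 2)%R; have nE : n%:Z = m + 2 by exact: gez0_abs.
  have n5 : (n < 5)%N by move: nE; clearbody n; lia.
  exists (Ordinal n5); rewrite /c /= -[n%:R]/((n%:Z)%:~R) nE intrD -mE.
  by field.
case/and3P: hl => /= l1 l2 l3.
have [i ci] := coord _ l1 w1; have [j cj] := coord _ l2 w2; have [k ck] := coord _ l3 w3.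
by exists (i, j, k) => //; rewrite /F /= ci cj ck -vx vw;
  case: w {vw w1 w2 w3 hr l1 l2 l3 ci cj ck} => [[]].
Qed.

Lemma pr0_singular : ~ locally_euclidean R (pr 0).
Proof.
have [r] := flat_orbifold_chart pr_onto pr_dist 0.
rewrite scaler0 lattice0 => hr; have := singular_point_not_locally_euclidean hr.
by rewrite addr0.
Qed.

Lemma pr_quarter_regular : locally_euclidean R (pr (1 / 4, 1 / 4, 1 / 4)).
Proof.
have [r] := flat_orbifold_chart pr_onto pr_dist (1 / 4, 1 / 4, 1 / 4).
rewrite quarter_not_lattice => hr; have := regular_point_locally_euclidean hr.
by rewrite addr0.
Qed.

(** The same cone neighbourhood is taken on both sides and glued by the identity. *)
Lemma connected_sum_data_exists v : homeomorphic_directions (pr v) (pr v) /\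
  inhabited (connected_sum_data (pr v) (pr v)).
Proof.
have [r hr] := flat_orbifold_chart pr_onto pr_dist v.
have [S [f fS]] := spherical_exists R (lattice (2 *: v)).
have id_homeo (T : topologicalType) : is_homeomorphism (id : T -> T).
  by split; [move=> x; exact: cvg_id|exists id; split => // x; exact: cvg_id].
split.
  exists S, S; split; [| |by exists id].
  - by have := spherical_directions hr fS; rewrite addr0.
  - by have := spherical_directions hr fS; rewrite addr0.
have [U] := regular_cone_nbhd_exists hr fS; rewrite addr0 => hU.
constructor; apply: (@Build_connected_sum_data _ _ _ _ _ U U hU hU id).
exact: id_homeo.
Qed.

(* A homeomorphism would inject two copies of the singular set into two copies
   with a singular point removed from each. *)
Lemma connected_sums_not_homeomorphic v w : ~ locally_euclidean R (pr v) ->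
  locally_euclidean R (pr w) ->
  forall (D1 : connected_sum_data (pr v) (pr v)) (D2 : connected_sum_data (pr w) (pr w)),
    ~ homeomorphic (connected_sum D1) (connected_sum D2).
Proof.
have [r1 h1] := flat_orbifold_chart pr_onto pr_dist v.
have [r2 h2] := flat_orbifold_chart pr_onto pr_dist w.
pose g1 u := pr (v + u); pose g2 u := pr (w + u).
have e1 : g1 0 = pr v by rewrite /g1 addr0.
have e2 : g2 0 = pr w by rewrite /g2 addr0.
rewrite -e1 -e2 => sv lw D1 D2 [k hk].
pose N := [set x : X | ~ locally_euclidean R x].
pose A := [set bx : bool * X | N bx.2].
have fA : finite_set A.
  rewrite (_ : A = setT `*` N); last by apply/seteqP; split=> [[c x]|[c x] []].
  by apply: finite_setX; [exact: finite_finset|exact: flat_orbifold_singular_finite].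
have hk' z : locally_euclidean R (k z) <-> locally_euclidean R z
  by exact: locally_euclidean_homeo.
have [_ [k' [kk' k'k _]]] := hk.
have [z0 _ _] := singular_on_side h2 D2 true lw sv.
have /choice[i iE] (bx : bool * X) : exists z : connected_sum D2, N bx.2 ->
    on_side bx.1 bx.2 z /\ ~ locally_euclidean R z.
  have [nx|] := pselect (N bx.2); last by exists z0.
  by have [z h nz] := singular_on_side h2 D2 bx.1 lw nx; exists z.
have /choice[j jE] (z : connected_sum D1) : exists bx : bool * X, ~ locally_euclidean R z ->
    [/\ on_side bx.1 bx.2 z, N bx.2 & bx.2 <> g1 0].
  have [lz|nz] := pselect (locally_euclidean R z); first by exists (true, g1 0).
  by have [c [x [h nx xv]]] := singular_from_side h1 nz; exists (c, x).
(* A labelled singular point goes to the sum at the regular point, back through the homeomorphism,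
   and then to the label and origin of its image; the removed apex is never reached. *)
pose f bx := j (k' (i bx)).
have fN bx : N bx.2 -> ~ locally_euclidean R (k' (i bx)).
  by move=> /iE[_ nz] l; apply: nz; rewrite -(k'k (i bx)); apply/hk'.
have fi : {in A &, injective f}.
  move=> [c x] [c' x']; rewrite !inE => nx nx' e.
  have [s1 _ _] := jE _ (fN _ nx); have [s2 _ _] := jE _ (fN _ nx').
  rewrite -/(f _) e in s1; have := on_side_fun s1 s2 => /(can_inj k'k) ee.
  have [t1 _] := iE _ nx; have [t2 _] := iE _ nx'; rewrite ee in t1.
  by have [/= -> ->] := on_side_inj h2 lw nx nx' t1 t2.
have fsub : f @` A `<=` A by move=> _ [bx nx <-]; have [] := jE _ (fN _ nx).
have Asv : A (true, g1 0) by exact: sv.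
have [bx nx fE] := finite_injection_onto fA fi fsub Asv.
by have [_ _] := jE _ (fN _ nx); rewrite -/(f bx) fE.
Qed.

End flat_orbifold_singular_points.

Theorem theorem1 (R : realType) :
  exists (P Q : metricType R) (p1 p2 : P) (q1 q2 : Q),
    [/\ closed_alexandrov3 P, ~ topological_manifold R 3 P,
        closed_alexandrov3 Q & ~ topological_manifold R 3 Q] /\
    [/\ homeomorphic_directions p1 q1, homeomorphic_directions p2 q2,
        inhabited (connected_sum_data p1 q1),
        inhabited (connected_sum_data p2 q2) &
        forall (D1 : connected_sum_data p1 q1) (D2 : connected_sum_data p2 q2),
          ~ homeomorphic (connected_sum D1) (connected_sum D2)].
Proof.
have dxx (v : R * R * R) : flat_dist v v = 0 by apply/flat_dist_eq0; exact: orb_refl.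
have [X [pr [pr_onto pr_dist]]] :=
  metric_quotient_exists dxx (@flat_dist_sym R) (@flat_dist_triangle R).
have alex := flat_orbifold_alexandrov3 pr_onto pr_dist.
have sing := pr0_singular pr_onto pr_dist.
have reg := pr_quarter_regular pr_onto pr_dist.
have nman : ~ topological_manifold R 3 X.
  by move=> /manifold_locally_euclidean/(_ (pr 0)).
have [d1 c1] := connected_sum_data_exists pr_onto pr_dist 0.
have [d2 c2] := connected_sum_data_exists pr_onto pr_dist (1 / 4, 1 / 4, 1 / 4).
exists X, X, (pr 0), (pr (1 / 4, 1 / 4, 1 / 4)), (pr 0), (pr (1 / 4, 1 / 4, 1 / 4)).
split; split => //.
exact: (connected_sums_not_homeomorphic pr_onto pr_dist sing reg).
Qed.
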